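(* Let $S\subseteq\mathbb R^d$ and let $\mathcal S(S)$ be the set of group-like elements of $T((\mathbb R^d))$ with first level in $S$ (defined in the context). (a) Let $\mathbb X$ be a continuous $\mathcal S(S)$-valued $\mathcal U$-affine process with associated map $R:\mathcal U\to\mathcal S(S)^*$. Then $\mathbb X$ is an $\mathcal S(S)$-valued $\mathcal V$-polynomial process with $\mathcal V:=\mathrm{Span}\{\exp_\sqcup(\mathbf u):\mathbf u\in\mathcal U\}$ and with associated map $L:\mathcal V\to\mathcal S(S)^*$ satisfying $$L(\exp_\sqcup(\mathbf u))=\exp_\sqcup(\mathbf u)\sqcup R(\mathbf u),\qquad\mathbf u\in\mathcal U.$$ (b) Let $\mathbb X$ be a continuous $\mathcal S(S)$-valued $\mathcal U$-polynomial process with associated map $L:\mathcal U\to\mathcal S(S)^*$. Assume that $\mathbf u\sqcup\mathbf u\in\mathcal U$ for each $\mathbf u\in\mathcal U$. Then $\mathbb X$ is an $\mathcal S(S)$-valued $\mathcal U$-affine process with associated map $R:\mathcal U\to\mathcal S(S)^*$ satisfying $$R(\mathbf u)=L(\mathbf u)+\tfrac12L(\mathbf u\sqcup\mathbf u)-\mathbf u\sqcup L(\mathbf u),\qquad\mathbf u\in\mathcal U.$$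
   Context: Tensor algebra. $T((\mathbb R^d))$ is the set of sequences $\mathbf a=(a_0,a_1,\dots)$ with $a_n\in(\mathbb R^d)^{\otimes n}$, $(\mathbb R^d)^{\otimes 0}=\mathbb R$; $T(\mathbb R^d)$ is the subset of sequences with finitely many nonzero entries; $T_{\mathbb C}((\mathbb R^d)):=T((\mathbb R^d))+\mathrm iT((\mathbb R^d))$. For a multi-index $I=(i_1,\dots,i_n)\in\{1,\dots,d\}^n$, $|I|:=n$ and $e_I:=e_{i_1}\otimes\cdots\otimes e_{i_n}$; the empty multi-index $\emptyset$ has length $0$ and $e_\emptyset=(1,0,0,\dots)$. $\mathbf a_I=\langle e_I,\mathbf a\rangle$ is the coefficient of $e_I$; $\pi_n(\mathbf a):=a_n$; $\mathbf a^{\le N}:=(a_0,\dots,a_N,0,\dots)$; $\langle\mathbf a,\mathbf b\rangle=\sum_I\mathbf a_I\mathbf b_I$ (bilinear) if one of them is in $T(\mathbb R^d)$. $I'$ is $I$ without its last letter. Shuffle product $\sqcup$: $e_I\sqcup e_\emptyset=e_\emptyset\sqcup e_I=e_I$, and $e_I\sqcup e_J=(e_{I'}\sqcup e_J)\otimes e_{i_n}+(e_I\sqcup e_{J'})\otimes e_{j_m}$ for $I=(i_1,\dots,i_n)$, $J=(j_1,\dots,j_m)$; extended bilinearly to $T(\mathbb R^d)$ and to $T_{\mathbb C}((\mathbb R^d))$ by $\langle e_I,\mathbf a\sqcup\mathbf b\rangle=\langle e_I,\mathbf a^{\le|I|}\sqcup\mathbf b^{\le|I|}\rangle$. Set $\mathbf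 u^{\sqcup0}=e_\emptyset$, $\mathbf u^{\sqcup k}=\mathbf u^{\sqcup(k-1)}\sqcup\mathbf u$ and $\exp_\sqcup(\mathbf u):=\sum_{k\ge0}\mathbf u^{\sqcup k}/k!$ (componentwise; equal to $e^{\mathbf u_\emptyset}\sum_k(\mathbf u-\mathbf u_\emptyset e_\emptyset)^{\sqcup k}/k!$). State space. $\mathcal S(S):=\{\mathbf x\in T((\mathbb R^d)):\pi_1(\mathbf x)\in S,\ \mathbf x_\emptyset=1,\ \mathbf x_I\mathbf x_J=\langle e_I\sqcup e_J,\mathbf x\rangle\ \forall I,J\}$ (with the trace of the product sigma-algebra). Fix a partition $\Pi=\{\Pi_1,\Pi_2,\dots\}$ of the set of all multi-indices, each $\Pi_k$ containing only indices of equal length, which is shuffle-compatible: for all $k_1,k_2$ there is $k$ such that for all $I_1\in\Pi_{k_1},I_2\in\Pi_{k_2}$, $e_{I_1}\sqcup e_{I_2}=\sum_{I\in\Pi_k}\lambda_Ie_I$ for some $\lambda_I\in\mathbb R$. Set $|\mathbf u|_{\mathbf x}:=\sum_{k\ge1}|\sum_{I\in\Pi_k}\mathbf u_I\mathbf x_I|$, $\mathcal S(S)^*:=\{\mathbf u\in T_{\mathbb C}((\mathbb R^d)):|\mathbf u|_{\mathbf x}<\infty\ \forall\mathbf x\in\mathcal S(S)\}$, and $\langle\mathbf u,\mathbf x\rangle:=\lim_{N\to\infty}\sum_{n=0}^N\langle\pi_n(\mathbf u),\pi_n(\mathbf x)\rangle$ for $\mathbf u\in\mathcal S(S)^*$,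 $\mathbf x\in\mathcal S(S)$. Martingale problem. Let $M(\mathcal S(S))$ be the set of maps $\mathcal S(S)\to\mathbb C$, $D(\mathcal L)\subseteq M(\mathcal S(S))$ a linear subset and $\mathcal L:D(\mathcal L)\to M(\mathcal S(S))$ linear; fix a filtered probability space with right-continuous filtration. An $\mathcal S(S)$-valued process $(\mathbb X_t)_{t\in[0,T]}$ solves the martingale problem for $\mathcal L$ if (1) $\mathbb X_0=\mathbf x$ for some $\mathbf x\in\mathcal S(S)$; (2) there is a version of $\mathbb X$ such that $(f(\mathbb X_t))_t$ and $(\mathcal Lf(\mathbb X_t))_t$ are adapted càdlàg processes for every $f\in D(\mathcal L)$; (3) $f(\mathbb X_t)-f(\mathbb X_0)-\int_0^t\mathcal Lf(\mathbb X_s)ds$ is a local martingale for every $f\in D(\mathcal L)$. Affine: for $\mathcal U\subseteq\mathcal S(S)^*$ and $D(\mathcal L)=\mathrm{Span}\{\mathbf x\mapsto\exp(\langle\mathbf u,\mathbf x\rangle):\mathbf u\in\mathcal U\}$, a linear operator $\mathcal L:D(\mathcal L)\to M(\mathcal S(S))$ is of $\mathcal U$-affine type if there is $R:\mathcal U\to\mathcal S(S)^*$ (the associated map) with $\mathcal L\exp(\langle\mathbf u,\cdot\rangle)(\mathbf x)=\exp(\langle\mathbf u,\mathbf x\rangle)\langle R(\mathbf u),\mathbf x\rangle$ for all $\mathbf u\in\mathcal U$, $\mathbf x\in\mathcal S(S)$; a solution of its martingale problem is an $\mathcal S(S)$-valued $\mathcal U$-affine process. Polynomial: for a linear subset $\mathcal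 U\subseteq\mathcal S(S)^*$ and $D(\mathcal L)=\{\mathbf x\mapsto\langle\mathbf u,\mathbf x\rangle:\mathbf u\in\mathcal U\}$, a linear operator $\mathcal L:D(\mathcal L)\to M(\mathcal S(S))$ is of $\mathcal U$-polynomial type if there is $L:\mathcal U\to\mathcal S(S)^*$ (the associated map) with $\mathcal L(\langle\mathbf u,\cdot\rangle)(\mathbf x)=\langle L(\mathbf u),\mathbf x\rangle$ for all $\mathbf u\in\mathcal U$, $\mathbf x\in\mathcal S(S)$; a solution of its martingale problem is an $\mathcal S(S)$-valued $\mathcal U$-polynomial process. Continuity of $\mathbb X$ is understood so that the processes $(\langle\mathbf u,\mathbb X_t\rangle)_{t\in[0,T]}$, $\mathbf u\in\mathcal U$, are continuous.
   Formalization: In (a) L(exp u)=exp u ⧢ R(u) holds as functionals on S(S), and as tensors when R agrees on all elements of U with that shuffle exponential; in (b) X solves the affine martingale problem, and is U-affine if a linear operator of U-affine type with map R exists. Both claims fail otherwise. *)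

(* Defs.v *)
From HB Require Import structures.
From mathcomp Require Import all_boot all_order all_algebra.
From mathcomp Require Import all_classical all_reals all_analysis.
From mathcomp Require Export complex.

Set Implicit Arguments.
Unset Strict Implicit.
Unset Printing Implicit Defensive.

Import Order.TTheory GRing.Theory Num.Theory.
Import numFieldNormedType.Exports.

Local Open Scope classical_set_scope.
Local Open Scope ring_scope.
Local Open Scope complex_scope.

Section ComplexAnalysis.
Variable R : realType.

(* R[i] has no canonical topology: limits are taken
   componentwise. *)
Definition clim (u : nat -> R[i]) : R[i] :=
  limn (fun n => complex.Re (u n)) +i* limn (fun n => complex.Im (u n)).

Definition cexp (z : R[i]) : R[i] :=
  (expR (complex.Re z) * cos (complex.Im z)) +i*
  (expR (complex.Re z) * sin (complex.Im z)).

Definition linear_subset (A : Type) (V : set (A -> R[i])) : Prop :=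
  V (fun=> 0) /\
  forall (c : R[i]) f g, V f -> V g -> V (fun a => c * f a + g a).

Definition cspan (A : Type) (G : set (A -> R[i])) : set (A -> R[i]) :=
  [set f | exists n (c : 'I_n -> R[i]) (g : 'I_n -> A -> R[i]),
     (forall i, G (g i)) /\ f = (fun a => \sum_(i < n) c i * g i a)].

(* An operator with domain D is a total function on A -> R[i]; its values
   outside D are irrelevant. *)
Definition linear_on (A : Type) (D : set (A -> R[i]))
    (Lop : (A -> R[i]) -> A -> R[i]) : Prop :=
  forall (c : R[i]) f g, D f -> D g ->
    Lop (fun a => c * f a + g a) = (fun a => c * Lop f a + Lop g a).

End ComplexAnalysis.

(* A multi-index is a sequence of letters in 'I_d; its length is its size. *)
Definition word (d : nat) := seq 'I_d.

Section ShuffleWords.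
Variable d : nat.

Fixpoint shuffle_rev (I : word d) : word d -> seq (word d) :=
  match I with
  | [::] => fun J => [:: J]
  | i :: I' =>
      (fix aux (J : word d) : seq (word d) :=
         match J with
         | [::] => [:: I]
         | j :: J' => map (cons i) (shuffle_rev I' J) ++ map (cons j) (aux J')
         end)
  end.

(* e_I shuffled with e_J is the sum of e_K over K in this list (with
   multiplicity). The recursion on last letters becomes structural on
   reversed words; see shuffle_rcons for its usual form. *)
Definition shuffle (I J : word d) : seq (word d) :=
  map rev (shuffle_rev (rev I) (rev J)).

Lemma shuffle0w J : shuffle [::] J = [:: J].
Proof. by rewrite /shuffle /= revK. Qed.

Lemma shufflew0 I : shuffle I [::] = [:: I].
Proof.
rewrite /shuffle; have -> : rev [::] = [::] :> word d by [].
by case E : (rev I) => [|i s] /=; rewrite -?E ?revK // -(revK I) E.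
Qed.

Lemma shuffle_rcons I i J j :
  shuffle (rcons I i) (rcons J j) =
    map (rcons^~ i) (shuffle I (rcons J j)) ++
    map (rcons^~ j) (shuffle (rcons I i) J).
Proof.
rewrite /shuffle !rev_rcons /= map_cat -!map_comp.
by congr (_ ++ _); apply: eq_map => s /=; rewrite rev_cons.
Qed.

End ShuffleWords.

Section TensorAlgebra.
Variables (R : realType) (d : nat).

(* T((R^d)) and its complexification, through the coefficients of the e_I. *)
Definition tensor := word d -> R.
Definition ctensor := word d -> R[i].

Definition eword (I : word d) : ctensor := fun K => (K == I)%:R.

Definition eshuffle (I J : word d) : tensor :=
  fun K => (count_mem K (shuffle I J))%:R.

(* <e_K, a shuffle b>, with a and b truncated at level |K|. *)
Definition cshuffle (a b : ctensor) : ctensor := fun K =>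
  \sum_(n < (size K).+1) \sum_(m < (size K).+1)
    \sum_(I : n.-tuple 'I_d) \sum_(J : m.-tuple 'I_d)
      a I * b J * (eshuffle I J K)%:C.

Fixpoint shuffle_pow (u : ctensor) (k : nat) : ctensor :=
  if k is k'.+1 then cshuffle (shuffle_pow u k') u else eword [::].

Definition shuffle_exp (u : ctensor) : ctensor := fun K =>
  clim (fun N => \sum_(k < N) shuffle_pow u k K / (k`!)%:R).

Definition grouplike (S : set 'rV[R]_d) (x : tensor) : Prop :=
  [/\ S (\row_i x [:: i]), x [::] = 1 &
      forall I J : word d, x I * x J = \sum_(K <- shuffle I J) x K].

Definition state (S : set 'rV[R]_d) := {x : tensor | grouplike S x}.

(* The cells are indexed from 0; they are nonempty, pairwise disjoint and cover
   all words. *)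
Definition shuffle_partition (Pi : nat -> set (word d)) : Prop :=
  [/\ classical_sets.partition setT Pi setT,
      forall k I J, Pi k I -> Pi k J -> size I = size J &
      forall k1 k2, exists k, forall I1 I2, Pi k1 I1 -> Pi k2 I2 ->
        exists lam : word d -> R, forall K,
          eshuffle I1 I2 K = \sum_(I \in Pi k) lam I * (K == I)%:R].

Variable S : set 'rV[R]_d.

Definition pairing (u : ctensor) (x : state S) : R[i] :=
  clim (fun N => \sum_(n < N.+1) \sum_(I : n.-tuple 'I_d)
                   u I * (sval x I)%:C).

Variable Pi : nat -> set (word d).

Definition cell_norm (u : ctensor) (x : state S) : \bar R :=
  (\sum_(0 <= k <oo)
     (ComplexField.Normc.normc (\sum_(I \in Pi k) u I * (sval x I)%:C))%:E)%E.

Definition dual : set ctensor :=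
  [set u | forall x : state S, (cell_norm u x < +oo)%E].

(* Equality of the functionals on the state space induced by u and v. *)
Definition dual_eq (u v : ctensor) : Prop :=
  forall x : state S, pairing u x = pairing v x.

End TensorAlgebra.

Section StochasticProcesses.
Context {R : realType} {dO : measure_display} {Omega : measurableType dO}.
Variables (P : probability Omega R) (T : R) (F : R -> set (set Omega)).

(* Processes and filtrations are indexed by R; only times in [0, T] matter. *)
Definition right_continuous_filtration : Prop :=
  [/\ forall t, 0 <= t <= T -> sigma_algebra setT (F t),
      forall t, 0 <= t <= T -> F t `<=` measurable,
      forall s t, 0 <= s -> s <= t -> t <= T -> F s `<=` F t &
      forall t, 0 <= t < T ->
        forall A, (forall s, t < s <= T -> F s A) -> F t A].

Definition adapted (M : R -> Omega -> R) : Prop :=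
  forall t, 0 <= t <= T ->
    forall B : set R, measurable B -> F t (M t @^-1` B).

Definition cadlag (M : R -> Omega -> R) : Prop := forall w,
  (forall t, 0 <= t < T -> M s w @[s --> t^'+] --> M t w) /\
  (forall t, 0 < t <= T -> cvg (M s w @[s --> t^'-])).

(* The last clause is E[M_t | F_s] = M_s almost surely. *)
Definition martingale (M : R -> Omega -> R) : Prop :=
  [/\ adapted M,
      forall t, 0 <= t <= T -> P.-integrable setT (EFin \o M t) &
      forall s t, 0 <= s -> s <= t -> t <= T -> forall A, F s A ->
        (\int[P]_(w in A) (M t w)%:E = \int[P]_(w in A) (M s w)%:E)%E].

Definition stopping_time (tau : Omega -> R) : Prop :=
  (forall w, 0 <= tau w <= T) /\
  (forall t, 0 <= t <= T -> F t [set w | tau w <= t]).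

(* On the closed horizon [0, T] a localizing sequence reaches T almost surely
   after finitely many steps. *)
Definition local_martingale (M : R -> Omega -> R) : Prop :=
  exists tau : nat -> Omega -> R,
    [/\ forall n, stopping_time (tau n),
        forall n w, tau n w <= tau n.+1 w,
        {ae P, forall w, exists n, tau n w = T} &
        forall n, martingale (fun t w => M (Num.min t (tau n w)) w)].

Definition complex_proc (Q : (R -> Omega -> R) -> Prop)
    (M : R -> Omega -> R[i]) : Prop :=
  Q (fun t w => complex.Re (M t w)) /\ Q (fun t w => complex.Im (M t w)).

Definition ctime_integral (g : R -> R[i]) (t : R) : R[i] :=
  (\int[lebesgue_measure]_(s in `[0, t]) complex.Re (g s))%R +i*
  (\int[lebesgue_measure]_(s in `[0, t]) complex.Im (g s))%R.

Variables (d : nat) (S : set 'rV[R]_d).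

Definition state_process (X : R -> Omega -> state S) : Prop :=
  forall t, 0 <= t <= T -> forall I : word d,
    measurable_fun setT (fun w => sval (X t w) I).

Definition version (X Y : R -> Omega -> state S) : Prop :=
  state_process Y /\
  forall t, 0 <= t <= T -> {ae P, forall w, sval (Y t w) = sval (X t w)}.

(* The martingale problem for a set G of pairs (f, g), where g plays the role
   of the image of f under the operator. *)
Definition solves_pairs (G : set ((state S -> R[i]) * (state S -> R[i])))
    (X : R -> Omega -> state S) : Prop :=
  [/\ state_process X,
      exists x : state S, {ae P, forall w, sval (X 0 w) = sval x} &
      exists Y, version X Y /\
        forall f g, G (f, g) ->
        [/\ complex_proc adapted (fun t w => f (Y t w)),
            complex_proc cadlag (fun t w => f (Y t w)),
            complex_proc adapted (fun t w => g (Y t w)),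
            complex_proc cadlag (fun t w => g (Y t w)) &
            complex_proc local_martingale (fun t w =>
              f (Y t w) - f (Y 0 w) - ctime_integral (fun s => g (Y s w)) t)]].

Definition solves_martingale_problem (D : set (state S -> R[i]))
    (Lop : (state S -> R[i]) -> state S -> R[i])
    (X : R -> Omega -> state S) : Prop :=
  solves_pairs [set fg | D fg.1 /\ fg.2 = Lop fg.1] X.

Variable Pi : nat -> set (word d).
Implicit Types (U : set (ctensor R d)) (Rm Lm : ctensor R d -> ctensor R d).

Definition exp_pairing (u : ctensor R d) : state S -> R[i] :=
  fun x => cexp (pairing u x).

Definition affine_domain U : set (state S -> R[i]) :=
  cspan [set f | exists2 u, U u & f = exp_pairing u].

Definition affine_type U Rm (Lop : (state S -> R[i]) -> state S -> R[i]) :=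
  [/\ U `<=` dual S Pi, linear_on (affine_domain U) Lop,
      forall u, U u -> dual S Pi (Rm u) &
      forall u, U u -> forall x,
        Lop (exp_pairing u) x = exp_pairing u x * pairing (Rm u) x].

Definition affine_process U Rm (X : R -> Omega -> state S) : Prop :=
  exists2 Lop, affine_type U Rm Lop &
    solves_martingale_problem (affine_domain U) Lop X.

(* The linear span of the pairs (exp<u,.>, exp<u,.><Rm u,.>): the graph of the
   operator of affine type with associated map Rm whenever that exists. *)
Definition affine_graph U Rm : set ((state S -> R[i]) * (state S -> R[i])) :=
  [set fg | exists n (c : 'I_n -> R[i]) (u : 'I_n -> ctensor R d),
     [/\ forall i, U (u i),
         fg.1 = (fun x => \sum_(i < n) c i * exp_pairing (u i) x) &
         fg.2 = (fun x => \sum_(i < n)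
                   c i * (exp_pairing (u i) x * pairing (Rm (u i)) x))]].

Definition polynomial_domain U : set (state S -> R[i]) :=
  [set f | exists2 u, U u & f = pairing u].

Definition polynomial_type U Lm (Lop : (state S -> R[i]) -> state S -> R[i]) :=
  [/\ U `<=` dual S Pi, linear_subset U, linear_on (polynomial_domain U) Lop,
      forall u, U u -> dual S Pi (Lm u) &
      forall u, U u -> forall x, Lop (pairing u) x = pairing (Lm u) x].

Definition polynomial_process U Lm (X : R -> Omega -> state S) : Prop :=
  exists2 Lop, polynomial_type U Lm Lop &
    solves_martingale_problem (polynomial_domain U) Lop X.

Definition continuous_process U (X : R -> Omega -> state S) : Prop :=
  forall u, U u -> {ae P, forall w,
    {within `[0, T], continuous (fun t => complex.Re (pairing u (X t w)))} /\
    {within `[0, T], continuous (fun t => complex.Im (pairing u (X t w)))}}.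

End StochasticProcesses.

(* Main.v *)
Require Import Defs.
From mathcomp Require Import all_boot all_order all_algebra.
From mathcomp Require Import all_classical all_reals all_analysis.
From mathcomp Require Import measurable_realfun.
From mathcomp Require Import ring lra zify.

(** The argument has an algebraic and a stochastic half.

    Algebra. The cells of a shuffle-compatible partition form a grading of the
    words that refines the length: all words in the shuffle of two words lie in
    one cell determined by the cells of the factors. For a group-like [x] this
    makes the norm at [x] submultiplicative ([bounded_at_shuffle]) and the
    pairing with [x] multiplicative for the shuffle product
    ([pairing_shuffle]), the latter by a Cauchy product of absolutely convergent
    series. Consequently the dual is closed under shuffle products and shuffle
    exponentials, and the shuffle exponential of [u] pairs to the complex
    exponential of the pairing of [u] ([pairing_shuffle_exp]). The functions
    exp<u, x> and exp<u, x> <Rm u, x> are then linear functions of [x], given by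
    the shuffle exponential of [u] and by its shuffle product with [Rm u]. So an
    operator of affine type is, on the same domain, of polynomial type, and the
    first half of the theorem is a change of description ([affine_polynomial]). One exponential may come from several
    elements of [U], which is why the associated map is determined as a
    functional on the state space, and as a tensor when [Rm] does not
    distinguish these elements.

    Stochastics. Let [y], [A] and [B] be the pairings of the process with [u],
    [Lm u] and [Lm (cshuffle u u)]. As [cshuffle u u] pairs to the square of
    [y], the polynomial martingale problem says that [y] minus the integral of
    [A] and [y ^+ 2] minus the integral of [B] are local martingales. With
    [y] continuous, Ito's formula for the exponential gives the drift
    [cexp y * (A + B / 2 - y * A)], which is the affine one. Stopping at the hitting times of high levels
    ([hit_stopping]) makes all processes bounded, and bounded stopped local
    martingales are martingales ([optional_stopping]). Along a partition of
    [s, t] a second order expansion of the exponential ([exp_step]) leaves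
    martingale increments with weights known at the left end points, which have
    mean zero ([exp_sum_mean]), a drift error of the order of the oscillation of
    [y] ([Ds_mean]), and a cubic remainder. The remainder is at most the largest
    increment times the sum of squared increments; the former tends to zero in
    mean square by continuity, and the latter has a second moment bounded
    uniformly over partitions ([sqsum_sqr_mean_le]). Hence the stopped
    exponential minus its compensator has the martingale property
    ([ito_increment], [exp_stopped_mean]), and the hitting times localize it
    ([exp_family_local_martingale]), for all linear combinations of exponentials
    and hence for every operator of affine type with this map. Continuity of the version that solves the
    martingale problem is inherited from the process at grid points
    ([version_continuous]). *)

Set Implicit Arguments.
Unset Strict Implicit.
Unset Printing Implicit Defensive.

Import Order.TTheory GRing.Theory Num.Theory.
Import numFieldNormedType.Exports.

Local Open Scope classical_set_scope.
Local Open Scope ring_scope.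
Local Open Scope complex_scope.

(** * Complex numbers and their sequences *)

Notation normc := ComplexField.Normc.normc.
Notation cRe := complex.Re.
Notation cIm := complex.Im.

Section ComplexNorm.
Variable R : realType.
Implicit Types (z w : R[i]) (x : R).

Lemma normcE z : (normc z)%:C = `|z|.
Proof. by rewrite normc_def; case: z. Qed.

Lemma normc_ge0 z : 0 <= normc z.
Proof. by case: z => a b; exact: sqrtr_ge0. Qed.

Lemma normcD z w : normc (z + w) <= normc z + normc w.
Proof. by rewrite -lecR rmorphD /= !normcE ler_normD. Qed.

Lemma normcN z : normc (- z) = normc z.
Proof. by apply: complexI; rewrite !normcE normrN. Qed.

Lemma normcB z w : normc (z - w) <= normc z + normc w.
Proof. by rewrite (le_trans (normcD _ _)) // normcN. Qed.

Lemma normcM z w : normc (z * w) = normc z * normc w.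
Proof. exact: ComplexField.Normc.normcM. Qed.

Lemma normc0 : normc (0 : R[i]) = 0.
Proof. exact: ComplexField.Normc.normc0. Qed.

Lemma normc1 : normc (1 : R[i]) = 1.
Proof. exact: ComplexField.Normc.normc1. Qed.

Lemma normcX z n : normc (z ^+ n) = normc z ^+ n.
Proof. by elim: n => [|n IH]; rewrite ?expr0 ?normc1 // !exprS normcM IH. Qed.

Lemma normcV z : normc z^-1 = (normc z)^-1.
Proof. exact: ComplexField.Normc.normcV. Qed.

Lemma normc_real x : normc x%:C = `|x|.
Proof. by rewrite /= expr0n /= addr0 sqrtr_sqr. Qed.

Lemma normc_nat n : normc (n%:R : R[i]) = n%:R.
Proof. by rewrite -(rmorph_nat (real_complex R)) normc_real normr_nat. Qed.

Lemma normc_sum (I : Type) (r : seq I) (P : pred I) (F : I -> R[i]) :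
  normc (\sum_(i <- r | P i) F i) <= \sum_(i <- r | P i) normc (F i).
Proof.
elim/big_rec2 : _ => [|i x z _ h]; first by rewrite normc0.
by rewrite (le_trans (normcD _ _)) // lerD2l.
Qed.

Lemma normr_Re z : `|cRe z| <= normc z.
Proof. by case: z => a b /=; rewrite -sqrtr_sqr ler_wsqrtr // lerDl sqr_ge0. Qed.

Lemma normr_Im z : `|cIm z| <= normc z.
Proof. by case: z => a b /=; rewrite -sqrtr_sqr ler_wsqrtr // lerDr sqr_ge0. Qed.

Lemma normc_le_ReIm z : normc z <= `|cRe z| + `|cIm z|.
Proof.
case: z => a b.
have h : a +i* b = a%:C + 'i * b%:C by rewrite [LHS]complexE.
rewrite [X in normc X]h (le_trans (normcD _ _)) // normcM.
rewrite (normc_real a) (normc_real b).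
have -> : normc ('i : R[i]) = 1 by rewrite /= expr0n expr1n add0r sqrtr1.
by rewrite mul1r.
Qed.

Lemma normc_sqr z : normc z ^+ 2 = cRe z ^+ 2 + cIm z ^+ 2.
Proof. by case: z => a b /=; rewrite sqr_sqrtr // addr_ge0 ?sqr_ge0. Qed.

Lemma normc_distC z w : normc (z - w) = normc (w - z).
Proof. by rewrite -normcN opprB. Qed.

Lemma cReD z w : cRe (z + w) = cRe z + cRe w. Proof. by case: z; case: w. Qed.
Lemma cImD z w : cIm (z + w) = cIm z + cIm w. Proof. by case: z; case: w. Qed.
Lemma cReN z : cRe (- z) = - cRe z. Proof. by case: z. Qed.
Lemma cImN z : cIm (- z) = - cIm z. Proof. by case: z. Qed.
Lemma cReM z w : cRe (z * w) = cRe z * cRe w - cIm z * cIm w.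
Proof. by case: z; case: w. Qed.
Lemma cImM z w : cIm (z * w) = cRe z * cIm w + cIm z * cRe w.
Proof. by case: z; case: w. Qed.
Lemma cRe_sum (I : Type) (r : seq I) (P : pred I) (F : I -> R[i]) :
  cRe (\sum_(i <- r | P i) F i) = \sum_(i <- r | P i) cRe (F i).
Proof. by elim/big_rec2 : _ => // i x z _ <-; rewrite cReD. Qed.
Lemma cIm_sum (I : Type) (r : seq I) (P : pred I) (F : I -> R[i]) :
  cIm (\sum_(i <- r | P i) F i) = \sum_(i <- r | P i) cIm (F i).
Proof. by elim/big_rec2 : _ => // i x z _ <-; rewrite cImD. Qed.
Lemma eq_ReIm z w : cRe z = cRe w -> cIm z = cIm w -> z = w.
Proof. by case: z; case: w => /= ? ? ? ? -> ->. Qed.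

(** Limits of complex sequences are taken componentwise; the modulus is what the
    estimates control, and [ccvgP] passes from one to the other. *)
Definition ccvg (u : nat -> R[i]) (l : R[i]) : Prop :=
  normc (u n - l) @[n --> \oo] --> (0 : R).

Lemma squeeze0 (f g : nat -> R) : (forall n, 0 <= f n <= g n) ->
  g @ \oo --> (0 : R) -> f @ \oo --> (0 : R).
Proof.
move=> h hg; apply: (@squeeze_cvgr _ _ _ _ (fun=> 0) g) => //.
  exact: nearW.
exact: cvg_cst.
Qed.

Lemma ccvgP u l : ccvg u l <->
  (cRe (u n) @[n --> \oo] --> cRe l) /\ (cIm (u n) @[n --> \oo] --> cIm l).
Proof.
split=> [h|[hr hi]].
  split; apply/cvgrPdist_lt => e e0; move/cvgrPdist_lt : h => /(_ e e0).
    apply: filterS => n; rewrite sub0r normrN ger0_norm ?normc_ge0 // => hn.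
    by rewrite distrC -cReN -cReD (le_lt_trans (normr_Re _)).
  apply: filterS => n; rewrite sub0r normrN ger0_norm ?normc_ge0 // => hn.
  by rewrite distrC -cImN -cImD (le_lt_trans (normr_Im _)).
apply: (@squeeze0 _ (fun n => `|cRe (u n) - cRe l| + `|cIm (u n) - cIm l|)).
  move=> n; rewrite normc_ge0 /= (le_trans (normc_le_ReIm _)) //.
  by rewrite cReD cReN cImD cImN.
rewrite -[0 in X in _ --> X]addr0; apply: cvgD.
- rewrite -[0 in X in _ --> X](normr0 R) -(subrr (cRe l)).
  by apply: cvg_norm; apply: cvgB => //; exact: cvg_cst.
- rewrite -[0 in X in _ --> X](normr0 R) -(subrr (cIm l)).
  by apply: cvg_norm; apply: cvgB => //; exact: cvg_cst.
Qed.

Lemma ccvg_clim u l : ccvg u l -> clim u = l.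
Proof.
move=> /ccvgP[hr hi]; rewrite /clim.
by apply: eq_ReIm => /=; [exact: cvg_lim hr|exact: cvg_lim hi].
Qed.

Lemma ccvg_unique u l l' : ccvg u l -> ccvg u l' -> l = l'.
Proof. by move=> /ccvg_clim <- /ccvg_clim <-. Qed.

Lemma ccvg_cst l : ccvg (fun=> l) l.
Proof. by apply/ccvgP; split; exact: cvg_cst. Qed.

Lemma ccvgD u v l m : ccvg u l -> ccvg v m -> ccvg (fun n => u n + v n) (l + m).
Proof.
move=> /ccvgP[ur ui] /ccvgP[vr vi]; apply/ccvgP; split.
  by under eq_fun do rewrite cReD; rewrite cReD; exact: cvgD.
by under eq_fun do rewrite cImD; rewrite cImD; exact: cvgD.
Qed.

Lemma ccvgM u v l m : ccvg u l -> ccvg v m -> ccvg (fun n => u n * v n) (l * m).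
Proof.
move=> /ccvgP[ur ui] /ccvgP[vr vi]; apply/ccvgP; split.
  under eq_fun do rewrite cReM; rewrite cReM.
  by apply: cvgB; exact: cvgM.
under eq_fun do rewrite cImM; rewrite cImM.
by apply: cvgD; exact: cvgM.
Qed.

Lemma ccvg_sum (I : Type) (r : seq I) (F : I -> nat -> R[i]) (l : I -> R[i]) :
  (forall i, ccvg (F i) (l i)) ->
  ccvg (fun n => \sum_(i <- r) F i n) (\sum_(i <- r) l i).
Proof.
move=> h; elim: r => [|i r IH].
  rewrite big_nil; under eq_fun do rewrite big_nil; exact: ccvg_cst.
by rewrite big_cons; under eq_fun do rewrite big_cons; exact: ccvgD.
Qed.

Lemma ccvg_normc u l : ccvg u l -> normc (u n) @[n --> \oo] --> normc l.
Proof.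
move=> h; apply/cvgrPdist_le => e e0.
move/cvgrPdist_le : h => /(_ e e0); apply: filterS => n.
rewrite sub0r normrN ger0_norm ?normc_ge0 // => hn.
apply: le_trans hn.
have := normcD (u n - l) l; have := normcD (l - u n) (u n).
rewrite !subrK (normc_distC l) => h1 h2.
by rewrite ler_norml; apply/andP; split; lra.
Qed.

Lemma ccvg_le u l (C : R) : ccvg u l -> (forall n, normc (u n) <= C) ->
  normc l <= C.
Proof.
move=> /ccvg_normc h hC; rewrite -(cvg_lim _ h) //.
by apply: limr_le; [exact: cvgP h|exact: nearW].
Qed.

Lemma ccvg_subseq u l (f : nat -> nat) : (forall n, n <= f n)%N ->
  ccvg u l -> ccvg (u \o f) l.
Proof.
move=> hf h; apply: cvg_trans h => A [N _ hN]; exists N => // n /= Nn.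
by apply: hN => /=; exact: leq_trans Nn (hf n).
Qed.

Lemma series_ord (a : nat -> R) N : series a N = \sum_(i < N) a i.
Proof. by rewrite /series /= big_mkord. Qed.

Lemma sum_bounded_cvg (a : nat -> R) (C : R) : (forall n, 0 <= a n) ->
  (forall N, \sum_(n < N) a n <= C) ->
  exists2 l, \sum_(n < N) a n @[N --> \oo] --> l & forall N, \sum_(n < N) a n <= l.
Proof.
move=> a0 hC; set u := fun N => \sum_(n < N) a n.
have nd : nondecreasing_seq u.
  apply/nondecreasing_seqP => n; rewrite /u big_ord_recr /= lerDl; exact: a0.
have cu : cvgn u.
  apply: nondecreasing_is_cvgn => //; exists C => _ [N _ <-]; exact: hC.
by exists (limn u) => // N; exact: nondecreasing_cvgn_le.
Qed.

Lemma csum_abs_cvg (a : nat -> R[i]) (C : R) :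
  (forall N, \sum_(n < N) normc (a n) <= C) ->
  exists2 l, ccvg (fun N => \sum_(n < N) a n) l & normc l <= C.
Proof.
move=> hC.
have cvgpart (f : R[i] -> R) : (forall z, `|f z| <= normc z) ->
    cvgn (fun N => \sum_(n < N) f (a n)).
  move=> hf; rewrite (_ : (fun N => _) = series (f \o a)); last first.
    by apply/funext => N; rewrite series_ord.
  apply: normed_cvg; apply: nondecreasing_is_cvgn.
    by apply/nondecreasing_seqP => n /=; rewrite seriesSr lerDl.
  exists C => _ [N _ <-]; apply: le_trans (hC N).
  by rewrite /= series_ord; apply: ler_sum => i _; exact: hf.
have hr := cvgpart _ normr_Re; have hi := cvgpart _ normr_Im.
exists (limn (fun N => \sum_(n < N) cRe (a n)) +i*
        limn (fun N => \sum_(n < N) cIm (a n))); last first.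
  apply: (@ccvg_le (fun N => \sum_(n < N) a n)) => [|n].
    apply/ccvgP; split.
      by under eq_fun do rewrite cRe_sum.
    by under eq_fun do rewrite cIm_sum.
  exact: le_trans (normc_sum _ _ _) (hC n).
apply/ccvgP; split.
  by under eq_fun do rewrite cRe_sum.
by under eq_fun do rewrite cIm_sum.
Qed.

Lemma cvg_sumr (T : Type) (F : set_system T) {FF : Filter F} (I : Type)
    (r : seq I) (f : I -> T -> R) (l : I -> R) :
  (forall i, f i @ F --> l i) ->
  (fun w : T => \sum_(i <- r) f i w) @ F --> \sum_(i <- r) l i.
Proof.
move=> h; elim: r => [|i r IH].
  by rewrite big_nil; under eq_fun do rewrite big_nil; exact: cvg_cst.
by rewrite big_cons; under eq_fun do rewrite big_cons; exact: cvgD.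
Qed.

End ComplexNorm.

(** * Cauchy products *)

Section Cauchy.
Variable R : realType.
Implicit Types (a b : nat -> R[i]).

Lemma triangle_sum (V : nmodType) (f : nat -> nat -> V) N :
  \sum_(n < N) \sum_(i < n.+1) f i (n - i)%N =
  \sum_(i < N) \sum_(j < N | (i + j < N)%N) f i j.
Proof.
transitivity (\sum_(n < N) \sum_(i < N | (i <= n)%N) f i (n - i)%N).
  apply: eq_bigr => n _.
  by rewrite (big_ord_widen _ (fun i => f i (n - i)%N) (ltn_ord n)).
rewrite (exchange_big_dep xpredT) //=; apply: eq_bigr => i _.
transitivity (\sum_(i <= n < N) f i (n - i)%N).
  rewrite [RHS]big_geq_mkord; by apply: eq_bigl.
rewrite -{1}[i : nat]add0n big_addn big_mkord.
rewrite (big_ord_widen N (fun j => f i (j + i - i)%N)) ?leq_subr //.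
apply: eq_big => [j|j _]; last by rewrite addnK.
by rewrite ltn_subRL.
Qed.

(** The truncated product exceeds the Cauchy sum of order N by terms whose
    index sum is at least N; they are dominated by the corresponding gap of
    the nonnegative series, which is at most [X_N Y_N - X_h Y_h] with
    [h = N./2]. *)
Lemma cauchy_product a b (Ca Cb : R) A B :
  (forall N, \sum_(n < N) normc (a n) <= Ca) ->
  (forall N, \sum_(n < N) normc (b n) <= Cb) ->
  ccvg (fun N => \sum_(n < N) a n) A -> ccvg (fun N => \sum_(n < N) b n) B ->
  ccvg (fun N => \sum_(n < N) \sum_(i < n.+1) a i * b (n - i)%N) (A * B).
Proof.
move=> hCa hCb hA hB.
have [la cla _] := sum_bounded_cvg (fun n => normc_ge0 (a n)) hCa.
have [lb clb _] := sum_bounded_cvg (fun n => normc_ge0 (b n)) hCb.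
set X := fun N => \sum_(n < N) normc (a n) in cla.
set Y := fun N => \sum_(n < N) normc (b n) in clb.
set r := fun N => \sum_(n < N) _.
have gap N : normc (r N - (\sum_(n < N) a n) * (\sum_(n < N) b n)) <=
    X N * Y N - X N./2 * Y N./2.
  rewrite /r (triangle_sum (fun i j => a i * b j)) mulr_suml -sumrB.
  have -> : \sum_(i < N) (\sum_(j < N | (i + j < N)%N) a i * b j -
      a i * \sum_(n < N) b n) =
      - \sum_(i < N) \sum_(j < N | ~~ (i + j < N)%N) a i * b j.
    rewrite -sumrN; apply: eq_bigr => i _; rewrite mulr_sumr.
    by rewrite [X in _ - X](bigID (fun j : 'I_N => (i + j < N)%N)) /= opprD addrA
      subrr sub0r.
  rewrite normcN (le_trans (normc_sum _ _ _)) //.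
  have -> : X N * Y N = \sum_(i < N) \sum_(j < N | (i + j < N)%N)
      normc (a i) * normc (b j) + \sum_(i < N) \sum_(j < N | ~~ (i + j < N)%N)
      normc (a i) * normc (b j).
    rewrite -big_split /= mulr_suml; apply: eq_bigr => i _.
    by rewrite mulr_sumr (bigID (fun j : 'I_N => (i + j < N)%N)).
  have hle : X N./2 * Y N./2 <= \sum_(i < N) \sum_(j < N | (i + j < N)%N)
      normc (a i) * normc (b j).
    (* [i < N./2] and [j < N./2] force [i + j < N]. *)
    have hN : (N./2 <= N)%N by rewrite leq_half_double; lia.
    rewrite /X (big_ord_widen _ (fun i => normc (a i)) hN) mulr_suml.
    rewrite big_mkcond; apply: ler_sum => i _; case: ifP => [hi|_]; last first.
      by apply: sumr_ge0 => j _; rewrite mulr_ge0 ?normc_ge0.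
    rewrite /Y (big_ord_widen _ (fun i => normc (b i)) hN) mulr_sumr.
    rewrite big_mkcond [leRHS]big_mkcond; apply: ler_sum => j _ /=.
    case: ifP => [hj|_]; last by case: ifP => // _; rewrite mulr_ge0 ?normc_ge0.
    by rewrite ifT // ; lia.
  apply: le_trans (_ : \sum_(i < N) \sum_(j < N | ~~ (i + j < N)%N)
      normc (a i) * normc (b j) <= _); last by lra.
  apply: ler_sum => i _; apply: le_trans (normc_sum _ _ _) _.
  by apply: ler_sum => j _; rewrite normcM.
have hgap : (fun N => X N * Y N - X N./2 * Y N./2) @ \oo --> (0 : R).
  rewrite -(subrr (la * lb)); apply: cvgB; first exact: cvgM.
  have h2 : half @ \oo --> \oo.
    by apply/cvgnyPge => A'; near=> n; rewrite geq_half_double; near: n; exact: nbhs_infty_ge.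
  by apply: cvgM; [exact: (cvg_comp _ _ h2 cla)|exact: (cvg_comp _ _ h2 clb)].
have hAB := ccvgM hA hB.
have hr : ccvg (fun N => r N - (\sum_(n < N) a n) * (\sum_(n < N) b n)) 0.
  apply: (squeeze0 _ hgap) => N; rewrite subr0 normc_ge0; exact: gap.
have := ccvgD hr hAB; rewrite add0r.
by congr ccvg; apply/funext => N; rewrite subrK.
Unshelve. all: by end_near.
Qed.
End Cauchy.

(** * The complex exponential series *)

Section Cexp.
Variable R : realType.
Implicit Types (z w : R[i]) (x y : R).

Lemma exp_sum_le x N : 0 <= x -> \sum_(k < N) x ^+ k / (k`!)%:R <= expR x.
Proof.
move=> x0; rewrite /expR.
have := nondecreasing_cvgn_le (u_ := series (exp_coeff x)) _ (is_cvg_series_exp_coeff x) N.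
rewrite series_ord; apply.
by apply/nondecreasing_seqP => n; rewrite seriesSr lerDl exp_coeff_ge0.
Qed.

Lemma normc_exp_term z k : normc (z ^+ k / (k`!)%:R) = normc z ^+ k / (k`!)%:R.
Proof. by rewrite normcM normcX normcV normc_nat. Qed.

Lemma exp_sum_normc_le z N :
  \sum_(k < N) normc (z ^+ k / (k`!)%:R) <= expR (normc z).
Proof.
by under eq_bigr do rewrite normc_exp_term; apply: exp_sum_le; exact: normc_ge0.
Qed.

Let partial z N : R[i] := \sum_(k < N) z ^+ k / (k`!)%:R.

(** The Cauchy product of two exponential series is regrouped by the binomial
    theorem. Stated for arbitrary limits, the exponential law is available
    before the sums of the series are known, and it is used to find them. *)
Lemma exp_sum_cvgD z w ez ew : ccvg (partial z) ez -> ccvg (partial w) ew ->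
  ccvg (partial (z + w)) (ez * ew).
Proof.
move=> hz hw.
have := @cauchy_product R (fun k => z ^+ k / (k`!)%:R)
  (fun k => w ^+ k / (k`!)%:R) _ _ _ _
  (exp_sum_normc_le z) (exp_sum_normc_le w) hz hw.
congr ccvg; apply/funext => N; apply: eq_bigr => n _.
rewrite exprDn mulr_suml [RHS](reindex_inj rev_ord_inj) /=; apply: eq_bigr => i _.
have hi : (i <= n)%N by rewrite -ltnS.
rewrite subSS subKn // -(bin_fact hi) bin_sub // natrM natrM.
rewrite -mulr_natr.
have f0 m : (m`!)%:R != 0 :> R[i] by rewrite pnatr_eq0 -lt0n fact_gt0.
have b0 : 'C(n, i)%:R != 0 :> R[i] by rewrite pnatr_eq0 -lt0n bin_gt0.
by field; rewrite !f0 b0.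
Qed.

Lemma exp_sum_cvg_real x : ccvg (partial x%:C) (expR x)%:C.
Proof.
have h N : partial x%:C N = (\sum_(k < N) x ^+ k / (k`!)%:R)%:C.
  rewrite rmorph_sum; apply: eq_bigr => k _.
  by rewrite rmorphM rmorphXn fmorphV rmorph_nat.
apply/ccvgP; split => /=; under eq_fun do rewrite h /=; last exact: cvg_cst.
rewrite (_ : (fun n => _) = series (exp_coeff x)); last first.
  by apply/funext => n; rewrite series_ord.
exact: is_cvg_series_exp_coeff.
Qed.

Lemma imag_expr y k : (0 +i* y) ^+ k =
  (if odd k then 0 +i* ((-1) ^+ k./2 * y ^+ k) else ((-1) ^+ k./2 * y ^+ k)%:C)
  :> R[i].
Proof.
elim: k => [|k IH]; first by rewrite !expr0 mulr1.
rewrite exprS {}IH /= uphalf_half; case: (odd k); simpc => /=.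
  by rewrite !exprS mulN1r; congr (_ +i* _); ring.
by rewrite !exprS; congr (_ +i* _); ring.
Qed.

Lemma exp_sum_cvg_imag y : ccvg (partial (0 +i* y)) (cos y +i* sin y).
Proof.
have reV n : (n%:R : R[i])^-1 = (n%:R^-1)%:C by rewrite fmorphV rmorph_nat.
apply/ccvgP; split => /=.
  rewrite (_ : (fun n => _) = series (cos_coeff y)); last first.
    apply/funext => n; rewrite series_ord /partial cRe_sum; apply: eq_bigr => k _.
    rewrite reV imag_expr /cos_coeff /=; case: (odd k) => /=; last by rewrite -exprnP; ring.
    by ring.
  by rewrite unlock; exact: is_cvg_series_cos_coeff.
rewrite (_ : (fun n => _) = series (sin_coeff y)); last first.
  apply/funext => n; rewrite series_ord /partial cIm_sum; apply: eq_bigr => k _.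
  rewrite reV imag_expr /sin_coeff /=; case: (boolP (odd k)) => hk /=; last by ring.
  have -> : k.-1./2 = k./2 by lia.
  ring.
by rewrite unlock; exact: is_cvg_series_sin_coeff.
Qed.

(** The exponential law reduces the claim to a real and to an imaginary
    argument, where the series are those of the real exponential, the cosine and
    the sine. *)
Lemma cexp_series z : ccvg (fun N => \sum_(k < N) z ^+ k / (k`!)%:R) (cexp z).
Proof.
have {1}-> : z = (cRe z)%:C + (0 +i* cIm z) by case: z => a b; simpc.
have -> : cexp z = (expR (cRe z))%:C * (cos (cIm z) +i* sin (cIm z)).
  by rewrite /cexp; apply: eq_ReIm; rewrite ?cReM ?cImM /=; ring.
apply: exp_sum_cvgD; [exact: exp_sum_cvg_real|exact: exp_sum_cvg_imag].
Qed.

Lemma cexpD z w : cexp (z + w) = cexp z * cexp w.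
Proof.
apply: (ccvg_unique (cexp_series _)).
by apply: exp_sum_cvgD; exact: cexp_series.
Qed.

Lemma normc_cexp z : normc (cexp z) <= expR (normc z).
Proof.
apply: ccvg_le (cexp_series z) _ => N.
exact: le_trans (normc_sum _ _ _) (exp_sum_normc_le z N).
Qed.

(** The factorial of [m + k] is at least that of [k], so the tail is the power
    of order [m] times a series dominated by the exponential one. *)
Lemma cexp_remainder z m :
  normc (cexp z - \sum_(k < m) z ^+ k / (k`!)%:R) <=
    normc z ^+ m * expR (normc z).
Proof.
have h : ccvg (fun N => \sum_(k < N) z ^+ (m + k) / ((m + k)`!)%:R)
    (cexp z - \sum_(k < m) z ^+ k / (k`!)%:R).
  have := ccvgD (ccvg_subseq (f := addn m) (fun n => leq_addl m n) (cexp_series z))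
    (ccvg_cst (- \sum_(k < m) z ^+ k / (k`!)%:R)).
  congr ccvg; apply/funext => N /=.
  by rewrite big_split_ord /= addrAC subrr add0r.
apply: ccvg_le h _ => N; apply: le_trans (normc_sum _ _ _) _.
apply: le_trans (_ : normc z ^+ m * \sum_(k < N) normc z ^+ k / (k`!)%:R <= _).
  rewrite mulr_sumr; apply: ler_sum => k _.
  rewrite normc_exp_term exprD -mulrA ler_wpM2l ?exprn_ge0 ?normc_ge0 //.
  rewrite ler_wpM2l ?exprn_ge0 ?normc_ge0 //.
  rewrite lef_pV2 ?posrE ?ltr0n ?fact_gt0 // ler_nat.
  rewrite (fact_split (leq_addl m k)) leq_pmulr // big_nat_cond.
  by apply: prodn_cond_gt0 => i; lia.
by rewrite ler_wpM2l ?exprn_ge0 ?normc_ge0 // exp_sum_le ?normc_ge0.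
Qed.

End Cexp.

(** * Words, shuffles and graded sums *)

Section Words.
Variable d : nat.
Implicit Types (I J K : word d).

Lemma size_shuffle_rev I J K : K \in shuffle_rev I J ->
  size K = (size I + size J)%N.
Proof.
elim: I J K => [|i I IHI] J K /=; first by rewrite inE => /eqP ->.
elim: J K => [|j J IHJ] K /=; first by rewrite inE addn0 => /eqP ->.
rewrite mem_cat => /orP[/mapP[L LI ->]|/mapP[L LJ ->]] /=.
  by rewrite (IHI _ _ LI) /= addSn.
by rewrite (IHJ _ LJ) addnS.
Qed.

Lemma size_shuffle I J K : K \in shuffle I J -> size K = (size I + size J)%N.
Proof.
by move=> /mapP[L /size_shuffle_rev h ->]; rewrite size_rev h !size_rev.
Qed.

Lemma cat_shuffle_rev I J : I ++ J \in shuffle_rev I J.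
Proof.
elim: I J => [|i I IH] J /=; first by rewrite inE.
case: J => [|j J] /=; first by rewrite cats0 inE.
by rewrite mem_cat map_f.
Qed.

(** The concatenation is one of the shuffles. *)
Lemma shuffle_neq_nil I J : exists K, K \in shuffle I J.
Proof. by exists (rev (rev I ++ rev J)); apply: map_f; exact: cat_shuffle_rev. Qed.

Definition words N : seq (word d) :=
  flatten [seq [seq tval t | t <- enum {: n.-tuple 'I_d}] | n <- iota 0 N.+1].

Lemma mem_words N I : (I \in words N) = (size I <= N)%N.
Proof.
apply/flattenP/idP => [[s /mapP[n]]|h].
  by rewrite mem_iota add0n ltnS => nN -> /mapP[t _ ->]; rewrite size_tuple.
exists [seq tval t | t <- enum {: (size I).-tuple 'I_d}].
  by apply/mapP; exists (size I) => //; rewrite mem_iota.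
by apply/mapP; exists (in_tuple I) => //; rewrite mem_enum.
Qed.

Lemma words_uniq N : uniq (words N).
Proof.
rewrite /words; move: 0%N (N.+1) => a b; elim: b a => //= b IH a.
rewrite cat_uniq IH andbT map_inj_uniq ?enum_uniq //=; last exact: val_inj.
apply/hasPn => J /flattenP[s /mapP[n hn ->] /mapP[t _ ->]].
apply/mapP => -[t' _ /(congr1 size)]; rewrite !size_tuple => E.
by move: hn; rewrite mem_iota E ltnn.
Qed.

Lemma sum_words (V : nmodType) N (F : word d -> V) :
  \sum_(I <- words N) F I = \sum_(n < N.+1) \sum_(I : n.-tuple 'I_d) F I.
Proof.
rewrite /words big_flatten big_map -[iota 0 N.+1]/(index_iota 0 N.+1) big_mkord.
by apply: eq_bigr => n _; rewrite big_map big_enum.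
Qed.

Lemma sum_words_widen (V : nmodType) N M (F : word d -> V) (P : pred (word d)) :
  (N <= M)%N -> (forall I, (size I <= M)%N -> P I -> (N < size I)%N -> F I = 0) ->
  \sum_(I <- words N | P I) F I = \sum_(I <- words M | P I) F I.
Proof.
move=> NM h; rewrite [RHS](bigID (fun I => (size I <= N)%N)) /=.
rewrite [X in _ = _ + X]big_seq_cond [X in _ = _ + X]big1 ?addr0; last first.
  move=> I /andP[]; rewrite mem_words => sI /andP[PI]; rewrite -ltnNge => ?.
  exact: h.
rewrite -big_filter -[RHS]big_filter; apply: perm_big; apply: uniq_perm.
- by rewrite filter_uniq ?words_uniq.
- by rewrite filter_uniq ?words_uniq.
by move=> I; rewrite !mem_filter !mem_words; lia.
Qed.

(** The coefficients of a shuffle are multiplicities; this turns them into a sum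
    over the list of shuffles, the form in which group-like elements are
    multiplicative. *)
Lemma sum_count_mem (R : pzRingType) (W s : seq (word d)) (P : pred (word d))
    (F : word d -> R) : uniq W -> (forall K, K \in s -> P K -> K \in W) ->
  \sum_(K <- W | P K) (count_mem K s)%:R * F K = \sum_(K <- s | P K) F K.
Proof.
move=> uW; elim: s => [|L s IH] hs.
  by rewrite big_nil big1 // => K _; rewrite mul0r.
rewrite big_cons -IH; last by move=> K Ks; apply: hs; rewrite inE Ks orbT.
under eq_bigr do rewrite /= natrD mulrDl.
rewrite big_split /=.
have -> : \sum_(K <- W | P K) (L == K)%:R * F K = if P L then F L else 0.
  case: ifP => PL; last first.
    by rewrite big1 // => K PK; case: eqP => [LK|]; [rewrite LK PK in PL|rewrite mul0r].
  rewrite -big_filter (bigD1_seq L) ?filter_uniq //=; last first.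
    by rewrite mem_filter PL hs // mem_head.
  rewrite eqxx mul1r big1 ?addr0 // => K /negPf KL.
  by rewrite eq_sym KL mul0r.
by case: ifP => // _; rewrite add0r.
Qed.

End Words.

Section Shuffle.
Variables (R : realType) (d : nat).
Implicit Types (a b u v : ctensor R d) (I J K : word d).

Lemma eshuffle_size I J K : (size I + size J)%N != size K ->
  eshuffle R I J K = 0.
Proof.
move=> h; rewrite /eshuffle; suff -> : count_mem K (shuffle I J) = 0%N by [].
by apply/count_memPn/negP => /size_shuffle; lia.
Qed.

(** The length of a shuffle is the sum of the lengths, so longer words
    contribute nothing and one bound [N] serves for all the words considered
    together. *)
Lemma cshuffleE N a b K : (size K <= N)%N ->
  cshuffle a b K = \sum_(I <- words d N) \sum_(J <- words d N)
    a I * b J * (eshuffle R I J K)%:C.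
Proof.
move=> KN; rewrite /cshuffle.
transitivity (\sum_(I <- words d (size K)) \sum_(J <- words d (size K))
    a I * b J * (eshuffle R I J K)%:C).
  rewrite sum_words; apply: eq_bigr => n _; rewrite exchange_big /=.
  by apply: eq_bigr => I _; rewrite sum_words.
transitivity (\sum_(I <- words d (size K)) \sum_(J <- words d N)
    a I * b J * (eshuffle R I J K)%:C).
  apply: eq_bigr => I _; apply: sum_words_widen => // J _ _ hJ.
  by rewrite eshuffle_size ?rmorph0 ?mulr0 //; lia.
apply: sum_words_widen => // I _ _ hI; rewrite big1 // => J _.
by rewrite eshuffle_size ?rmorph0 ?mulr0 //; lia.
Qed.

End Shuffle.

(** The cells of the partition and the word length are both gradings compatible
    with the shuffle product; that sums grouped by a grading are multiplicative
    is proved once for both. *)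
Section Graded.
Variables (R : realType) (d : nat) (S : set 'rV[R]_d) (x : state S).
Variables (g : word d -> nat) (lev : nat -> nat) (kap : nat -> nat -> nat).
Hypothesis glev : forall I, (size I <= lev (g I))%N.
Hypothesis gkap : forall I J K, K \in shuffle I J -> g K = kap (g I) (g J).
Hypothesis levl : forall k1 k2, (lev k1 <= lev (kap k1 k2))%N.
Hypothesis levr : forall k1 k2, (lev k2 <= lev (kap k1 k2))%N.
Implicit Types (a b u v : ctensor R d) (I J K : word d).

Definition gsum u k : R[i] :=
  \sum_(I <- words d (lev k) | g I == k) u I * (sval x I)%:C.

Lemma gsum_widen u k N : (lev k <= N)%N ->
  gsum u k = \sum_(I <- words d N | g I == k) u I * (sval x I)%:C.
Proof.
move=> kN; apply: sum_words_widen => // I _ /eqP E.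
by have := glev I; rewrite E; lia.
Qed.

Lemma sum_by_cells (V : nmodType) (N M : nat) (F : word d -> V) :
  (forall I, (size I <= N)%N -> (g I < M)%N) ->
  \sum_(I <- words d N) F I = \sum_(k < M) \sum_(I <- words d N | g I == k) F I.
Proof.
move=> hM; rewrite [RHS](exchange_big_dep xpredT) //=.
rewrite big_seq [RHS]big_seq; apply: eq_bigr => I; rewrite mem_words => sI.
by rewrite (big_pred1 (Ordinal (hM I sI))) // => k; rewrite eq_sym.
Qed.

Lemma cell_bound N : exists M, forall I, (size I <= N)%N -> (g I < M)%N.
Proof.
exists (\max_(I <- words d N) g I).+1 => I; rewrite -mem_words => hI.
by rewrite ltnS (big_rem I) //= leq_maxl.
Qed.

Lemma gsum_shuffle_words a b k N : (lev k <= N)%N ->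
  gsum (cshuffle a b) k = \sum_(I <- words d N) \sum_(J <- words d N)
    (if kap (g I) (g J) == k
     then (a I * (sval x I)%:C) * (b J * (sval x J)%:C) else 0).
Proof.
move=> kN; rewrite (gsum_widen _ kN) big_seq_cond.
transitivity (\sum_(K <- words d N | g K == k) \sum_(I <- words d N)
    \sum_(J <- words d N) a I * b J * (eshuffle R I J K * sval x K)%:C).
  rewrite [RHS]big_seq_cond; apply: eq_bigr => K; rewrite mem_words => /andP[KN _].
  rewrite (cshuffleE _ _ KN) mulr_suml; apply: eq_bigr => I _.
  by rewrite mulr_suml; apply: eq_bigr => J _; rewrite rmorphM mulrA.
rewrite exchange_big; apply: eq_bigr => I _; rewrite exchange_big.
apply: eq_bigr => J _; rewrite -mulr_sumr -rmorph_sum /=.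
rewrite sum_count_mem ?words_uniq //; last first.
  move=> K KIJ /eqP E; rewrite mem_words; apply: leq_trans kN.
  by rewrite -E glev.
case: eqP => E.
  rewrite mulrACA -rmorphM /=; have [_ _ ->] := svalP x; congr (_ * _%:C).
  rewrite big_seq_cond [RHS]big_seq; apply: eq_bigl => K.
  by case: (boolP (K \in _)) => //= /gkap ->; rewrite E eqxx.
rewrite big_seq_cond big1 ?mulr0 // => K /andP[/gkap -> /eqP] //.
Qed.

(** Since [x] is group-like, a product of terms of [a] and of [b] is the sum of
    the terms of their shuffles, which all have the grade given by [kap]. Words
    longer than [lev k] do not reach the grade [k], which leaves finitely many
    pairs of grades. *)
Lemma gsum_shuffle a b k : exists M0, forall M, (M0 <= M)%N ->
  gsum (cshuffle a b) k =
    \sum_(k1 < M) \sum_(k2 < M | kap k1 k2 == k) gsum a k1 * gsum b k2.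
Proof.
have [M0 hM0] := cell_bound (lev k); exists M0 => M hM.
have hM1 I : (size I <= lev k)%N -> (g I < M)%N by move=> /hM0; lia.
rewrite (gsum_shuffle_words _ _ (leqnn (lev k))) (sum_by_cells _ hM1).
apply: eq_bigr => k1 _.
under eq_bigr do rewrite (sum_by_cells _ hM1).
rewrite exchange_big [RHS]big_mkcond; apply: eq_bigr => k2 _ /=.
case: eqP => E.
  rewrite (gsum_widen a (N := lev k)); last by rewrite -E levl.
  rewrite (gsum_widen b (N := lev k)); last by rewrite -E levr.
  rewrite mulr_suml; apply: eq_bigr => I /eqP gI; rewrite mulr_sumr.
  by apply: eq_bigr => J /eqP gJ; rewrite gI gJ E eqxx.
rewrite big1 // => I /eqP gI; rewrite big1 // => J /eqP gJ.
by rewrite gI gJ; case: eqP.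
Qed.

Lemma gsumD u v k : gsum (fun K => u K + v K) k = gsum u k + gsum v k.
Proof. by rewrite -big_split; apply: eq_bigr => I _; rewrite mulrDl. Qed.

Lemma gsumZ c u k : gsum (fun K => c * u K) k = c * gsum u k.
Proof. by rewrite mulr_sumr; apply: eq_bigr => I _; rewrite mulrA. Qed.

End Graded.

(** * The pairing is multiplicative on the dual *)

Lemma sum_pred1_le (R : numDomainType) (N m : nat) (c : R) : 0 <= c ->
  \sum_(k < N | m == k) c <= c.
Proof.
move=> c0; case: (ltnP m N) => mN.
  by rewrite (big_pred1 (Ordinal mN)) // => k; rewrite eq_sym.
by rewrite big1 // => k /eqP E; move: mN; rewrite E leqNgt ltn_ord.
Qed.

Section CellSums.
Variables (R : realType) (d : nat) (Pi : nat -> set (word d)).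
Hypothesis hPi : shuffle_partition R Pi.
Implicit Types (I J K : word d).

(** The words occurring in the shuffle of two words lie in a cell that depends
    on the two cells only. Thus the index of the cell is a grading for the
    shuffle product, and it refines the length, because a cell contains words of
    one length; lengths of cells add up since the shuffle of two representatives
    is not empty. *)
Lemma partition_gradingP : { g : word d -> nat & { lev : nat -> nat &
    { kap : nat -> nat -> nat |
  [/\ forall k I, Pi k I <-> g I = k, forall I, size I = lev (g I),
      forall I J K, K \in shuffle I J -> g K = kap (g I) (g J) &
      forall k1 k2, lev (kap k1 k2) = (lev k1 + lev k2)%N]}}}.
Proof.
have [[hcov htriv hne] hsz hsh] := hPi.
have h1 I : exists k, Pi k I.
  by have : [set: word d] I by []; rewrite -hcov => -[k _ ?]; exists k.
pose g I := projT1 (cid (h1 I)).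
have gP I : Pi (g I) I by exact: projT2 (cid (h1 I)).
have gE k I : Pi k I <-> g I = k.
  split=> [kI|<- //]; apply: htriv => //; exists I; split => //; exact: gP.
pose w k := projT1 (cid (hne k Logic.I)).
have wP k : Pi k (w k) by exact: projT2 (cid (hne k Logic.I)).
pose lev k := size (w k).
have levP I : size I = lev (g I) by apply: (hsz (g I)) => //; exact: gP.
pose kap k1 k2 := projT1 (cid (hsh k1 k2)).
have kapP k1 k2 I J K : Pi k1 I -> Pi k2 J -> K \in shuffle I J -> Pi (kap k1 k2) K.
  move=> kI kJ KIJ; have [lam hlam] := projT2 (cid (hsh k1 k2)) _ _ kI kJ.
  apply: contrapT => nK; have := hlam K; rewrite fsbig1.
    rewrite /eshuffle => /eqP; rewrite pnatr_eq0 => /eqP/count_memPn.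
    by rewrite KIJ.
  move=> L kL; case: eqP => [E|]; rewrite ?mulr0 //; by rewrite E in nK.
exists g, lev, kap; split => //.
  by move=> I J K KIJ; apply/gE; apply: kapP KIJ; exact: gP.
move=> k1 k2; have [K hK] := shuffle_neq_nil (w k1) (w k2).
by have /gE <- := kapP _ _ _ _ _ (wP k1) (wP k2) hK; rewrite -levP (size_shuffle hK).
Qed.

Definition cell : word d -> nat := projT1 partition_gradingP.
Definition level : nat -> nat := projT1 (projT2 partition_gradingP).
Definition kappa : nat -> nat -> nat :=
  proj1_sig (projT2 (projT2 partition_gradingP)).

Lemma cellP k I : Pi k I <-> cell I = k.
Proof. by have [h _ _ _] := proj2_sig (projT2 (projT2 partition_gradingP)); exact: h. Qed.
Lemma levelP I : size I = level (cell I).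
Proof. by have [_ h _ _] := proj2_sig (projT2 (projT2 partition_gradingP)); exact: h. Qed.
Lemma kappaP I J K : K \in shuffle I J -> cell K = kappa (cell I) (cell J).
Proof. by have [_ _ h _] := proj2_sig (projT2 (projT2 partition_gradingP)); exact: h. Qed.
Lemma level_kappa k1 k2 : level (kappa k1 k2) = (level k1 + level k2)%N.
Proof. by have [_ _ _ h] := proj2_sig (projT2 (projT2 partition_gradingP)); exact: h. Qed.

Variable (S : set 'rV[R]_d).
Implicit Types (x : state S) (u v a b : ctensor R d) (c : R[i]) (C D : R).

Definition csum x u k : R[i] := gsum x cell level u k.
Definition lsum x u n : R[i] := gsum x (fun I => size I) id u n.

Lemma csumE x u k : csum x u k = \sum_(I \in Pi k) u I * (sval x I)%:C.
Proof.
rewrite /csum /gsum -big_filter fsbig_seq ?filter_uniq ?words_uniq //.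
apply: eq_fsbigl; apply/seteqP; split => I /=; rewrite mem_filter mem_words.
  by move=> /andP[/eqP /cellP].
by move=> /cellP E; rewrite E eqxx levelP E leqnn.
Qed.

Lemma lsumE x u n : lsum x u n = \sum_(I : n.-tuple 'I_d) u I * (sval x I)%:C.
Proof.
rewrite /lsum /gsum big_mkcond sum_words big_ord_recr /= big1 => [|i _]; last first.
  by rewrite big1 // => I _; rewrite size_tuple ltn_eqF.
by rewrite add0r; apply: eq_bigr => I _; rewrite size_tuple eqxx.
Qed.

(** Bounds on the partial sums replace the norm at [x], which is an extended
    real number; they combine by real inequalities. *)
Definition bounded_at x u C := forall M, \sum_(k < M) normc (csum x u k) <= C.

Lemma dualP u : dual S Pi u <-> forall x, exists C, bounded_at x u C.
Proof.
have h0 x k : (0 <= (normc (\sum_(I \in Pi k) u I * (sval x I)%:C))%:E)%E.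
  by rewrite lee_fin normc_ge0.
split=> hu x.
  have := hu x; rewrite /cell_norm => fin.
  exists (fine (cell_norm Pi u x)) => M; rewrite -lee_fin fineK; last first.
    by rewrite ge0_fin_numE //; apply: nneseries_ge0 => n _ _; exact: h0.
  apply: le_trans (nneseries_lim_ge (P := xpredT) M _); last by move=> *; exact: h0.
  rewrite big_mkord sumEFin lee_fin; apply: ler_sum => k _.
  by rewrite csumE.
have [C hC] := hu x; apply: le_lt_trans (ltry C).
apply: lime_le; first by apply: is_cvg_nneseries => n _ _; exact: h0.
apply: nearW => M; rewrite big_mkord sumEFin lee_fin.
by apply: le_trans (hC M); apply: ler_sum => k _; rewrite csumE.
Qed.

Lemma bounded_at_ge0 x u C : bounded_at x u C -> 0 <= C.
Proof. by move/(_ 0%N); rewrite big_ord0. Qed.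

Lemma bounded_at_lin x c u v C D : bounded_at x u C -> bounded_at x v D ->
  bounded_at x (fun K => c * u K + v K) (normc c * C + D).
Proof.
move=> hu hv M; apply: le_trans (_ : \sum_(k < M)
    (normc c * normc (csum x u k) + normc (csum x v k)) <= _).
  apply: ler_sum => k _; rewrite /csum gsumD gsumZ -normcM; exact: normcD.
rewrite big_split /= -mulr_sumr; apply: lerD; last exact: hv.
by rewrite ler_wpM2l ?normc_ge0 //; exact: hu.
Qed.

(** The norm is submultiplicative: a pair of cells contributes to one cell of
    the product, so the sum over all cells of the product is at most the double
    sum over pairs. *)
Lemma bounded_at_shuffle x a b C D : bounded_at x a C -> bounded_at x b D ->
  bounded_at x (cshuffle a b) (C * D).
Proof.
move=> ha hb N.
have hM0 k : exists M0, forall M, (M0 <= M)%N -> csum x (cshuffle a b) k =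
    \sum_(k1 < M) \sum_(k2 < M | kappa k1 k2 == k) csum x a k1 * csum x b k2.
  apply: gsum_shuffle => [I|I J K|k1 k2|k1 k2].
  - by rewrite -levelP.
  - exact: kappaP.
  - by rewrite level_kappa leq_addr.
  - by rewrite level_kappa leq_addl.
pose m k := projT1 (cid (hM0 k)).
have hm k := projT2 (cid (hM0 k)).
pose M := (\max_(k < N) m k)%N.
apply: le_trans (_ : \sum_(k < N) \sum_(k1 < M) \sum_(k2 < M | kappa k1 k2 == k)
    normc (csum x a k1) * normc (csum x b k2) <= _).
  apply: ler_sum => k _; rewrite (hm k M); last exact: (leq_bigmax (F := fun k : 'I_N => m k)).
  apply: le_trans (normc_sum _ _ _) _; apply: ler_sum => k1 _.
  apply: le_trans (normc_sum _ _ _) _; apply: ler_sum => k2 _.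
  by rewrite normcM.
rewrite exchange_big /=.
apply: le_trans (_ : \sum_(k1 < M) normc (csum x a k1) * D <= _); last first.
  by rewrite -mulr_suml ler_wpM2r ?(bounded_at_ge0 hb) //; exact: ha.
apply: ler_sum => k1 _.
rewrite (exchange_big_dep xpredT) //=.
apply: le_trans (_ : \sum_(k2 < M) normc (csum x a k1) * normc (csum x b k2) <= _).
  apply: ler_sum => k2 _; apply: sum_pred1_le.
  by rewrite mulr_ge0 ?normc_ge0.
by rewrite -mulr_sumr ler_wpM2l ?normc_ge0 //; exact: hb.
Qed.

(** Cells refine lengths. Hence the norm, a sum over cells, controls the
    pairing, a series over lengths, which therefore converges absolutely. *)
Lemma sum_lsum_le x u C : bounded_at x u C ->
  forall N, \sum_(n < N) normc (lsum x u n) <= C.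
Proof.
move=> hu N.
have [M hM] : exists M, forall n, (n < N)%N ->
    lsum x u n = \sum_(k < M | level k == n) csum x u k.
  have [M hM] := cell_bound cell N.
  exists M => n nN; rewrite /lsum /gsum -big_filter.
  rewrite (_ : [seq I <- _ | _] = [seq I <- words d n | size I == n]) //.
  rewrite big_filter big_mkcond (sum_by_cells (g := cell) (M := M)); last first.
    by move=> I sI; apply: hM; apply: leq_trans sI (ltnW nN).
  rewrite [RHS]big_mkcond; apply: eq_bigr => k _; rewrite -big_mkcondr /=.
  case: eqP => E.
    (* A cell of level [n] consists of words of length [n]. *)
    rewrite /csum /gsum E; apply: eq_bigl => I.
    by case: eqP => //= gI; rewrite levelP gI E eqxx.
  by rewrite big1 // => I /andP[/eqP gI /eqP sI]; case: E; rewrite -gI -levelP.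
apply: le_trans (_ : \sum_(n < N) \sum_(k < M | level k == n) normc (csum x u k) <= _).
  by apply: ler_sum => n _; rewrite hM //; exact: normc_sum.
rewrite (exchange_big_dep xpredT) //=; apply: le_trans (hu M).
by apply: ler_sum => k _; apply: sum_pred1_le; exact: normc_ge0.
Qed.

Lemma pairing_cvg x u C : bounded_at x u C ->
  ccvg (fun N => \sum_(n < N) lsum x u n) (pairing u x) /\
  normc (pairing u x) <= C.
Proof.
move=> hu; have [l hl lC] := csum_abs_cvg (sum_lsum_le hu).
suff -> : pairing u x = l by [].
apply: ccvg_clim; have := ccvg_subseq (f := succn) (fun n => leqnSn n) hl.
congr ccvg; apply/funext => N /=.
by apply: eq_bigr => n _; rewrite lsumE.
Qed.

Lemma pairing_lin x c u v C D : bounded_at x u C -> bounded_at x v D ->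
  pairing (fun K => c * u K + v K) x = c * pairing u x + pairing v x.
Proof.
move=> hu hv; have [h _] := pairing_cvg (bounded_at_lin c hu hv).
apply: (ccvg_unique h).
have [h1 _] := pairing_cvg hu; have [h2 _] := pairing_cvg hv.
have := ccvgD (ccvgM (ccvg_cst c) h1) h2; congr ccvg; apply/funext => N /=.
rewrite mulr_sumr -big_split; apply: eq_bigr => n _.
by rewrite /lsum gsumD gsumZ.
Qed.

Lemma lsum_shuffle x a b n :
  lsum x (cshuffle a b) n = \sum_(i < n.+1) lsum x a i * lsum x b (n - i)%N.
Proof.
have [M0 hM0] := @gsum_shuffle R d S x (fun I => size I) id addn (fun I => leqnn _)
  (fun I J K h => size_shuffle h) (fun k1 k2 => leq_addr _ _) (fun k1 k2 => leq_addl _ _) a b n.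
rewrite /lsum (hM0 (maxn M0 n.+1) (leq_maxl _ _)).
rewrite (big_ord_widen (maxn M0 n.+1) (fun i => lsum x a i * lsum x b (n - i)%N)) ?leq_maxr //.
rewrite [RHS]big_mkcond; apply: eq_bigr => i _ /=.
case: ifP => hi; last by rewrite big1 // => j /eqP; lia.
have hj : (n - i < maxn M0 n.+1)%N by lia.
rewrite (big_pred1 (Ordinal hj)) // => j /=; rewrite -val_eqE /=; lia.
Qed.

(** Lengths add up under the shuffle product, so the series of the product is
    the Cauchy product of two absolutely convergent series. *)
Lemma pairing_shuffle x a b C D : bounded_at x a C -> bounded_at x b D ->
  pairing (cshuffle a b) x = pairing a x * pairing b x.
Proof.
move=> ha hb; have [h _] := pairing_cvg (bounded_at_shuffle ha hb).
apply: (ccvg_unique h).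
have [h1 _] := pairing_cvg ha; have [h2 _] := pairing_cvg hb.
have := cauchy_product (sum_lsum_le ha) (sum_lsum_le hb) h1 h2.
by congr ccvg; apply/funext => N; apply: eq_bigr => n _; rewrite lsum_shuffle.
Qed.

Lemma csum_unit x k : csum x (eword R [::]) k = (k == cell [::])%:R.
Proof.
rewrite /csum /gsum (eq_bigr (fun I => (count_mem I [:: [::]])%:R * (sval x I)%:C)).
  rewrite sum_count_mem ?words_uniq //.
    rewrite big_cons big_nil addr0; have [_ -> _] := svalP x.
    by rewrite eq_sym; case: eqP.
  by move=> K; rewrite inE mem_words => /eqP ->.
by move=> I _; rewrite /eword /= addn0 eq_sym.
Qed.

Lemma bounded_at_unit x : bounded_at x (eword R [::]) 1.
Proof.
move=> M; apply: le_trans (_ : \sum_(k < M | cell [::] == k) 1 <= _).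
  rewrite [leRHS]big_mkcond; apply: ler_sum => k _; rewrite csum_unit eq_sym.
  by case: eqP; rewrite ?normc1 ?normc0.
exact: sum_pred1_le.
Qed.

Lemma pairing_unit x : pairing (eword R [::]) x = 1.
Proof.
have [h _] := pairing_cvg (bounded_at_unit x).
have h1 : ccvg (fun N => \sum_(n < N.+1) lsum x (eword R [::]) n) 1.
  apply: (squeeze0 (g := fun=> 0)); last exact: cvg_cst.
  move=> N; rewrite normc_ge0 big_ord_recl big1 => [|i _].
    rewrite lsumE (big_pred1 [tuple]) ?addr0; last first.
      by move=> t; apply/esym/eqP; rewrite [t]tuple0; apply: val_inj.
    by rewrite /eword eqxx mul1r; have [_ -> _] := svalP x; rewrite subrr normc0 lexx.
  by rewrite lsumE big1 // => -[[|j t] //= st] _; rewrite /eword /= mul0r.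
exact: (ccvg_unique (ccvg_subseq (f := succn) (fun n => leqnSn n) h) h1).
Qed.

Lemma bounded_at_pow x u C k : bounded_at x u C ->
  bounded_at x (shuffle_pow u k) (C ^+ k) /\
  pairing (shuffle_pow u k) x = pairing u x ^+ k.
Proof.
move=> hu; elim: k => [|k [IH1 IH2]] /=.
  by rewrite !expr0; split; [exact: bounded_at_unit|exact: pairing_unit].
split; first by rewrite exprSr; exact: bounded_at_shuffle.
by rewrite (pairing_shuffle IH1 hu) IH2 exprSr.
Qed.

End CellSums.

(** * The shuffle exponential *)

Section ShuffleExp.
Variables (R : realType) (d : nat).
Implicit Types (u v a b : ctensor R d).

(** On words of bounded length the shuffle product is a bilinear map between
    spaces of finite dimension, hence bounded in this norm. The componentwise
    exponential series converges for this reason, for every tensor. *)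
Definition wnorm N a : R := \sum_(I <- words d N) normc (a I).

Lemma wnorm_ge0 N a : 0 <= wnorm N a.
Proof. by apply: sumr_ge0 => I _; exact: normc_ge0. Qed.

Lemma le_wnorm N a K : (size K <= N)%N -> normc (a K) <= wnorm N a.
Proof.
rewrite -mem_words => hK; rewrite /wnorm (bigD1_seq K) ?words_uniq //= lerDl.
by apply: sumr_ge0 => I _; exact: normc_ge0.
Qed.

Lemma wnorm_shuffle N : exists2 B : R, 0 <= B &
  forall a b, wnorm N (cshuffle a b) <= wnorm N a * wnorm N b * B.
Proof.
pose B : R := \sum_(K <- words d N) \sum_(I <- words d N) \sum_(J <- words d N)
  eshuffle R I J K.
have B0 : 0 <= B by do 3!apply: sumr_ge0 => ? _; rewrite /eshuffle.
exists B => // a b; rewrite /wnorm /B mulr_sumr big_seq [leRHS]big_seq.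
apply: ler_sum => K; rewrite mem_words => hK.
rewrite (cshuffleE _ _ hK) (le_trans (normc_sum _ _ _)) // mulr_sumr.
rewrite big_seq [leRHS]big_seq; apply: ler_sum => I; rewrite mem_words => hI.
rewrite (le_trans (normc_sum _ _ _)) // mulr_sumr.
rewrite big_seq [leRHS]big_seq; apply: ler_sum => J; rewrite mem_words => hJ.
rewrite !normcM normc_real ger0_norm ?ler0n //.
rewrite ler_wpM2r ?ler0n // ler_pM ?normc_ge0 ?le_wnorm //.
Qed.

Lemma shuffle_exp_cvg u K :
  ccvg (fun N => \sum_(k < N) shuffle_pow u k K / (k`!)%:R) (shuffle_exp u K).
Proof.
have [B B0 hB] := wnorm_shuffle (size K).
set E := wnorm (size K) (eword R [::]); set D := wnorm (size K) u * B.
have hE k : wnorm (size K) (shuffle_pow u k) <= E * D ^+ k.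
  elim: k => [|k IH] /=; first by rewrite expr0 mulr1.
  apply: le_trans (hB _ _) _; rewrite -mulrA -/D exprSr mulrA ler_wpM2r //.
  by rewrite mulr_ge0 ?wnorm_ge0.
have [|l hl _] := @csum_abs_cvg R (fun k => shuffle_pow u k K / (k`!)%:R) (E * expR D).
  move=> N; apply: le_trans (_ : \sum_(k < N) E * (D ^+ k / (k`!)%:R) <= _).
    apply: ler_sum => k _; rewrite normcM normcV normc_nat mulrA.
    by rewrite ler_wpM2r ?invr_ge0 ?ler0n // (le_trans (le_wnorm _ (leqnn _))).
  rewrite -mulr_sumr ler_wpM2l ?wnorm_ge0 // exp_sum_le // mulr_ge0 //.
  exact: wnorm_ge0.
by rewrite /shuffle_exp (ccvg_clim hl).
Qed.

Variables (Pi : nat -> set (word d)) (hPi : shuffle_partition R Pi).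
Variable (S : set 'rV[R]_d).
Implicit Types (x : state S) (C : R).

Let psum u N : ctensor R d := fun K => \sum_(k < N) shuffle_pow u k K / (k`!)%:R.

Lemma psumS u N :
  psum u N.+1 = (fun K => (N`!)%:R^-1 * shuffle_pow u N K + psum u N K).
Proof.
by apply/funext => K; rewrite /psum big_ord_recr /= addrC; congr (_ + _); rewrite mulrC.
Qed.

(** The shuffle powers of [u] have norms at most the powers of [C], so
    differences of partial sums are bounded by those of the scalar exponential
    series. *)
Lemma psum_bound x u C : bounded_at hPi x u C -> forall N n,
  bounded_at hPi x (fun K => -1 * psum u N K + psum u (N + n) K)
    (\sum_(N <= k < N + n) C ^+ k / (k`!)%:R).
Proof.
move=> hu N; elim=> [|n IH].
  rewrite addn0 big_geq // => M; rewrite big1 // => k _.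
  by rewrite /csum gsumD gsumZ mulN1r addNr normc0.
rewrite addnS big_nat_recr ?leq_addr //=.
have [h _] := bounded_at_pow (N + n) hu.
have := bounded_at_lin ((N + n)`!%:R^-1) h IH.
rewrite normcV normc_nat [X in bounded_at _ _ _ X]addrC [_^-1 * _]mulrC.
congr bounded_at; apply/funext => K; rewrite psumS; ring.
Qed.

Lemma psum_pairing x u C : bounded_at hPi x u C -> forall N,
  (exists D, bounded_at hPi x (psum u N) D) /\
  pairing (psum u N) x = \sum_(k < N) pairing u x ^+ k / (k`!)%:R.
Proof.
move=> hu; elim=> [|N [[D hD] IH]].
  have h0 : psum u 0 = fun K => -1 * eword R [::] K + eword R [::] K.
    by apply/funext => K; rewrite /psum big_ord0 mulN1r addNr.
  have h1 := bounded_at_unit hPi x.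
  rewrite h0 (pairing_lin _ h1 h1) big_ord0 mulN1r addNr; split => //.
  by exists (normc (-1) * 1 + 1); exact: bounded_at_lin.
have [h hp] := bounded_at_pow N hu; rewrite psumS (pairing_lin _ h hD) hp IH.
split; first by eexists; exact: (bounded_at_lin _ h hD).
by rewrite big_ord_recr /= addrC [_^-1 * _]mulrC.
Qed.

(** The bound for differences of partial sums survives when the upper index
    grows, because each finite sum over cells is continuous in the coefficients. *)
Lemma shuffle_exp_tail x u C : bounded_at hPi x u C -> forall N,
  bounded_at hPi x (fun K => -1 * psum u N K + shuffle_exp u K)
    (expR C - \sum_(k < N) C ^+ k / (k`!)%:R).
Proof.
move=> hu N M; have C0 := bounded_at_ge0 hu.
have hc k : ccvg (fun n => csum hPi x (fun K => -1 * psum u N K + psum u (N + n) K) k)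
    (csum hPi x (fun K => -1 * psum u N K + shuffle_exp u K) k).
  rewrite /csum /gsum -big_filter; under eq_fun do rewrite -big_filter.
  apply: ccvg_sum => K; apply: ccvgM; last exact: ccvg_cst.
  apply: ccvgD; first exact: ccvg_cst.
  exact: (ccvg_subseq (f := addn N) (fun n => leq_addl _ _) (shuffle_exp_cvg u K)).
have hl : \sum_(k < M) normc (csum hPi x (fun K => -1 * psum u N K + psum u (N + n) K) k)
    @[n --> \oo] --> \sum_(k < M) normc (csum hPi x (fun K => -1 * psum u N K + shuffle_exp u K) k).
  by apply: cvg_sumr => k; exact: ccvg_normc (hc k).
rewrite -(cvg_lim _ hl) //; apply: limr_le; first exact: cvgP hl.
apply: nearW => n; apply: le_trans (psum_bound hu N n M) _.
rewrite lerBrDl -(big_mkord xpredT (fun k => C ^+ k / (k`!)%:R)).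
rewrite -big_cat_nat ?leq_addr //= big_mkord; exact: exp_sum_le.
Qed.

Lemma shuffle_exp_bounded x u C : bounded_at hPi x u C ->
  bounded_at hPi x (shuffle_exp u) (expR C).
Proof.
move=> hu M; have := shuffle_exp_tail hu 0 M; rewrite big_ord0 subr0.
apply: le_trans; apply: ler_sum => k _.
rewrite /csum gsumD gsumZ [X in -1 * X]/gsum big1 ?mulr0 ?add0r //.
by move=> K _; rewrite /psum big_ord0 mul0r.
Qed.

(** The partial sums pair to the partial sums of the complex exponential, since
    pairing is multiplicative, and the pairing of the tail is bounded by its
    norm. *)
Lemma pairing_shuffle_exp x u C : bounded_at hPi x u C ->
  pairing (shuffle_exp u) x = cexp (pairing u x).
Proof.
move=> hu; apply: (ccvg_unique _ (cexp_series _)).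
apply: (squeeze0 (g := fun N => expR C - \sum_(k < N) C ^+ k / (k`!)%:R)).
  move=> N; rewrite normc_ge0 /=.
  have [[D hD] <-] := psum_pairing hu N.
  have [_] := pairing_cvg (shuffle_exp_tail hu N).
  rewrite (pairing_lin _ hD (shuffle_exp_bounded hu)) mulN1r addrC.
  by rewrite normc_distC.
rewrite -[0 in X in _ --> X](subrr (expR C)); apply: cvgB; first exact: cvg_cst.
rewrite (_ : (fun n => _) = series (exp_coeff C)); last first.
  by apply/funext => n; rewrite series_ord.
exact: is_cvg_series_exp_coeff.
Qed.

End ShuffleExp.

(** * From affine to polynomial processes *)

Section Dual.
Variables (R : realType) (d : nat) (Pi : nat -> set (word d)).
Hypothesis hPi : shuffle_partition R Pi.
Variable (S : set 'rV[R]_d).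
Implicit Types (x : state S) (u v : ctensor R d) (c : R[i]).
Local Notation dual := (dual S Pi).

Lemma dual_lin c u v : dual u -> dual v -> dual (fun K => c * u K + v K).
Proof.
move=> /(dualP hPi) hu /(dualP hPi) hv; apply/(dualP hPi) => x.
have [C hC] := hu x; have [D hD] := hv x.
by eexists; exact: bounded_at_lin hC hD.
Qed.

Lemma dual0 : dual (fun=> 0).
Proof.
apply/(dualP hPi) => x; exists 0 => M; rewrite big1 // => k _.
by rewrite /csum /gsum big1 ?normc0 // => I _; rewrite mul0r.
Qed.

Lemma dual_shuffle u v : dual u -> dual v -> dual (cshuffle u v).
Proof.
move=> /(dualP hPi) hu /(dualP hPi) hv; apply/(dualP hPi) => x.
have [C hC] := hu x; have [D hD] := hv x.
by eexists; exact: bounded_at_shuffle hC hD.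
Qed.

Lemma dual_shuffle_exp u : dual u -> dual (shuffle_exp u).
Proof.
move=> /(dualP hPi) hu; apply/(dualP hPi) => x; have [C hC] := hu x.
by eexists; exact: shuffle_exp_bounded hC.
Qed.

Lemma dual_pairing_lin c u v x : dual u -> dual v ->
  pairing (fun K => c * u K + v K) x = c * pairing u x + pairing v x.
Proof.
move=> /(dualP hPi) hu /(dualP hPi) hv.
have [C hC] := hu x; have [D hD] := hv x; exact: pairing_lin hC hD.
Qed.

Lemma dual_pairing_shuffle u v x : dual u -> dual v ->
  pairing (cshuffle u v) x = pairing u x * pairing v x.
Proof.
move=> /(dualP hPi) hu /(dualP hPi) hv.
have [C hC] := hu x; have [D hD] := hv x; exact: pairing_shuffle hC hD.
Qed.

Lemma dual_pairing_exp u x : dual u ->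
  pairing (shuffle_exp u) x = cexp (pairing u x).
Proof. by move=> /(dualP hPi) /(_ x) [C hC]; exact: pairing_shuffle_exp hC. Qed.

Lemma dual_sum n (c : 'I_n -> R[i]) (g : 'I_n -> ctensor R d) :
  (forall i, dual (g i)) -> dual (fun K => \sum_(i < n) c i * g i K) /\
  forall x, pairing (fun K => \sum_(i < n) c i * g i K) x =
    \sum_(i < n) c i * pairing (g i) x.
Proof.
elim: n c g => [|n IH] c g hg.
  rewrite (_ : (fun K => _) = (fun=> 0)); last by apply/funext => K; rewrite big_ord0.
  split=> [|x]; first exact: dual0.
  rewrite big_ord0 (_ : (fun=> 0) = fun K : word d => -1 * (0 : R[i]) + 0).
    by rewrite (@dual_pairing_lin (-1) (fun=> 0) (fun=> 0)) ?mulN1r ?addNr //; exact: dual0.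
  by apply/funext => K; rewrite mulr0 addr0.
have [IH1 IH2] := IH (fun i => c (lift ord0 i)) (fun i => g (lift ord0 i)) (fun i => hg _).
rewrite (_ : (fun K => _) = fun K => c ord0 * g ord0 K +
    \sum_(i < n) c (lift ord0 i) * g (lift ord0 i) K); last first.
  by apply/funext => K; rewrite big_ord_recl.
split=> [|x]; first exact: dual_lin.
by rewrite dual_pairing_lin // IH2 big_ord_recl.
Qed.

End Dual.

Section Span.
Variable R : realType.

Lemma cspan_sub (A : Type) (G : set (A -> R[i])) : G `<=` cspan G.
Proof.
move=> g Gg; exists 1%N, (fun=> 1), (fun=> g); split => //.
by apply/funext => a; rewrite big_ord1 mul1r.
Qed.

Lemma cspan0 (A : Type) (G : set (A -> R[i])) : cspan G (fun=> 0).
Proof.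
exists 0%N, (fun=> 0), (fun=> fun=> 0); split => [[]//|].
by apply/funext => a; rewrite big_ord0.
Qed.

Lemma cspan_lin (A : Type) (G : set (A -> R[i])) c f g :
  cspan G f -> cspan G g -> cspan G (fun a => c * f a + g a).
Proof.
move=> [n [cf [gf [hf ->]]]] [m [cg [gg [hg ->]]]].
exists (n + m)%N, (fun i => match fintype.split i with inl i => c * cf i | inr i => cg i end),
  (fun i => match fintype.split i with inl i => gf i | inr i => gg i end); split.
  by move=> i; case: (fintype.split i).
apply/funext => a; rewrite big_split_ord /= mulr_sumr; congr (_ + _).
  by apply: eq_bigr => i _; rewrite (unsplitK (inl i)) mulrA.
by apply: eq_bigr => i _; rewrite (unsplitK (inr i)).
Qed.

Lemma cspan_linear_subset (A : Type) (G : set (A -> R[i])) : linear_subset (cspan G).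
Proof. by split; [exact: cspan0|move=> c f g; exact: cspan_lin]. Qed.

Lemma linear_on_sum (A : Type) (G : set (A -> R[i])) Lop : linear_on (cspan G) Lop ->
  forall n (c : 'I_n -> R[i]) (g : 'I_n -> A -> R[i]), (forall i, G (g i)) ->
  Lop (fun a => \sum_(i < n) c i * g i a) = fun a => \sum_(i < n) c i * Lop (g i) a.
Proof.
move=> hL; elim=> [|n IH] c g hg.
  rewrite (_ : (fun a => _) = (fun=> 0)); last by apply/funext => a; rewrite big_ord0.
  have := hL (-1) _ _ (cspan0 G) (cspan0 G).
  rewrite (_ : (fun a => -1 * 0 + 0) = (fun=> 0)); last first.
    by apply/funext => a; rewrite mulr0 addr0.
  by move=> ->; apply/funext => a; rewrite big_ord0 mulN1r addNr.
have := hL (c ord0) (g ord0)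
  (fun a => \sum_(i < n) c (lift ord0 i) * g (lift ord0 i) a).
rewrite IH // (_ : (fun a => _ + _) = (fun a => \sum_(i < n.+1) c i * g i a)).
  move=> -> //; first by apply/funext => a; rewrite big_ord_recl.
    exact: cspan_sub.
  by eexists n, _, _; split; [|reflexivity] => i; exact: hg.
by apply/funext => a; rewrite big_ord_recl.
Qed.

End Span.

Section AffinePolynomial.
Variables (R : realType) (d : nat) (Pi : nat -> set (word d)).
Hypothesis hPi : shuffle_partition R Pi.
Variable (S : set 'rV[R]_d).
Variables (U : set (ctensor R d)) (Rm : ctensor R d -> ctensor R d).
Hypothesis Ud : U `<=` dual S Pi.
Hypothesis Rd : forall u, U u -> dual S Pi (Rm u).
Local Notation V := (cspan (@shuffle_exp R d @` U)).

Lemma exp_pairingE u : U u -> pairing (shuffle_exp u) = exp_pairing (S := S) u.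
Proof. by move=> Uu; apply/funext => x; rewrite (dual_pairing_exp hPi) //; exact: Ud. Qed.

Lemma exp_family n (g : 'I_n -> ctensor R d) :
  (forall i, (@shuffle_exp R d @` U) (g i)) ->
  { u : 'I_n -> ctensor R d | (forall i, U (u i)) /\ (forall i, g i = shuffle_exp (u i)) }.
Proof.
move=> hg; have h i : exists u, U u /\ g i = shuffle_exp u.
  by have [u Uu <-] := hg i; exists u.
by exists (fun i => projT1 (cid (h i))); split => i; case: (cid (h i)) => u [].
Qed.

Lemma polynomial_domain_exp : polynomial_domain V = affine_domain (S := S) U.
Proof.
apply/seteqP; split => f /=.
  move=> [_ [n [c [g [hg ->]]]] ->].
  have [u [Uu gu]] := exp_family hg.
  have hd i : dual S Pi (g i).
    by rewrite gu; apply: (dual_shuffle_exp hPi); exact: Ud.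
  exists n, c, (fun i => exp_pairing (u i)); split; first by move=> i; exists (u i).
  apply/funext => x; have [_ ->] := dual_sum hPi c hd.
  by apply: eq_bigr => i _; rewrite gu exp_pairingE.
move=> [n [c [g [hg ->]]]].
have h i : exists u, U u /\ g i = exp_pairing u by have [u Uu ->] := hg i; exists u.
pose u i := projT1 (cid (h i)).
have [Uu gu] : (forall i, U (u i)) /\ (forall i, g i = exp_pairing (u i)).
  by split => i; rewrite /u; case: (cid (h i)) => v [].
exists (fun K => \sum_(i < n) c i * shuffle_exp (u i) K).
  exists n, c, (fun i => shuffle_exp (u i)); split => // i.
  by exists (u i).
apply/funext => x.
have hd i : dual S Pi (shuffle_exp (u i)) by apply: (dual_shuffle_exp hPi); exact: Ud.
have [_ ->] := dual_sum hPi c hd.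
by apply: eq_bigr => i _; rewrite gu exp_pairingE.
Qed.

(** The image of a combination of exponentials under the polynomial associated
    map depends on the chosen representation only up to tensors that pair to
    zero; a single exponential is represented by itself. *)
Definition exp_rep (v : ctensor R d) (n : nat) (c : 'I_n -> R[i])
    (u : 'I_n -> ctensor R d) : Prop :=
  (forall i, U (u i)) /\ v = (fun K => \sum_(i < n) c i * shuffle_exp (u i) K).

(** A tensor that is itself the exponential of an element of [U] is given this
    representation; any other element of the span gets an arbitrary one. *)
Lemma associated_mapP v : exists w : ctensor R d,
  (V v -> exists n c u, @exp_rep v n c u /\
     w = fun K => \sum_(i < n) c i * cshuffle (shuffle_exp (u i)) (Rm (u i)) K) /\
  ((exists2 u, U u & v = shuffle_exp u) -> exists u, [/\ U u, v = shuffle_exp u &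
     w = cshuffle (shuffle_exp u) (Rm u)]).
Proof.
case: (pselect (exists2 u, U u & v = shuffle_exp u)) => [[u Uu ->]|nu].
  exists (cshuffle (shuffle_exp u) (Rm u)); split=> [_|_]; last by exists u.
  exists 1%N, (fun=> 1), (fun=> u); split.
    by split => //; apply/funext => K; rewrite big_ord1 mul1r.
  by apply/funext => K; rewrite big_ord1 mul1r.
case: (pselect (V v)) => [[n [c [g [hg vE]]]]|nV]; last by exists v.
have [u [Uu gu]] := exp_family hg.
eexists; split; last by move=> /nu.
move=> _; exists n, c, u; split; last reflexivity; split => //.
by rewrite vE; apply/funext => K; apply: eq_bigr => i _; rewrite gu.
Qed.

Definition associated_map v : ctensor R d := projT1 (cid (associated_mapP v)).

(** An exponential of a linear function is a linear function of the shuffle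
    exponential, and its product with another linear function is linear in the
    shuffle product. The operator and its domain are therefore unchanged; only
    the description of them is new. *)
Lemma affine_polynomial Lop : linear_on (affine_domain (S := S) U) Lop ->
  (forall u, U u -> forall x,
     Lop (exp_pairing u) x = exp_pairing u x * pairing (Rm u) x) ->
  [/\ polynomial_type Pi V associated_map Lop,
      forall u, U u -> dual_eq S (associated_map (shuffle_exp u))
         (cshuffle (shuffle_exp u) (Rm u)) &
      forall u, U u ->
        (forall v, U v -> shuffle_exp v = shuffle_exp u -> Rm v = Rm u) ->
        associated_map (shuffle_exp u) = cshuffle (shuffle_exp u) (Rm u)].
Proof.
move=> Llin LR.
have ed u : U u -> dual S Pi (shuffle_exp u).
  by move=> Uu; apply: (dual_shuffle_exp hPi); exact: Ud.
have sd u : U u -> dual S Pi (cshuffle (shuffle_exp u) (Rm u)).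
  by move=> Uu; apply: (dual_shuffle hPi); [exact: ed|exact: Rd].
have hV v : V v -> dual S Pi (associated_map v) /\
    forall x, Lop (pairing v) x = pairing (associated_map v) x.
  move=> Vv; rewrite /associated_map; case: (cid _) => w /= [/(_ Vv)].
  move=> [n [c [u [[Uu vE] ->]]]] _.
  have [h1 h2] := dual_sum hPi c (fun i => sd _ (Uu i)).
  split => // x; rewrite h2.
  have -> : pairing v = fun x => \sum_(i < n) c i * exp_pairing (S := S) (u i) x.
    apply/funext => y; rewrite vE; have [_ ->] := dual_sum hPi c (fun i => ed _ (Uu i)).
    by apply: eq_bigr => i _; rewrite exp_pairingE.
  rewrite (linear_on_sum Llin) /=; last by move=> i; exists (u i).
  apply: eq_bigr => i _; rewrite LR // (dual_pairing_shuffle hPi) ?exp_pairingE //.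
  - exact: ed.
  - exact: Rd.
split.
- split.
  + move=> v [n [c [g [hg ->]]]]; have [u [Uu gu]] := exp_family hg.
    have hd i : dual S Pi (g i) by rewrite gu; exact: ed.
    by have [] := dual_sum hPi c hd.
  + exact: cspan_linear_subset.
  + by rewrite polynomial_domain_exp.
  + by move=> v /hV[].
  + by move=> v /hV[].
- move=> u Uu x; rewrite /associated_map; case: (cid _) => w /= [_ []].
    by exists u.
  move=> v [Uv uv ->].
  have pE w' : U w' -> pairing (cshuffle (shuffle_exp w') (Rm w')) x =
      Lop (exp_pairing w') x.
    move=> Uw; rewrite (LR w' Uw x) -(exp_pairingE Uw).
    by apply: (dual_pairing_shuffle hPi); [exact: ed|exact: Rd].
  by rewrite (pE v Uv) (pE u Uu) -(exp_pairingE Uv) -(exp_pairingE Uu) uv.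
- move=> u Uu hu; rewrite /associated_map; case: (cid _) => w /= [_ []].
    by exists u.
  by move=> v [Uv uv ->]; rewrite (hu v) // -uv.
Qed.

End AffinePolynomial.

(** * Bounded measurable functions *)

(** Almost surely bounded measurable functions on a set of finite measure: an
    algebra on which the integral is linear and dominated convergence needs no
    further integrability check. *)
Section BoundedMeasurable.
Context {dT : measure_display} {Om : measurableType dT} {R : realType}.
Variables (mu : {measure set Om -> \bar R}) (D : set Om).
Hypotheses (mD : measurable D) (muD : (mu D < +oo)%E).
Implicit Types (f g : Om -> R) (c C : R).

Definition bounded_ae f := exists C, {ae mu, forall w, D w -> `|f w| <= C}.
Definition bm f := measurable_fun D f /\ bounded_ae f.

Lemma bm_meas f : bm f -> measurable_fun D f. Proof. by case. Qed.

Lemma bm_integrable f : bm f -> mu.-integrable D (EFin \o f).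
Proof.
move=> [mf [C hC]]; apply/integrableP; split; first exact/measurable_EFinP.
apply: le_lt_trans (integral_le_bound (mu := mu) (Num.max C 0)%:E mD _ _ _) _.
- exact/measurable_EFinP.
- by rewrite lee_fin le_max lexx orbT.
- apply: filterS hC => w h Dw; rewrite lee_fin; apply: le_trans (h Dw) _.
  by rewrite le_max lexx.
- by rewrite lte_mul_pinfty // ?lee_fin // le_max lexx orbT.
Qed.

Lemma bm_cst c : bm (fun=> c).
Proof. by split; [exact: measurable_cst|exists `|c|; apply: aeW]. Qed.

Lemma bmD f g : bm f -> bm g -> bm (fun w => f w + g w).
Proof.
move=> [mf [C hC]] [mg [C' hC']]; split; first exact: measurable_funD.
exists (C + C'); apply: filterS2 hC hC' => w h h' Dw.
by rewrite (le_trans (ler_normD _ _)) // lerD ?h ?h'.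
Qed.

Lemma bmM f g : bm f -> bm g -> bm (fun w => f w * g w).
Proof.
move=> [mf [C hC]] [mg [C' hC']]; split; first exact: measurable_funM.
exists (C * C'); apply: filterS2 hC hC' => w h h' Dw.
by rewrite normrM ler_pM ?h ?h'.
Qed.

Lemma bmZ c f : bm f -> bm (fun w => c * f w).
Proof. by move=> hf; apply: bmM => //; exact: bm_cst. Qed.

Lemma bmN f : bm f -> bm (fun w => - f w).
Proof. by move/(bmZ (-1)); congr bm; apply/funext => w; rewrite mulN1r. Qed.

Lemma bmB f g : bm f -> bm g -> bm (fun w => f w - g w).
Proof. by move=> hf hg; apply: bmD => //; exact: bmN. Qed.

Lemma bm_sqr f : bm f -> bm (fun w => f w ^+ 2).
Proof. by move=> hf; under eq_fun do rewrite expr2; exact: bmM. Qed.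

Lemma bm_sum (I : Type) (r : seq I) (f : I -> Om -> R) :
  (forall i, bm (f i)) -> bm (fun w => \sum_(i <- r) f i w).
Proof.
move=> hf; elim: r => [|i r IH].
  by under eq_fun do rewrite big_nil; exact: bm_cst.
by under eq_fun do rewrite big_cons; exact: bmD.
Qed.

Lemma bm_norm f : bm f -> bm (fun w => `|f w|).
Proof.
move=> [mf [C hC]]; split; first exact: measurableT_comp.
by exists C; apply: filterS hC => w h Dw; rewrite normr_id h.
Qed.

Lemma bm_indic (A : set Om) : measurable A -> bm \1_A.
Proof.
move=> mA; split; first exact: measurable_indic.
exists 1; apply: aeW => w _; rewrite indicE.
by case: (w \in A); rewrite ?normr1 ?normr0.
Qed.

Lemma RintD f g : bm f -> bm g -> \int[mu]_(w in D) (f w + g w) =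
  \int[mu]_(w in D) f w + \int[mu]_(w in D) g w.
Proof. by move=> hf hg; rewrite RintegralD //; exact: bm_integrable. Qed.

Lemma RintB f g : bm f -> bm g -> \int[mu]_(w in D) (f w - g w) =
  \int[mu]_(w in D) f w - \int[mu]_(w in D) g w.
Proof. by move=> hf hg; rewrite RintegralB //; exact: bm_integrable. Qed.

Lemma RintZ c f : bm f ->
  \int[mu]_(w in D) (c * f w) = c * \int[mu]_(w in D) f w.
Proof. by move=> hf; rewrite RintegralZl //; exact: bm_integrable. Qed.

Lemma Rint_sum (I : Type) (r : seq I) (f : I -> Om -> R) :
  (forall i, bm (f i)) ->
  \int[mu]_(w in D) (\sum_(i <- r) f i w) = \sum_(i <- r) \int[mu]_(w in D) f i w.
Proof.
move=> hf; elim: r => [|i r IH].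
  under eq_Rintegral do rewrite big_nil.
  by rewrite big_nil Rintegral_cst // mul0r.
rewrite big_cons -IH -RintD //; last exact: bm_sum.
by under eq_Rintegral do rewrite big_cons.
Qed.

Lemma Rint_ae_eq f g : measurable_fun D f -> measurable_fun D g ->
  {ae mu, forall w, D w -> f w = g w} ->
  \int[mu]_(w in D) f w = \int[mu]_(w in D) g w.
Proof.
move=> mf mg h; congr fine; apply: ae_eq_integral => //.
- exact/measurable_EFinP.
- exact/measurable_EFinP.
- by apply: filterS h => w hw Dw; rewrite hw.
Qed.

Lemma bm_max f g : bm f -> bm g -> bm (fun w => Num.max (f w) (g w)).
Proof.
move=> [mf [C hC]] [mg [C' hC']]; split; first exact: measurable_maxr.
exists (Num.max C C'); apply: filterS2 hC hC' => w h h' Dw.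
have h1 := h Dw; have h2 := h' Dw; rewrite le_max.
by case: (leP (f w) (g w)) => _; rewrite ?h1 ?h2 ?orbT.
Qed.

(** Replacing [g] by the maximum of [f] and [g] changes it on a null set only
    and makes the inequality hold everywhere. *)
Lemma Rint_ae_le f g : bm f -> bm g ->
  {ae mu, forall w, D w -> f w <= g w} ->
  \int[mu]_(w in D) f w <= \int[mu]_(w in D) g w.
Proof.
move=> hf hg h.
rewrite [leRHS](Rint_ae_eq (g := fun w => Num.max (f w) (g w))).
- apply: le_Rintegral => //; [exact: bm_integrable|exact/bm_integrable/bm_max|].
  by move=> w _; rewrite le_max lexx.
- exact: bm_meas.
- exact/bm_meas/bm_max.
- by apply: filterS h => w hw Dw; rewrite max_r // hw.
Qed.

Lemma normr_Rint_le f g : bm f -> bm g ->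
  {ae mu, forall w, D w -> `|f w| <= g w} ->
  `|\int[mu]_(w in D) f w| <= \int[mu]_(w in D) g w.
Proof.
move=> hf hg h; apply: le_trans (le_normr_Rintegral mD (bm_integrable hf)) _.
by apply: Rint_ae_le => //; exact: bm_norm.
Qed.

Lemma Rint_bdd_cvg (f_ : nat -> Om -> R) f C :
  (forall n, measurable_fun D (f_ n)) -> measurable_fun D f ->
  {ae mu, forall w, D w -> forall n, `|f_ n w| <= C} ->
  {ae mu, forall w, D w -> f_ ^~ w @ \oo --> f w} ->
  bm f /\ \int[mu]_(w in D) f_ n w @[n --> \oo] --> \int[mu]_(w in D) f w.
Proof.
move=> mf_ mf hC hf.
have bf : bm f.
  split => //; exists C; apply: filterS2 hC hf => w h1 h2 Dw.
  have /cvg_norm h3 := h2 Dw.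
  by rewrite -(cvg_lim _ h3) //; apply: limr_le; [exact: cvgP h3|exact: nearW (h1 Dw)].
split => //.
have [] := @dominated_convergence _ _ _ mu D mD (fun n => EFin \o f_ n) (EFin \o f)
  (fun=> C%:E).
- by move=> n; exact/measurable_EFinP.
- exact/measurable_EFinP.
- apply: filterS hf => w h Dw; apply: cvg_EFin; last exact: h.
  by apply: nearW.
- exact: (bm_integrable (bm_cst C)).
- by apply: filterS hC => w h n Dw; rewrite lee_fin h.
move=> _ _ h; apply: (fine_cvg _) => /=.
rewrite fineK; first exact: h.
exact/integrable_fin_num/bm_integrable.
Qed.

End BoundedMeasurable.

Section ComplexIntegral.
Context {dT : measure_display} {Om : measurableType dT} {R : realType}.
Variables (mu : {measure set Om -> \bar R}) (D : set Om).
Hypotheses (mD : measurable D) (muD : (mu D < +oo)%E).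
Implicit Types (f g : Om -> R[i]) (c : R[i]).

Definition cbm f := bm mu D (fun w => cRe (f w)) /\ bm mu D (fun w => cIm (f w)).

Definition cint f : R[i] :=
  \int[mu]_(w in D) cRe (f w) +i* \int[mu]_(w in D) cIm (f w).

Lemma cbm_cst c : cbm (fun=> c). Proof. by split; exact: bm_cst. Qed.

Lemma cbmD f g : cbm f -> cbm g -> cbm (fun w => f w + g w).
Proof.
move=> [f1 f2] [g1 g2]; split.
  by under eq_fun do rewrite cReD; exact: bmD.
by under eq_fun do rewrite cImD; exact: bmD.
Qed.

Lemma cbmM f g : cbm f -> cbm g -> cbm (fun w => f w * g w).
Proof.
move=> [f1 f2] [g1 g2]; split.
  by under eq_fun do rewrite cReM; apply: bmB; exact: bmM.
by under eq_fun do rewrite cImM; apply: bmD; exact: bmM.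
Qed.

Lemma cbmZ c f : cbm f -> cbm (fun w => c * f w).
Proof. by move=> hf; apply: cbmM => //; exact: cbm_cst. Qed.

Lemma cbmN f : cbm f -> cbm (fun w => - f w).
Proof. by move/(cbmZ (-1)); congr cbm; apply/funext => w; rewrite mulN1r. Qed.

Lemma cbmB f g : cbm f -> cbm g -> cbm (fun w => f w - g w).
Proof. by move=> hf hg; apply: cbmD => //; exact: cbmN. Qed.

Lemma cbm_sum (I : Type) (r : seq I) (f : I -> Om -> R[i]) :
  (forall i, cbm (f i)) -> cbm (fun w => \sum_(i <- r) f i w).
Proof.
move=> hf; elim: r => [|i r IH].
  by under eq_fun do rewrite big_nil; exact: cbm_cst.
by under eq_fun do rewrite big_cons; exact: cbmD.
Qed.

Lemma cbm_real (h : Om -> R) : bm mu D h -> cbm (fun w => (h w)%:C).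
Proof. by move=> hh; split => //=; exact: bm_cst. Qed.

Lemma cintD f g : cbm f -> cbm g -> cint (fun w => f w + g w) = cint f + cint g.
Proof.
move=> [f1 f2] [g1 g2]; apply: eq_ReIm; rewrite ?cReD ?cImD /=.
  by under eq_Rintegral do rewrite cReD; rewrite RintD.
by under eq_Rintegral do rewrite cImD; rewrite RintD.
Qed.

Lemma cintZ c f : cbm f -> cint (fun w => c * f w) = c * cint f.
Proof.
move=> [f1 f2]; apply: eq_ReIm; rewrite ?cReM ?cImM /=.
  under eq_Rintegral do rewrite cReM.
  by rewrite RintB ?RintZ //; exact: bmZ.
under eq_Rintegral do rewrite cImM.
by rewrite RintD ?RintZ //; exact: bmZ.
Qed.

Lemma cintB f g : cbm f -> cbm g -> cint (fun w => f w - g w) = cint f - cint g.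
Proof.
move=> hf hg; rewrite -mulN1r -cintZ // -cintD //; last exact: cbmZ.
by congr cint; apply/funext => w; rewrite mulN1r.
Qed.

Lemma cint_sum (I : Type) (r : seq I) (f : I -> Om -> R[i]) :
  (forall i, cbm (f i)) ->
  cint (fun w => \sum_(i <- r) f i w) = \sum_(i <- r) cint (f i).
Proof.
move=> hf; elim: r => [|i r IH].
  rewrite big_nil /cint; under eq_Rintegral do rewrite big_nil.
  under [X in _ +i* X]eq_Rintegral do rewrite big_nil.
  by rewrite !Rintegral_cst // mul0r.
rewrite big_cons -IH -cintD //; last exact: cbm_sum.
by congr cint; apply/funext => w; rewrite big_cons.
Qed.

(** The factor 2 comes from treating real and imaginary parts separately. *)
Lemma normc_cint f (g : Om -> R) : cbm f -> bm mu D g ->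
  {ae mu, forall w, D w -> normc (f w) <= g w} ->
  normc (cint f) <= 2 * \int[mu]_(w in D) g w.
Proof.
move=> [f1 f2] hg h; apply: le_trans (normc_le_ReIm _) _ => /=.
rewrite mulr2n mulrDl mul1r; apply: lerD; apply: normr_Rint_le => //.
  by apply: filterS h => w hw Dw; exact: le_trans (normr_Re _) (hw Dw).
by apply: filterS h => w hw Dw; exact: le_trans (normr_Im _) (hw Dw).
Qed.

Lemma cbm_bound f : cbm f -> exists C, {ae mu, forall w, D w -> normc (f w) <= C}.
Proof.
move=> [[_ [C hC]] [_ [C' hC']]]; exists (C + C').
apply: filterS2 hC hC' => w h h' Dw.
by rewrite (le_trans (normc_le_ReIm _)) // lerD ?h ?h'.
Qed.

End ComplexIntegral.

(** * Cadlag paths and grids *)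

Section Paths.
Variables (R : realType) (T : R).
Implicit Types (f g : R -> R) (t x y : R).

Definition cadlag_path f : Prop :=
  (forall t, 0 <= t < T -> f s @[s --> t^'+] --> f t) /\
  (forall t, 0 < t <= T -> cvg (f s @[s --> t^'-])).

Lemma right_eps f t l : f s @[s --> t^'+] --> l -> forall e, 0 < e ->
  exists2 d, 0 < d & forall s, t < s < t + d -> `|f s - l| < e.
Proof.
move=> /cvgrPdist_lt h e /h[d /= d0 hd]; exists d => // s /andP[ts sd].
rewrite distrC; apply: hd => //=; rewrite distrC ger0_norm; lra.
Qed.

Lemma left_eps f t l : f s @[s --> t^'-] --> l -> forall e, 0 < e ->
  exists2 d, 0 < d & forall s, t - d < s < t -> `|f s - l| < e.
Proof.
move=> /cvgrPdist_lt h e /h[d /= d0 hd]; exists d => // s /andP[ts sd].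
rewrite distrC; apply: hd => //=; rewrite ger0_norm; lra.
Qed.

Lemma cadlag_locally_bounded f : cadlag_path f -> forall x, 0 <= x <= T ->
  exists C, exists2 d, 0 < d & forall y, 0 <= y <= T -> `|y - x| < d -> `|f y| <= C.
Proof.
move=> [hr hl] x xT.
have [Cr [dr dr0 hCr]] : exists C, exists2 d, 0 < d & forall y, y <= T ->
    x < y < x + d -> `|f y| <= C.
  case: (ltP x T) => xT'; last first.
    by exists 0, 1 => // y yT /andP[xy _]; exfalso; lra.
  have [|d d0 hd] := right_eps (hr x _) (@ltr01 R); first by lra.
  exists (`|f x| + 1), d => // y _ hy.
  rewrite -[f y](subrK (f x)) (le_trans (ler_normD _ _)) // addrC lerD2l ltW //.
  exact: hd.
have [Cl [dl dl0 hCl]] : exists C, exists2 d, 0 < d & forall y, 0 <= y ->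
    x - d < y < x -> `|f y| <= C.
  case: (ltP 0 x) => x0; last first.
    by exists 0, 1 => // y yT /andP[_ xy]; exfalso; lra.
  have [|d d0 hd] := left_eps (hl x _) (@ltr01 R); first by lra.
  exists (`|lim (f s @[s --> x^'-])| + 1), d => // y _ hy.
  rewrite -[f y](subrK (lim (f s @[s --> x^'-]))) (le_trans (ler_normD _ _)) //.
  by rewrite addrC lerD2l ltW //; exact: hd.
exists (Num.max (`|f x|) (Num.max Cr Cl)), (Num.min dr dl).
  by rewrite lt_min dr0.
move=> y /andP[y0 yT]; rewrite lt_min ltr_norml ltr_norml => /andP[/andP[h1 h2] /andP[h3 h4]].
rewrite !le_max; case: (ltgtP y x) => xy.
- by rewrite hCl ?orbT //; lra.
- by rewrite hCr ?orbT //; lra.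
- by rewrite xy lexx.
Qed.

(** By compactness, a property of a point and an index that holds near every
    point for all large indices holds on the whole segment for all large
    indices. *)
Lemma segment_cover (Q : nat -> R -> Prop) :
  (forall x, 0 <= x <= T -> exists N, exists2 d, 0 < d &
     forall n y, (N <= n)%N -> 0 <= y <= T -> `|y - x| < d -> Q n y) ->
  exists N, forall n, (N <= n)%N -> forall y, 0 <= y <= T -> Q n y.
Proof.
move=> h.
have /compact_near_coveringP/near_covering_withinP := @segment_compact R 0 T.
move=> /(_ nat \oo Q _) hc.
have [|N _ hN] := hc.
  move=> x; rewrite /= in_itv /= => /h[N [d d0 hd]].
  exists (ball x d, [set n | (N <= n)%N]) => /=.
    by split; [exact: nbhsx_ballx|exists N].
  move=> [y n] /= [xy Nn]; rewrite in_itv /= => yT; apply: hd => //.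
  by rewrite distrC.
by exists N => n Nn y yT; apply: hN => //=; rewrite in_itv.
Qed.

Lemma cadlag_bounded f : cadlag_path f -> exists C, forall t, 0 <= t <= T -> `|f t| <= C.
Proof.
move=> /cadlag_locally_bounded h.
have [|N hN] := @segment_cover (fun n y => `|f y| <= n%:R).
  move=> x /h[C [d d0 hd]]; have [N hN] : exists N : nat, C <= N%:R.
    exists (Num.bound `|C|); apply: le_trans (ler_norm C) _; rewrite ltW //.
    exact: archi_boundP.
  exists N, d => // n y Nn yT xy; rewrite (le_trans (hd _ yT xy)) // (le_trans hN) //.
  by rewrite ler_nat.
by exists N%:R => t tT; apply: hN.
Qed.

Lemma continuous_uniform f : {within `[0, T], continuous f} -> forall e, 0 < e ->
  exists2 d, 0 < d & forall x y, 0 <= x <= T -> 0 <= y <= T ->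
    `|x - y| < d -> `|f x - f y| < e.
Proof.
move=> hf e e0.
have hloc x : 0 <= x <= T -> exists2 d, 0 < d & forall y, 0 <= y <= T ->
    `|y - x| < d -> `|f y - f x| < e / 2.
  move=> xT; have e20 : 0 < e / 2 by rewrite divr_gt0.
  have /subspace_continuousP /(_ x) := hf.
  rewrite /= in_itv /= => /(_ xT) /cvgrPdist_lt /(_ _ e20).
  move=> [d /= d0 hd]; exists d => // y yT yx; rewrite distrC; apply: hd.
    by rewrite /= distrC.
  by rewrite /= in_itv.
have [|N hN] := @segment_cover (fun n x => forall y, 0 <= y <= T ->
    `|x - y| < n.+1%:R^-1 -> `|f x - f y| < e).
  move=> x xT; have [d d0 hd] := hloc x xT.
  have [N hN] : exists N : nat, (N.+1%:R^-1 : R) < d / 2.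
    exists (Num.bound (d / 2)^-1).
    have d20 : 0 < d / 2 by lra.
    rewrite -[ltRHS]invrK ltf_pV2 ?posrE ?invr_gt0 ?ltr0n //.
    apply: lt_trans (archi_boundP _) _; last by rewrite ltr_nat.
    by rewrite invr_ge0 ltW.
  exists N, (d / 2); first by lra.
  move=> n z Nn zT zx y yT yz.
  have h1 : `|f z - f x| < e / 2 by apply: hd => //; lra.
  have h2 : `|f y - f x| < e / 2.
    apply: hd => //; apply: le_lt_trans (ler_distD z y x) _.
    rewrite distrC in yz.
    have nN : (n.+1%:R^-1 : R) <= N.+1%:R^-1.
      by rewrite lef_pV2 ?posrE ?ltr0n // ler_nat.
    by rewrite [d]splitr; apply: ltrD zx; exact: lt_trans (lt_le_trans yz nN) hN.
  rewrite -[f z](subrK (f x)) -addrA (le_lt_trans (ler_normD _ _)) //.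
  by rewrite [e]splitr ltrD // distrC.
exists (N.+1%:R^-1); first by rewrite invr_gt0 ltr0n.
by move=> x y xT yT; apply: hN.
Qed.

Lemma cadlag_cst c : cadlag_path (fun=> c).
Proof. by split=> t _; [exact: cvg_cst|apply/cvg_ex; exists c; exact: cvg_cst]. Qed.

Lemma cadlagD f g : cadlag_path f -> cadlag_path g -> cadlag_path (fun t => f t + g t).
Proof.
move=> [f1 f2] [g1 g2]; split=> t tT; first exact: (cvgD (f1 t tT) (g1 t tT)).
exact: (is_cvgD (f2 t tT) (g2 t tT)).
Qed.

Lemma cadlagM f g : cadlag_path f -> cadlag_path g -> cadlag_path (fun t => f t * g t).
Proof.
move=> [f1 f2] [g1 g2]; split=> t tT; first exact: (cvgM (f1 t tT) (g1 t tT)).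
exact: (is_cvgM (f2 t tT) (g2 t tT)).
Qed.

Lemma cadlagN f : cadlag_path f -> cadlag_path (fun t => - f t).
Proof.
move=> [f1 f2]; split=> t tT; first exact: (cvgN (f1 t tT)).
exact: (is_cvgN (f2 t tT)).
Qed.

Lemma cadlagB f g : cadlag_path f -> cadlag_path g -> cadlag_path (fun t => f t - g t).
Proof. by move=> hf hg; apply: cadlagD => //; exact: cadlagN. Qed.

Lemma cadlag_comp f h : continuous (h : R -> R) -> cadlag_path f ->
  cadlag_path (fun t => h (f t)).
Proof.
move=> hc [f1 f2]; split=> t tT.
  by apply: continuous_cvg; [exact: hc|exact: f1].
apply/cvg_ex; exists (h (lim (f s @[s --> t^'-]))).
by apply: continuous_cvg; [exact: hc|exact: f2].
Qed.

Lemma cadlag_sum (I : Type) (r : seq I) (f : I -> R -> R) :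
  (forall i, cadlag_path (f i)) -> cadlag_path (fun t => \sum_(i <- r) f i t).
Proof.
move=> h; elim: r => [|i r IH].
  by under eq_fun do rewrite big_nil; exact: cadlag_cst.
by under eq_fun do rewrite big_cons; exact: cadlagD.
Qed.

Lemma lipschitz_cadlag f C : (forall s t, 0 <= s -> s <= t -> t <= T ->
  `|f t - f s| <= C * (t - s)) -> cadlag_path f.
Proof.
move=> hC.
have hC' s t : 0 <= s <= T -> 0 <= t <= T -> `|f t - f s| <= `|C| * `|t - s|.
  move=> sT tT; wlog st : s t sT tT / s <= t => [hw|].
    case: (leP s t) => st; first exact: hw.
    by rewrite distrC [`|t - s|]distrC; apply: hw => //; exact: ltW.
  have ts : 0 <= t - s by rewrite subr_ge0.
  apply: le_trans (hC _ _ _ st _) _; [lra|lra|].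
  by rewrite (ger0_norm ts); apply: ler_wpM2r => //; exact: ler_norm.
have key t e : 0 <= t <= T -> 0 < e -> forall s, 0 <= s <= T ->
    `|t - s| < e / (`|C| + 1) -> `|f t - f s| < e.
  move=> tT e0 s sT h; apply: le_lt_trans (hC' _ _ sT tT) _.
  have C0 := normr_ge0 C; have C1 : 0 < `|C| + 1 by lra.
  rewrite ltr_pdivlMr // in h.
  have := normr_ge0 (t - s); nra.
have pos e : 0 < e -> 0 < e / (`|C| + 1).
  by move=> e0; rewrite divr_gt0 // ltr_wpDl.
split=> t tT.
  apply/cvgrPdist_lt => e e0; near=> s; apply: key => //; first by lra.
  - have : t < s by near: s; exact: nbhs_right_gt.
    have : s < T by near: s; apply: nbhs_right_lt; lra.
    lra.
  - rewrite distrC ger0_norm; last by rewrite subr_ge0; near: s; exact: nbhs_right_ge.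
    rewrite ltrBlDl; near: s; apply: nbhs_right_lt; rewrite ltrDl; exact: pos.
apply/cvg_ex; exists (f t).
apply/cvgrPdist_lt => e e0; near=> s; apply: key => //; first by lra.
- have : s < t by near: s; exact: nbhs_left_lt.
  have : 0 < s by near: s; apply: nbhs_left_gt; lra.
  lra.
- rewrite ger0_norm; last by rewrite subr_ge0; near: s; exact: nbhs_left_le.
  rewrite ltrBlDl -ltrBlDr; near: s; apply: nbhs_left_gt.
  by rewrite ltrBlDr ltrDl; exact: pos.
Unshelve. all: by end_near.
Qed.

(** Right continuity on [0, T] along sequences: unlike cadlag limits, this form
    passes to a path stopped at a fixed time by a direct substitution. *)
Definition rcs f := forall x (u : nat -> R), 0 <= x <= T ->
  (forall n, x <= u n <= T) -> u @ \oo --> x -> (fun n => f (u n)) @ \oo --> f x.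

Lemma right_cont_seq f : cadlag_path f -> rcs f.
Proof.
move=> [hr _] x u xT hu hux; case: (ltP x T) => xT'; last first.
  have -> : x = T by lra.
  rewrite (_ : (fun n => f (u n)) = fun=> f T); first exact: cvg_cst.
  by apply/funext => n; congr f; have := hu n; lra.
apply/cvgrPdist_lt => e e0.
have [|d d0 hd] := right_eps (hr x _) e0; first by lra.
move/cvgrPdist_lt : hux => /(_ d d0); apply: filterS => n; rewrite distrC => hn.
case: (eqVneq (u n) x) => [->|nx]; first by rewrite subrr normr0.
rewrite distrC; apply: hd.
have := hu n; have : u n - x < d by apply: le_lt_trans (ler_norm _) hn.
by move=> h /andP[h1 _]; rewrite lt_neqAle eq_sym nx h1 /=; lra.
Qed.

End Paths.

(** Cadlag paths are recovered from their values at grid points approached from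
    the right, which is why times are rounded up. *)
Section Grid.
Variables (R : realType).
Implicit Types (t x : R) (N : nat).

Definition gpt t N i : R := t * i%:R / N.+1%:R.
Definition gidx t N x : nat := `|Num.ceil (x * N.+1%:R / t)|%N.
Definition gup t N x : R := gpt t N (gidx t N x).

Lemma gpt0 t N : gpt t N 0 = 0. Proof. by rewrite /gpt mulr0 mul0r. Qed.
Lemma gptN t N : gpt t N N.+1 = t. Proof. by rewrite /gpt mulfK // pnatr_eq0. Qed.
Lemma gptS t N i : gpt t N i.+1 = gpt t N i + t / N.+1%:R.
Proof. by rewrite /gpt -addn1 natrD mulrDr mulrDl mulr1. Qed.

Lemma gpt_le t N i j : 0 <= t -> (i <= j)%N -> gpt t N i <= gpt t N j.
Proof.
by move=> t0 ij; rewrite /gpt ler_wpM2r ?invr_ge0 // ler_wpM2l // ler_nat.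
Qed.

Lemma gpt_ge0 t N i : 0 <= t -> 0 <= gpt t N i.
Proof. by move=> t0; rewrite -(gpt0 t N) gpt_le. Qed.

Lemma gpt_le_t t N i : 0 <= t -> (i <= N.+1)%N -> gpt t N i <= t.
Proof. by move=> t0 iN; rewrite -[leRHS](gptN t N) gpt_le. Qed.

(** Rounding up is adjoint to the enumeration of the grid; events about the
    rounded time become comparisons with grid points. *)
Lemma gidx_le t N x i : 0 < t -> 0 <= x -> (gidx t N x <= i)%N = (x <= gpt t N i).
Proof.
move=> t0 x0; rewrite /gidx /gpt.
have h : 0 <= Num.ceil (x * N.+1%:R / t).
  by rewrite ceil_ge0 (lt_le_trans (ltrN10 _)) // divr_ge0 ?mulr_ge0 // ltW.
rewrite -lez_nat gez0_abs // ceil_le_int.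
rewrite ler_pdivrMr // ler_pdivlMr ?ltr0n //.
by rewrite [t * _]mulrC.
Qed.

Lemma gidx_max t N x : 0 < t -> 0 <= x <= t -> (gidx t N x <= N.+1)%N.
Proof. by move=> t0 /andP[x0 xt]; rewrite gidx_le // gptN. Qed.

Lemma gup_ge t N x : 0 < t -> 0 <= x -> x <= gup t N x.
Proof. by move=> t0 x0; rewrite /gup -gidx_le. Qed.

Lemma gup_le_t t N x : 0 < t -> 0 <= x <= t -> gup t N x <= t.
Proof. by move=> t0 xt; rewrite /gup gpt_le_t ?gidx_max // ltW. Qed.

Lemma gup_le t N x : 0 < t -> 0 <= x -> gup t N x <= x + t / N.+1%:R.
Proof.
move=> t0 x0; rewrite /gup; case E : (gidx t N x) => [|i].
  by rewrite gpt0 addr_ge0 // divr_ge0 // ltW.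
rewrite gptS lerD2r ltW // ltNge -gidx_le // E; lia.
Qed.

Lemma gup_cvg t x : 0 < t -> 0 <= x -> gup t N x @[N --> \oo] --> x.
Proof.
move=> t0 x0; apply: (@squeeze_cvgr _ _ _ _ (fun=> x) (fun N => x + t / N.+1%:R)).
- by apply: nearW => N; rewrite gup_ge // gup_le.
- exact: cvg_cst.
- rewrite -[x in X in _ --> X]addr0; apply: cvgD; first exact: cvg_cst.
  rewrite -(mulr0 t); apply: cvgM; first exact: cvg_cst.
  exact: cvg_harmonic.
Qed.

End Grid.

(** * Time integrals of cadlag paths *)

Lemma bm_sub {dT : measure_display} {Om : measurableType dT} {R : realType}
    (mu : {measure set Om -> \bar R}) (E D : set Om) (f : Om -> R) :
  measurable E -> D `<=` E -> bm mu E f -> bm mu D f.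
Proof.
move=> mE DE [mf [C hC]]; split; first exact: measurable_funS mf.
by exists C; apply: filterS hC => w h Dw; apply: h; exact: DE.
Qed.

Lemma measurable_fun_select {d1 d2 : measure_display} {Om : sigmaRingType d1}
    {U : sigmaRingType d2} (D : set Om) (k : Om -> nat) (h : nat -> Om -> U) :
  (forall i, measurable (D `&` k @^-1` [set i])) ->
  (forall i, measurable_fun D (h i)) -> measurable_fun D (fun w => h (k w) w).
Proof.
move=> mk mh mD B mB.
rewrite (_ : _ `&` _ = \bigcup_i ((D `&` k @^-1` [set i]) `&` (D `&` h i @^-1` B))).
  by apply: bigcupT_measurable => i; apply: measurableI => //; exact: mh.
apply/seteqP; split => [w [Dw hw]|w [i _ [[Dw <-] [_ hw]]]] //.
by exists (k w).
Qed.

Section TimeIntegral.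
Variables (R : realType) (T : R).
Implicit Types (f g : R -> R) (s t a b : R).
Local Notation lam := (@lebesgue_measure R).

Lemma itv_cc_fin a b : (lam `[a, b] < +oo)%E.
Proof. by rewrite lebesgue_measure_itv /=; case: ifP => _; rewrite ?ltry // -EFinD ltry. Qed.

Lemma gidx_itv t N x i : 0 < t -> 0 <= x <= t ->
  (gidx t N x == i.+1) = (gpt t N i < x <= gpt t N i.+1).
Proof.
move=> t0 /andP[x0 xt]; rewrite -gidx_le // ltNge -gidx_le // -ltnNge.
by rewrite andbC -eqn_leq.
Qed.

Lemma cadlag_step_measurable f t N : 0 < t -> measurable_fun `[0, t] (fun s => f (gup t N s)).
Proof.
move=> t0; apply: (measurable_fun_select (h := fun i _ => f (gpt t N i))); last first.
  by move=> i; exact: measurable_cst.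
move=> i; rewrite (_ : _ `&` _ = `[0, t] `&`
   (if i is i'.+1 then `]gpt t N i', gpt t N i] else [set 0])).
  by case: i => [|i]; apply: measurableI => //; exact: measurable_set1.
apply/seteqP; split => s /=; rewrite in_itv /= => -[st h]; split => //.
  case: i h => [/eqP|i /eqP]; last by rewrite gidx_itv // in_itv.
  rewrite -leqn0 gidx_le //; last by case/andP: st.
  by rewrite gpt0 => s0; apply/eqP; rewrite eq_le s0; case/andP: st.
case: i h => [->|i] /=.
  by apply/eqP; rewrite -leqn0 gidx_le // gpt0.
by rewrite in_itv /= -gidx_itv // => /eqP.
Qed.

Lemma cadlag_step_cvg f t s : cadlag_path T f -> 0 < t <= T -> 0 <= s <= t ->
  f (gup t N s) @[N --> \oo] --> f s.
Proof.
move=> hf /andP[t0 tT] /andP[s0 st]; apply: (right_cont_seq hf).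
- by rewrite s0 (le_trans st).
- move=> N; rewrite gup_ge //= (le_trans _ tT) // gup_le_t //.
  by rewrite s0.
- exact: gup_cvg.
Qed.

(** Rounding the time up to finer and finer grids approximates the path by step
    functions. *)
Lemma cadlag_measurable f t : cadlag_path T f -> t <= T -> measurable_fun `[0, t] f.
Proof.
move=> hf tT; case: (ltgtP t 0) => t0.
- rewrite set_itv_ge ?bnd_simp -?ltNge //; exact: measurable_fun_set0.
- apply: (@measurable_fun_cvg _ _ _ _ (fun N s => f (gup t N s))).
    by move=> N; exact: cadlag_step_measurable.
  move=> s; rewrite /= in_itv /= => st; apply: cadlag_step_cvg => //.
  by rewrite t0.
- by rewrite t0 set_itv1; exact: measurable_fun_set1.
Qed.

Lemma cadlag_bm f t : cadlag_path T f -> t <= T -> bm lam `[0, t] f.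
Proof.
move=> hf tT; split; first exact: cadlag_measurable.
have [C hC] := cadlag_bounded hf; exists C; apply: aeW => s /=.
by rewrite in_itv /= => /andP[s0 st]; apply: hC; rewrite s0 (le_trans st).
Qed.

Lemma cadlag_bm_sub f t (D : set R) : cadlag_path T f -> t <= T -> D `<=` `[0, t] ->
  bm lam D f.
Proof.
move=> hf tT DT; apply: (@bm_sub _ _ _ lam _ _ _ (measurable_itv _) DT).
exact: cadlag_bm.
Qed.

Lemma fine_lam_itv a b (p q : bool) : a <= b ->
  fine (lam [set` Interval (BSide p a) (BSide q b)]) = b - a.
Proof.
rewrite le_eqVlt => /predU1P[->|ab]; rewrite lebesgue_measure_itv /= lte_fin.
  by rewrite ltxx subrr.
by rewrite ab.
Qed.

Lemma bm_itv_split f a t b : bm lam `[a, b] f -> a <= t -> t <= b ->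
  \int[lam]_(s in `[a, b]) f s =
  \int[lam]_(s in `[a, t]) f s + \int[lam]_(s in `]t, b]) f s.
Proof.
move=> hf at_ tb; rewrite -(@Rintegral_itvB _ f (BLeft a) (BRight b) t) ?bnd_simp //.
  by rewrite addrC subrK.
by apply: (@bm_integrable _ _ _ lam); [exact: measurable_itv|exact: itv_cc_fin|].
Qed.

Lemma Rint_itv_split f a t b : cadlag_path T f -> 0 <= a -> a <= t -> t <= b -> b <= T ->
  \int[lam]_(s in `[a, b]) f s =
  \int[lam]_(s in `[a, t]) f s + \int[lam]_(s in `]t, b]) f s.
Proof.
move=> hf a0 at_ tb bT; apply: bm_itv_split => //.
by apply: cadlag_bm_sub hf bT _; apply: subset_itv; rewrite bnd_simp.
Qed.

Lemma Rint_le_length f C a b (p : bool) : cadlag_path T f -> 0 <= a -> a <= b -> b <= T ->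
  (forall s, a <= s < b -> `|f s| <= C) ->
  `|\int[lam]_(s in [set` Interval (BSide p a) (BRight b)]) f s| <= C * (b - a).
Proof.
move=> hf a0 ab bT hC.
have Da : [set` Interval (BSide p a) (BRight b)] `<=` `[a, b].
  by apply: subset_itv; [case: (p); rewrite bnd_simp|].
have Db : [set` Interval (BSide p a) (BRight b)] `<=` `[0, b].
  by apply: subset_trans Da _; apply: subset_itv; rewrite bnd_simp.
set D := [set` _] in Da Db *; have mD : measurable D by exact: measurable_itv.
have Dfin : (lam D < +oo)%E.
  rewrite /D lebesgue_measure_itv /=; case: ifP => _; rewrite ?ltry //.
rewrite -(fine_lam_itv p false ab) -Rintegral_cst //.
apply: (@normr_Rint_le _ _ _ lam) => //; [exact: cadlag_bm_sub hf bT Db|exact: bm_cst|].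
(* The bound may fail at the right end point, a null set. *)
exists [set b]; split; [exact: measurable_set1|exact: lebesgue_measure_set1|].
move=> s /= h; apply: contrapT => sb; apply: h => Ds; apply: hC.
have /= := Da _ Ds.
by rewrite in_itv /= => /andP[-> sb']; rewrite lt_neqAle sb' andbT; apply/eqP.
Qed.

Lemma integral_lipschitz f : cadlag_path T f -> exists C, forall s t, 0 <= s -> s <= t -> t <= T ->
  `|\int[lam]_(r in `[0, t]) f r - \int[lam]_(r in `[0, s]) f r| <= C * (t - s).
Proof.
move=> hf; have [C hC] := cadlag_bounded hf; exists C => s t s0 st tT.
rewrite (Rint_itv_split hf (lexx 0) s0 st tT) addrC addKr.
by apply: Rint_le_length => // r /andP[sr rt]; apply: hC; lra.
Qed.

Lemma integral_cadlag f : cadlag_path T f ->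
  cadlag_path T (fun t => \int[lam]_(r in `[0, t]) f r).
Proof. by move=> /integral_lipschitz[C hC]; exact: lipschitz_cadlag hC. Qed.

(** Right Riemann sums: on each grid cell the path is replaced by its value at
    the right end point, so right continuity gives pointwise convergence. *)
Lemma riemann_cvg f t : cadlag_path T f -> 0 <= t <= T ->
  \sum_(i < N.+1) t / N.+1%:R * f (gpt t N i.+1) @[N --> \oo] -->
  \int[lam]_(s in `[0, t]) f s.
Proof.
move=> hf /andP[]; rewrite le_eqVlt => /predU1P[<- _|t0 tT].
  rewrite set_itv1 Rintegral_set1.
  under eq_fun do under eq_bigr do rewrite mul0r mul0r.
  by under eq_fun do rewrite big1 //; exact: cvg_cst.
have [C hC] := cadlag_bounded hf.
have [] := @Rint_bdd_cvg _ _ R lam `[0, t] (measurable_itv _) (itv_cc_fin _ _)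
  (fun N s => f (gup t N s)) f C.
- by move=> N; exact: cadlag_step_measurable.
- exact: cadlag_measurable.
- apply: aeW => s /=; rewrite in_itv /= => st N; apply: hC.
  rewrite (le_trans (gup_le_t _ t0 st) tT) andbT.
  by apply: le_trans (gup_ge _ t0 _); case/andP: st.
- by apply: aeW => s /=; rewrite in_itv /= => st; apply: cadlag_step_cvg; rewrite ?t0.
move=> _ h; suff E N : \int[lam]_(s in `[0, t]) f (gup t N s) =
    \sum_(i < N.+1) t / N.+1%:R * f (gpt t N i.+1) by under eq_fun do rewrite -E.
(* The integral of the step function is computed cell by cell from the left. *)
have step_bm : bm lam `[0, t] (fun s => f (gup t N s)).
  split; first exact: cadlag_step_measurable.
  exists C; apply: aeW => s /=; rewrite in_itv /= => st; apply: hC.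
  rewrite (le_trans (gup_le_t _ t0 st) tT) andbT.
  by apply: le_trans (gup_ge _ t0 _); case/andP: st.
have key j : (j <= N.+1)%N -> \int[lam]_(s in `[0, gpt t N j]) f (gup t N s) =
    \sum_(i < j) t / N.+1%:R * f (gpt t N i.+1).
  elim: j => [|j IH] jN; first by rewrite gpt0 set_itv1 Rintegral_set1 big_ord0.
  rewrite big_ord_recr /= -IH; last exact: ltnW.
  have jj : gpt t N j <= gpt t N j.+1 by rewrite gpt_le // ltW.
  have jt : gpt t N j.+1 <= t by rewrite gpt_le_t // ltW.
  have j0 : 0 <= gpt t N j by apply: gpt_ge0; exact: ltW.
  have hb : bm lam `[0, gpt t N j.+1] (fun s => f (gup t N s)).
    apply: (@bm_sub _ _ _ lam _ _ _ (measurable_itv _) _ step_bm).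
    by apply: subset_itv; rewrite bnd_simp.
  rewrite (bm_itv_split hb j0 jj).
  congr (_ + _).
  rewrite (@eq_Rintegral _ _ _ lam _ (fun=> f (gpt t N j.+1))).
    rewrite Rintegral_cst // mulrC fine_lam_itv // gptS.
    by rewrite addrAC subrr add0r.
  move=> s; rewrite inE /= in_itv /= => sj; rewrite /gup; congr (f (gpt _ _ _)).
  apply/eqP; rewrite gidx_itv //.
  have := gpt_ge0 N j (ltW t0); lra.
by rewrite -(key N.+1) // gptN.
Qed.

End TimeIntegral.

(** * Filtrations and stopped processes *)

Section Filtration.
Context {R : realType} {dO : measure_display} {Omega : measurableType dO}.
Variables (P : probability Omega R) (T : R) (F : R -> set (set Omega)).
Hypotheses (T0 : 0 < T) (hF : right_continuous_filtration T F).
Implicit Types (M : R -> Omega -> R) (f g : Omega -> R) (rho : Omega -> R)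
  (s t : R) (A B G : set Omega).

(** The filtration is a family of plain set systems; as a measurable type each
    of them gains the closure properties of measurable functions. *)
Definition FT t := g_sigma_algebraType (F t).

Definition Fm t f := measurable_fun [set: FT t] (f : FT t -> R).

Lemma F_measurable t A : 0 <= t <= T ->
  @measurable _ (FT t) A <-> F t A.
Proof.
by move=> tT; have [h _ _ _] := hF; rewrite (measurable_g_measurableTypeE (h t tT)).
Qed.

Lemma F_sub t A : 0 <= t <= T -> F t A -> measurable A.
Proof. by move=> tT; have [_ h _ _] := hF; exact: h. Qed.

Lemma F_mono s t A : 0 <= s -> s <= t -> t <= T -> F s A -> F t A.
Proof. by move=> s0 st tT; have [_ _ h _] := hF; exact: h. Qed.

Lemma FmP t f : 0 <= t <= T ->
  Fm t f <-> (forall B : set R, measurable B -> F t (f @^-1` B)).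
Proof.
move=> tT; split=> [h B mB|h mD B mB].
  by apply/(F_measurable _ tT); rewrite -[X in measurable X]setTI; exact: h.
by rewrite setTI; apply/(F_measurable _ tT); exact: h.
Qed.

Lemma adaptedP M : adapted T F M <-> forall t, 0 <= t <= T -> Fm t (M t).
Proof. by split=> h t tT; [apply/FmP => //|apply/FmP => //]; exact: h. Qed.

Lemma Fm_mono s t f : 0 <= s -> s <= t -> t <= T -> Fm s f -> Fm t f.
Proof.
move=> s0 st tT; have sT : 0 <= s <= T by lra.
have tT' : 0 <= t <= T by lra.
move=> /(FmP _ sT) h; apply/FmP => // B mB; apply: F_mono s0 st tT _; exact: h.
Qed.

Lemma Fm_meas t f : 0 <= t <= T -> Fm t f -> measurable_fun setT f.
Proof.
by move=> tT /(FmP _ tT) h _ B mB; rewrite setTI; exact: F_sub tT (h B mB).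
Qed.

Lemma FmI t A B : 0 <= t <= T -> F t A -> F t B -> F t (A `&` B).
Proof.
move=> tT /(F_measurable _ tT) a /(F_measurable _ tT) b; apply/(F_measurable _ tT).
exact: measurableI.
Qed.

Lemma FmC t A : 0 <= t <= T -> F t A -> F t (~` A).
Proof.
move=> tT /(F_measurable _ tT) a; apply/(F_measurable _ tT); exact: measurableC.
Qed.

Lemma FmT t : 0 <= t <= T -> F t setT.
Proof. by move=> tT; apply/(F_measurable _ tT). Qed.

Lemma Fm_indic t A : 0 <= t <= T -> F t A -> Fm t \1_A.
Proof. by move=> tT /(F_measurable _ tT) h; exact: measurable_indic. Qed.

Lemma Fm_le t f (c : R) : 0 <= t <= T -> Fm t f -> F t [set w | f w <= c].
Proof.
move=> tT /(FmP _ tT) h; have := h _ (measurable_itv `]-oo, c]).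
by congr (F t _); apply/seteqP; split => w /=; rewrite in_itv.
Qed.

Definition stopped M rho : R -> Omega -> R := fun t w => M (Num.min t (rho w)) w.

Lemma stop_le rho t s : stopping_time T F rho -> 0 <= s -> s <= T -> 0 <= t -> s <= t ->
  t <= T -> F t [set w | rho w <= s].
Proof.
move=> [_ h] s0 sT t0 st tT; have hs : F s [set w | rho w <= s].
  by apply: h; rewrite s0.
exact: (F_mono s0 st tT hs).
Qed.

Section Rounding.
Variables (rho : Omega -> R) (hrho : stopping_time T F rho).
Variables (t : R) (t0 : 0 < t) (tT : t <= T).
Let kap N w := gidx t N (Num.min t (rho w)).

Lemma stop_min w : 0 <= Num.min t (rho w) <= t.
Proof. by have [h _] := hrho; rewrite le_min ge_min lexx (ltW t0); case/andP: (h w) => ->. Qed.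

(** Rounding up delays: the rounded time is at most a grid point exactly when
    the stopping time, cut off at [t], is, and this is known at the grid point. *)
Lemma kap_le_F N i s : 0 <= s -> s <= T -> gpt t N i <= s -> F s [set w | (kap N w <= i)%N].
Proof.
move=> s0 sT is_; have i0 : 0 <= gpt t N i by apply: gpt_ge0; exact: ltW.
case: (leP t (gpt t N i)) => ti.
  rewrite (_ : [set _ | _] = setT); first by apply: FmT; rewrite s0.
  apply/seteqP; split => // w _ /=; rewrite gidx_le //; last by case/andP: (stop_min w).
  by rewrite (le_trans _ ti) //; case/andP: (stop_min w).
rewrite (_ : [set _ | _] = [set w | rho w <= gpt t N i]).
  by apply: (stop_le hrho) => //; lra.
apply/seteqP; split => w /=; rewrite gidx_le //; do ?by case/andP: (stop_min w).
  by rewrite ge_min leNgt ti.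
by move=> h; rewrite ge_min h orbT.
Qed.

Lemma kap_eq_F N i s : 0 <= s -> s <= T -> gpt t N i <= s -> F s [set w | kap N w = i].
Proof.
move=> s0 sT is_; have sT' : 0 <= s <= T by rewrite s0.
case: i is_ => [|i] is_.
  rewrite (_ : [set _ | _] = [set w | (kap N w <= 0)%N]); first exact: kap_le_F.
  by apply/seteqP; split => w /=; [move=> ->|rewrite leqn0 => /eqP].
rewrite (_ : [set _ | _] = [set w | (kap N w <= i.+1)%N] `&` ~` [set w | (kap N w <= i)%N]).
  apply: FmI => //; first exact: kap_le_F.
  apply: FmC => //; apply: kap_le_F => //; apply: le_trans is_.
  by apply: gpt_le; [exact: ltW|].
apply/seteqP; split => w /=; first by move=> ->; split => //; rewrite ltnn.
by move=> [h1 /negP h2]; lia.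
Qed.

Lemma kap_max N w : (kap N w <= N.+1)%N.
Proof. by apply: gidx_max => //; exact: stop_min. Qed.

End Rounding.

Lemma rounded_Fm M rho t N : stopping_time T F rho ->
  (forall s, 0 <= s <= T -> Fm s (M s)) -> 0 < t -> t <= T ->
  Fm t (fun w => M (gup t N (Num.min t (rho w))) w).
Proof.
move=> hrho hM t0 tT; have tT' : 0 <= t <= T by rewrite ltW.
rewrite /Fm (_ : (fun w => _) = fun w : FT t => (fun i w => M (Num.min (gpt t N i) t) w)
    (gidx t N (Num.min t (rho w))) w); last first.
  apply/funext => w; congr M; apply/esym/min_l; apply: gpt_le_t; first exact: ltW.
  exact: (kap_max hrho).
apply: (measurable_fun_select (h := fun i (w : FT t) => M (Num.min (gpt t N i) t) w)).
  move=> i; rewrite setTI; apply/(F_measurable _ tT').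
  case: (leqP i N.+1) => iN.
    by apply: (kap_eq_F hrho) => //; [exact: ltW|apply: gpt_le_t => //; exact: ltW].
  rewrite (_ : _ @^-1` _ = set0); first by apply/(F_measurable _ tT').
  apply/seteqP; split => // w /= E; have := kap_max hrho t0 N w.
  by rewrite E leqNgt iN.
move=> i; have h0 : 0 <= Num.min (gpt t N i) t by rewrite le_min gpt_ge0 ltW.
apply: (Fm_mono h0 _ tT); first by rewrite ge_min lexx orbT.
by apply: hM; rewrite h0 ge_min tT orbT.
Qed.

(** The value at a stopping time is the limit of the values at the stopping time
    rounded up to a grid of [0, t], and these depend on the information up to
    [t] alone. *)
Lemma stopped_Fm M rho t : stopping_time T F rho ->
  (forall s, 0 <= s <= T -> Fm s (M s)) -> (forall w, rcs T (M^~ w)) ->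
  0 <= t <= T -> Fm t (stopped M rho t).
Proof.
move=> hrho hM hpath /andP[]; rewrite le_eqVlt => /predU1P[<- _|t0 tT].
  have -> : stopped M rho 0 = M 0.
    apply/funext => w; rewrite /stopped; congr M; apply: min_l.
    by have [h _] := hrho; case/andP: (h w).
  by apply: hM; rewrite lexx ltW.
apply: (@measurable_fun_cvg _ _ _ _ (fun N (w : FT t) =>
  M (gup t N (Num.min t (rho w))) w)) => [N|w _]; last first.
  have /andP[m0 mt] := stop_min hrho t0 w.
  apply: (hpath w); first by rewrite m0 (le_trans mt).
    by move=> N; rewrite gup_ge //= (le_trans (gup_le_t _ t0 _)) // m0.
  exact: gup_cvg.
exact: rounded_Fm.
Qed.

(** The integral is a limit of Riemann sums over values up to [t]. *)
Lemma integral_Fm M t : (forall s, 0 <= s <= T -> Fm s (M s)) ->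
  (forall w, cadlag_path T (M^~ w)) -> 0 <= t <= T ->
  Fm t (fun w => \int[lebesgue_measure]_(s in `[0, t]) M s w).
Proof.
move=> hM hpath tT.
apply: (@measurable_fun_cvg _ _ _ _ (fun N (w : FT t) =>
   \sum_(i < N.+1) t / N.+1%:R * M (gpt t N i.+1) w)) => [N|w _]; last first.
  exact: (@riemann_cvg _ _ (M^~ w)).
apply: measurable_sum => i; apply: measurable_funM; first exact: measurable_cst.
have /andP[t0 tT'] := tT.
apply: (@Fm_mono (gpt t N i.+1)) => //.
- exact: gpt_ge0.
- by apply: gpt_le_t.
- by apply: hM; rewrite gpt_ge0 //=; apply: le_trans tT'; exact: gpt_le_t.
Qed.

End Filtration.

(** * Optional stopping *)

Section OptionalStopping.
Context {R : realType} {dO : measure_display} {Omega : measurableType dO}.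
Variables (P : probability Omega R) (T : R) (F : R -> set (set Omega)).
Hypotheses (T0 : 0 < T) (hF : right_continuous_filtration T F).
Implicit Types (M m : R -> Omega -> R) (f g : Omega -> R) (rho : Omega -> R)
  (s t C : R) (A B G : set Omega).

Local Notation pint f := (P.-integrable setT (EFin \o f)).

Lemma PT_fin : (P setT < +oo)%E.
Proof. by rewrite probability_setT ltry. Qed.

Lemma Rint_restrict A f :
  \int[P]_(w in A) f w = \int[P]_w (\1_A w * f w).
Proof.
rewrite Rintegral_mkcond; congr (Rintegral _ _ _); apply/funext => w.
by rewrite /patch indicE; case: (w \in A); rewrite ?mul1r ?mul0r.
Qed.

Lemma integrable_indicM A f : measurable A -> pint f -> pint (fun w => \1_A w * f w).
Proof.
move=> mA hf; apply: (le_integrable measurableT _ _ hf).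
  apply/measurable_EFinP; apply: measurable_funM; first exact: measurable_indic.
  by case/integrableP: hf => /measurable_EFinP.
move=> w _ /=; rewrite lee_fin normrM indicE.
by case: (w \in A); rewrite ?normr1 ?normr0 ?mul1r ?mul0r.
Qed.

Lemma martingale_indic M s t A : martingale P T F M ->
  0 <= s -> s <= t -> t <= T -> F s A ->
  \int[P]_w (\1_A w * M t w) = \int[P]_w (\1_A w * M s w).
Proof.
move=> [_ _ h] s0 st tT sA; rewrite -!Rint_restrict /Rintegral.
by congr fine; exact: h.
Qed.

Lemma martingale_int M t : martingale P T F M -> 0 <= t <= T -> pint (M t).
Proof. by move=> [_ h _]; exact: h. Qed.

(** The rounded stopping time takes finitely many values. On the event that it
    equals a given grid point the martingale property applies between this point
    and [t]; grid points before [s] do not occur on [G], where the stopping time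
    exceeds [s]. *)
Lemma stopped_rounding m rho s t G C N : martingale P T F m ->
  stopping_time T F rho -> 0 <= s -> s <= t -> 0 < t -> t <= T -> F s G ->
  (forall w, G w -> s < rho w) ->
  let r := fun w => gup t N (Num.min t (rho w)) in
  let B := G `&` [set w | `|m (r w) w| <= C] in
  \int[P]_w (\1_B w * m t w) = \int[P]_w (\1_B w * m (r w) w).
Proof.
move=> hm hrho s0 st t0 tT sG Gs r B.
pose k w := gidx t N (Num.min t (rho w)).
pose q i : R := gpt t N i.
pose Bi (i : nat) : set Omega := G `&` ([set w | k w = i] `&` [set w | `|m (q i) w| <= C]).
have q0 i : 0 <= q i by apply: gpt_ge0; exact: ltW.
have qt i : (i <= N.+1)%N -> q i <= t by move=> iN; apply: gpt_le_t => //; exact: ltW.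
have hBi i : (i <= N.+1)%N -> F (q i) (Bi i).
  move=> iN; have qT : 0 <= q i <= T by rewrite q0 (le_trans (qt i iN)).
  case: (leP s (q i)) => sq.
    apply: (FmI hF qT); first by apply: (F_mono hF s0 sq) => //; case/andP: qT.
    apply: (FmI hF qT).
      by apply: (kap_eq_F T0 hF hrho t0) => //; case/andP: qT.
    apply: (@Fm_le _ _ _ _ _ hF _ (fun w => `|m (q i) w|) C qT).
    apply: measurableT_comp; first exact: normr_measurable.
    by have [/(adaptedP hF) h _ _] := hm; exact: h.
  rewrite (_ : Bi i = set0); first exact/(F_measurable hF _ qT).
  apply/seteqP; split => // w [Gw [/= kw _]].
  have /andP[m0 mt] := stop_min hrho t0 w.
  have h1 : Num.min t (rho w) <= q i by rewrite -gidx_le // -/(k w) kw.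
  have : s <= Num.min t (rho w) by rewrite le_min st ltW //; exact: Gs.
  lra.
have Bsum w : \1_B w = \sum_(i < N.+2) \1_(Bi i) w :> R.
  have kN : (k w < N.+2)%N by rewrite ltnS; exact: (kap_max hrho).
  rewrite (bigD1 (Ordinal kN)) //= big1 ?addr0 => [|i ik].
    rewrite !indicE; congr (nat_of_bool _)%:R; apply/idP/idP; rewrite !inE /B /Bi /=.
      by case.
    by case=> ? [].
  rewrite indicE memNset // => -[_ [/= ki _]]; case/eqP: ik; exact: val_inj.
have mt_int : pint (m t) by apply: (martingale_int hm); lra.
have mBi i : (i <= N.+1)%N -> measurable (Bi i).
  by move=> iN; apply: (F_sub hF) (hBi i iN); rewrite q0 (le_trans (qt i iN)).
have int1 (i : 'I_N.+2) : pint (fun w => \1_(Bi i) w * m t w).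
  by apply: integrable_indicM => //; apply: mBi; rewrite -ltnS.
have int2 (i : 'I_N.+2) : pint (fun w => \1_(Bi i) w * m (q i) w).
  apply: integrable_indicM; first by apply: mBi; rewrite -ltnS.
  by apply: (martingale_int hm); rewrite q0 (le_trans (qt i _)) // -ltnS.
have Rsum (f : 'I_N.+2 -> Omega -> R) : (forall i, pint (f i)) ->
    \int[P]_w (\sum_(i < N.+2) f i w) = \sum_(i < N.+2) \int[P]_w f i w.
  move=> hf; rewrite /Rintegral.
  under eq_integral do rewrite -sumEFin.
  rewrite integral_sum //= -sum_fine //.
  by move=> i _; apply: (integrable_fin_num measurableT); exact: hf.
transitivity (\sum_(i < N.+2) \int[P]_w (\1_(Bi i) w * m t w)).
  rewrite -Rsum //; congr (Rintegral _ _ _); apply/funext => w.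
  by rewrite Bsum mulr_suml.
transitivity (\sum_(i < N.+2) \int[P]_w (\1_(Bi i) w * m (q i) w)).
  apply: eq_bigr => i _; have iN : (i <= N.+1)%N by rewrite -ltnS.
  by apply: martingale_indic => //; [exact: qt|exact: hBi].
rewrite -Rsum //; congr (Rintegral _ _ _); apply/funext => w.
rewrite Bsum mulr_suml; apply: eq_bigr => i _.
rewrite !indicE; case: (boolP (w \in Bi i)) => [|_]; last by rewrite !mul0r.
by rewrite inE => -[_ [/= kw _]]; rewrite -kw.
Qed.

(** Only the stopped variable is known to be bounded, not the values at the
    rounded times. The events where the rounded value is at most [C + 1] belong
    to the information at the rounded time and fill up [G] in the limit;
    restricted to them both sides are dominated. *)
Lemma stopped_eq m rho s t G C : martingale P T F m ->
  (forall w, rcs T (m^~ w)) -> stopping_time T F rho ->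
  0 <= s -> s <= t -> t <= T -> F s G -> (forall w, G w -> s < rho w) ->
  {ae P, forall w, `|m (Num.min t (rho w)) w| <= C} ->
  \int[P]_w (\1_G w * m t w) = \int[P]_w (\1_G w * m (Num.min t (rho w)) w).
Proof.
move=> hm hrc hrho s0 st tT sG Gs hC.
have [t0|t0] := ltP 0 t; last first.
  have t00 : t = 0 by lra.
  congr (Rintegral _ _ _); apply/funext => w; congr (_ * m _ w).
  by rewrite min_l // t00; have [h _] := hrho; case/andP: (h w).
have tT' : 0 <= t <= T by rewrite ltW.
have hFm u : 0 <= u <= T -> Fm F u (m u) by have [/(adaptedP hF) h _ _] := hm; exact: h.
have mst : measurable_fun setT (fun w => m (Num.min t (rho w)) w).
  exact: (Fm_meas hF tT' (stopped_Fm T0 hF hrho hFm hrc tT')).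
have mt_int : pint (m t) by apply: (martingale_int hm).
have mG : measurable G by apply: (F_sub hF) sG; lra.
pose r N w := gup t N (Num.min t (rho w)).
pose B N := G `&` [set w | `|m (r N w) w| <= C + 1].
have min_t w := stop_min hrho t0 w.
have r_cvg w : m (r N w) w @[N --> \oo] --> m (Num.min t (rho w)) w.
  have /andP[m0 mt] := min_t w.
  apply: (hrc w); first by rewrite m0 (le_trans mt).
    by move=> N; rewrite gup_ge //= (le_trans (gup_le_t _ t0 _)) // m0.
  exact: gup_cvg.
have mr N : measurable_fun setT (fun w => m (r N w) w).
  exact: (Fm_meas hF tT' (rounded_Fm T0 hF N hrho hFm t0 tT)).
have mB N : measurable (B N).
  apply: measurableI => //; rewrite -[X in measurable X]setTI.
  have mN : measurable_fun setT (fun w => `|m (r N w) w|).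
    by apply: measurableT_comp; [exact: normr_measurable|exact: mr].
  move: mN => /(_ measurableT _ (measurable_itv `]-oo, (C + 1)])).
  by congr measurable; apply/seteqP; split => w /=; rewrite in_itv.
have indB w : `|m (Num.min t (rho w)) w| <= C ->
    \forall N \near \oo, \1_(B N) w = \1_G w :> R.
  move=> hw; have /cvgrPdist_lt /(_ 1 ltr01) := r_cvg w.
  apply: filterS => N hN; rewrite !indicE; congr (nat_of_bool _)%:R.
  apply/idP/idP; rewrite !inE /B /=; first by case.
  move=> Gw; split => //.
  rewrite -[m (r N w) w](subrK (m (Num.min t (rho w)) w)) addrC.
  by rewrite (le_trans (ler_normD _ _)) // lerD // ltW // distrC.
have key N : \int[P]_w (\1_(B N) w * m t w) = \int[P]_w (\1_(B N) w * m (r N w) w).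
  exact: (stopped_rounding _ _ hm hrho s0 st t0 tT sG Gs).
have lim1 : \int[P]_w (\1_(B N) w * m t w) @[N --> \oo] --> \int[P]_w (\1_G w * m t w).
  have [] := @dominated_convergence _ _ _ P setT measurableT
    (fun N w => (\1_(B N) w * m t w)%:E) (fun w => (\1_G w * m t w)%:E)
    (fun w => `|m t w|%:E).
  - move=> N; apply/measurable_EFinP.
    by case/integrableP: (integrable_indicM (mB N) mt_int) => /measurable_EFinP.
  - by case/integrableP: (integrable_indicM mG mt_int).
  - apply: filterS hC => w hw _; apply: cvg_EFin; first exact: nearW.
    apply: cvg_near_cst; apply: filterS (indB w hw) => N E /=; by rewrite E.
  - by have /integrable_abse := mt_int.
  - apply: aeW => w N _; rewrite lee_fin normrM indicE.
    by case: (w \in B N); rewrite ?normr1 ?normr0 ?mul1r ?mul0r.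
  move=> _ _ h; apply: (fine_cvg _) => /=; rewrite fineK; first exact: h.
  by apply: (integrable_fin_num measurableT); exact: integrable_indicM.
have lim2 : \int[P]_w (\1_(B N) w * m (r N w) w) @[N --> \oo] -->
    \int[P]_w (\1_G w * m (Num.min t (rho w)) w).
  have [] := @Rint_bdd_cvg _ _ R P setT measurableT PT_fin
    (fun N w => \1_(B N) w * m (r N w) w) (fun w => \1_G w * m (Num.min t (rho w)) w)
    (`|C + 1|).
  - by move=> N; apply: measurable_funM => //; exact: measurable_indic.
  - by apply: measurable_funM => //; exact: measurable_indic.
  - apply: aeW => w _ N; rewrite indicE; case: (boolP (w \in B N)) => [|_].
      by rewrite inE mul1r => -[_ /= h]; apply: le_trans h _; exact: ler_norm.
    by rewrite mul0r normr0.
  - apply: filterS hC => w hw _.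
    apply: cvgM; last exact: r_cvg.
    by apply: cvg_near_cst; exact: indB.
  by [].
by rewrite -(cvg_lim _ lim1) // -(cvg_lim _ lim2) // (funext key).
Qed.

(** On the event that [rho] exceeds [s], the martingales of a localizing
    sequence have the same mean at [rho] cut off at [t], at [t], at [s], and at
    [rho] cut off at [s]; bounded convergence removes the localization. On the
    complement the stopped process does not move between [s] and [t]. *)
Lemma optional_stopping M rho C : local_martingale P T F M ->
  adapted T F M -> (forall w, rcs T (M^~ w)) -> stopping_time T F rho ->
  {ae P, forall w, forall t, 0 <= t <= T -> `|stopped M rho t w| <= C} ->
  martingale P T F (stopped M rho).
Proof.
move=> [tau [htau taumono tauT hmart]] hM hrc hrho hC.
have hFm u : 0 <= u <= T -> Fm F u (M u) by move/(adaptedP hF): hM; exact.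
have hst t : 0 <= t <= T -> Fm F t (stopped M rho t) := stopped_Fm T0 hF hrho hFm hrc.
have st_bm t : 0 <= t <= T -> bm P setT (stopped M rho t).
  move=> tT; split; first exact: (Fm_meas hF tT (hst t tT)).
  by exists C; apply: filterS hC => w h _; exact: h.
split.
- by apply/(adaptedP hF).
- by move=> t tT; apply: (bm_integrable measurableT PT_fin); exact: st_bm.
move=> s t s0 st tT A sA.
have sT' : 0 <= s <= T by lra.
have tT' : 0 <= t <= T by lra.
have mA : measurable A := F_sub hF sT' sA.
suff h : \int[P]_w (\1_A w * stopped M rho t w) = \int[P]_w (\1_A w * stopped M rho s w).
  have ex u : 0 <= u <= T ->
      (\int[P]_(w in A) (stopped M rho u w)%:E = (\int[P]_w (\1_A w * stopped M rho u w))%:E)%E.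
    move=> uT; rewrite -Rint_restrict /Rintegral fineK //.
    apply/integrable_fin_num => //; apply: (integrableS measurableT) => //.
    by apply: (bm_integrable measurableT PT_fin); exact: st_bm.
  by rewrite !ex // h.
pose G := A `&` ~` [set w | rho w <= s].
have sG : F s G.
  by apply: (FmI hF) => //; apply: (FmC hF) => //; case: hrho => _; apply.
have mG : measurable G := F_sub hF sT' sG.
have Gs w : G w -> s < rho w by case=> _ /= /negP; rewrite -ltNge.
pose m n := stopped M (tau n).
have mrc n w : rcs T ((m n)^~ w).
  move=> x u xT hu hux; rewrite /m /stopped.
  have [h0 _] := htau n; have /andP[q0 qT] := h0 w.
  apply: (hrc w) => [|k|].
  - by rewrite le_min q0 ge_min qT orbT andbT; case/andP: xT => ->.
  - have /andP[xu uT] := hu k.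
    apply/andP; split; first by rewrite le_min !ge_min xu lexx orbT.
    by rewrite ge_min uT.
  - apply: (@squeeze_cvgr _ _ _ _ (fun=> Num.min x (tau n w))
        (fun k => Num.min x (tau n w) + (u k - x))).
    + apply: nearW => k; have /andP[xu uT] := hu k; apply/andP; split.
        by rewrite le_min !ge_min xu lexx orbT.
      case: (leP x (tau n w)) => h; case: (leP (u k) (tau n w)) => h'; lra.
    + exact: cvg_cst.
    + rewrite -[X in _ --> X]addr0; apply: cvgD; first exact: cvg_cst.
      by rewrite -(subrr x); apply: cvgB => //; exact: cvg_cst.
have m_bd n u : 0 <= u <= T -> {ae P, forall w, `|m n (Num.min u (rho w)) w| <= C}.
  move=> uT; apply: filterS hC => w h; rewrite /m /stopped.
  have [h0 _] := htau n; have /andP[q0 qT] := h0 w.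
  have := h (Num.min u (tau n w)); rewrite /stopped minAC; apply.
  by rewrite le_min q0 ge_min qT orbT andbT; case/andP: uT => ->.
have eqn n : \int[P]_w (\1_G w * m n (Num.min t (rho w)) w) =
    \int[P]_w (\1_G w * m n (Num.min s (rho w)) w).
  rewrite -(stopped_eq (hmart n) (mrc n) hrho s0 st tT sG Gs (m_bd n t tT')).
  rewrite -(stopped_eq (hmart n) (mrc n) hrho s0 (lexx s) (le_trans st tT) sG Gs (m_bd n s sT')).
  exact: (martingale_indic (hmart n) s0 st tT sG).
have lim u : 0 <= u <= T -> \int[P]_w (\1_G w * m n (Num.min u (rho w)) w) @[n --> \oo] -->
    \int[P]_w (\1_G w * stopped M rho u w).
  move=> uT.
  have mm n : measurable_fun setT (fun w => m n (Num.min u (rho w)) w).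
    apply: (Fm_meas hF uT); apply: (stopped_Fm T0 hF hrho _ (mrc n) uT).
    by move=> v vT; apply: (stopped_Fm T0 hF (htau n) hFm hrc vT).
  have [] := @Rint_bdd_cvg _ _ R P setT measurableT PT_fin
    (fun n w => \1_G w * m n (Num.min u (rho w)) w) (fun w => \1_G w * stopped M rho u w)
    C.
  - by move=> n; apply: measurable_funM => //; exact: measurable_indic.
  - apply: measurable_funM; first exact: measurable_indic.
    exact: (bm_meas (st_bm u uT)).
  - have hall : {ae P, forall w n, `|m n (Num.min u (rho w)) w| <= C}.
      apply: filterS hC => w h n; rewrite /m /stopped.
      have [h0 _] := htau n; have /andP[q0 qT] := h0 w.
      have := h (Num.min u (tau n w)); rewrite /stopped minAC; apply.
      by rewrite le_min q0 ge_min qT orbT andbT; case/andP: uT => ->.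
    apply: filterS hall => w h _ n; apply: le_trans (h n).
    by rewrite normrM indicE; case: (w \in G); rewrite ?normr1 ?normr0 ?mul1r ?mul0r.
  - apply: filterS tauT => w [N hN] _; apply: cvg_near_cst; exists N => // n /= Nn.
    have : tau n w = T.
      apply/eqP; rewrite eq_le; have [h0 _] := htau n; have /andP[_ -> /=] := h0 w.
      rewrite -hN; move: Nn {h0}; elim: n => [|n IH]; first by rewrite leqn0 => /eqP ->.
      rewrite leq_eqVlt => /predU1P[->//|]; rewrite ltnS => /IH h.
      exact: le_trans h (taumono n w).
    move=> E; rewrite /m /stopped E; congr (_ * M _ w); apply: min_l.
    by rewrite ge_min; case/andP: uT => _ ->.
  by [].
have eqG : \int[P]_w (\1_G w * stopped M rho t w) = \int[P]_w (\1_G w * stopped M rho s w).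
  by rewrite -(cvg_lim _ (lim t tT')) // -(cvg_lim _ (lim s sT')) // (funext eqn).
have decomp u : 0 <= u <= T -> \int[P]_w (\1_A w * stopped M rho u w) =
    \int[P]_w (\1_G w * stopped M rho u w) +
    \int[P]_w (\1_(A `\` G) w * stopped M rho u w).
  move=> uT; rewrite -(RintD measurableT PT_fin).
  - congr (Rintegral _ _ _); apply/funext => w; rewrite -mulrDl; congr (_ * _).
    rewrite !indicE in_setD; have : (w \in G) -> (w \in A).
      by rewrite !inE => -[].
    by case: (w \in G); case: (w \in A) => /= h; rewrite ?addr0 ?add0r //; have := h isT.
  - by apply: bmM; [exact: bm_indic|exact: st_bm].
  - by apply: bmM; [apply: bm_indic; exact: measurableD|exact: st_bm].
rewrite !decomp // eqG; congr (_ + _); congr (Rintegral _ _ _); apply/funext => w.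
rewrite !indicE; case: (boolP (w \in A `\` G)) => [|_]; last by rewrite !mul0r.
rewrite inE => -[Aw nGw]; congr (_ * _); rewrite /stopped; congr (M _ w).
(* Outside [G] the process is already stopped at time [s]. *)
have rs : rho w <= s by apply: contrapT => h; apply: nGw.
by rewrite !min_r // (le_trans rs).
Qed.

End OptionalStopping.

(** * Squared increments of bounded martingales *)

Lemma sum_ltn_min (K m : nat) : (\sum_(j < K) (j < m) = minn K m)%N.
Proof.
elim: K => [|K IH]; first by rewrite big_ord0 min0n.
by rewrite big_ord_recr /= IH; case: ltnP; lia.
Qed.

Section BoundedMartingale.
Context {R : realType} {dO : measure_display} {Omega : measurableType dO}.
Variables (P : probability Omega R) (T : R) (F : R -> set (set Omega)).
Hypotheses (T0 : 0 < T) (hF : right_continuous_filtration T F).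
Implicit Types (M m : R -> Omega -> R) (Z f g : Omega -> R)
  (s t c C : R) (A B G : set Omega).
Local Notation bm := (bm P setT).
Local Notation mT := (@measurableT _ Omega).
Local Notation Pfin := (PT_fin P).

Lemma Rint_mul1 f : \int[P]_w (1 * f w) = \int[P]_w f w.
Proof. by congr (Rintegral _ _ _); apply/funext => w; rewrite mul1r. Qed.

Lemma Rint_cst C : \int[P]_w C = C.
Proof.
rewrite Rintegral_cst //.
have -> : fine (P setT) = 1 by rewrite probability_setT.
by rewrite mulr1.
Qed.

(** A bounded weight known at time [s] is, up to [1/n], a constant plus
    [1/n] times a sum of indicators of events known at time [s]. *)
Lemma martingale_weight M s t Z : martingale P T F M ->
  0 <= s -> s <= t -> t <= T -> bm (M s) -> bm (M t) ->
  Fm F s Z -> bounded_ae P setT Z ->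
  \int[P]_w (Z w * (M t w - M s w)) = 0.
Proof.
move=> hM s0 st tT bs bt FZ [C hC].
have sT : 0 <= s <= T by lra.
set D := fun w => M t w - M s w; have bD : bm D by exact: bmB.
have bZ : bm Z by split; [exact: (Fm_meas hF sT)|exists C].
have ind0 A : F s A -> \int[P]_w (\1_A w * D w) = 0.
  move=> sA; have mA := F_sub hF sT sA.
  under eq_Rintegral do rewrite mulrBr.
  rewrite (RintB mT Pfin); do ?by apply: bmM => //; exact: bm_indic.
  by rewrite (martingale_indic hM s0 st tT sA) subrr.
have D0 : \int[P]_w D w = 0.
  rewrite -[RHS](ind0 setT (FmT hF sT)); congr (Rintegral _ _ _).
  by apply/funext => w; rewrite indicT mul1r.
(* Almost surely [Z + `|C|] lies between 0 and [2 * `|C|], so [K * n.+1] levels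
   of height [n.+1%:R^-1] exhaust it, and [c n] counts the levels below it. *)
pose K : nat := (Num.truncn (2 * `|C|)).+1.
pose q n w : nat := Num.truncn (n.+1%:R * (Z w + `|C|)).
pose c n w : R := \sum_(j < K * n.+1) \1_[set w | (j.+1%:R : R) <= n.+1%:R * (Z w + `|C|)] w.
have hA n (j : nat) : F s [set w | (j.+1%:R : R) <= n.+1%:R * (Z w + `|C|)].
  have FZ' : Fm F s (fun w => - (n.+1%:R * (Z w + `|C|))).
    apply: measurableT_comp => //; apply: measurable_funM; first exact: measurable_cst.
    by apply: measurable_funD => //; exact: measurable_cst.
  have := Fm_le hF (- j.+1%:R) sT FZ'.
  by congr (F s _); apply/seteqP; split => w /=; rewrite lerN2.
have bc n : bm (c n).
  apply: bm_sum => j; apply: bm_indic; exact: (F_sub hF sT (hA n j)).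
have cD n : \int[P]_w (c n w * D w) = 0.
  under eq_Rintegral do rewrite mulr_suml.
  rewrite (Rint_sum mT Pfin) => [|j]; last first.
    by apply: bmM => //; apply: bm_indic; exact: (F_sub hF sT (hA n j)).
  by rewrite big1 // => j _; apply: ind0; exact: hA.
have approx n : {ae P, forall w, `|Z w + `|C| - n.+1%:R^-1 * c n w| <= n.+1%:R^-1}.
  apply: filterS hC => w /(_ I) h.
  have n0 : (0 : R) < n.+1%:R by rewrite ltr0n.
  have := le_trans h (ler_norm C); rewrite ler_norml => /andP[h1 h2].
  have x0 : 0 <= n.+1%:R * (Z w + `|C|) by rewrite mulr_ge0 //; lra.
  have -> : c n w = (q n w)%:R.
    have -> : c n w = (\sum_(j < K * n.+1) (j < q n w))%N%:R.
      rewrite natr_sum; apply: eq_bigr => j _; rewrite indicE; congr (nat_of_bool _)%:R.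
      rewrite /q truncn_ge_nat //; apply/idP/idP; by rewrite inE.
    rewrite sum_ltn_min; congr _%:R; apply/minn_idPr.
    rewrite -(ler_nat R); apply: le_trans (_ : n.+1%:R * (Z w + `|C|) <= _).
      by rewrite /q; have /andP[] := truncn_itv x0.
    rewrite natrM mulrC ler_wpM2r //.
    have C2 : 0 <= 2 * `|C| by rewrite mulr_ge0.
    by have /andP[_] := truncn_itv C2; rewrite -/K; lra.
  have /andP[t1 t2] := truncn_itv x0; rewrite -/(q n w) in t1 t2.
  have -> : Z w + `|C| = n.+1%:R^-1 * (n.+1%:R * (Z w + `|C|)).
    by rewrite mulKf // gt_eqF.
  rewrite -mulrBr normrM gtr0_norm ?invr_gt0 // ler_piMr ?invr_ge0 ?(ltW n0) //.
  rewrite -natr1 in t2; rewrite ger0_norm; lra.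
have bound n : `|\int[P]_w (Z w * D w)| <= n.+1%:R^-1 * \int[P]_w `|D w|.
  have -> : \int[P]_w (Z w * D w) =
      \int[P]_w ((Z w + `|C| - n.+1%:R^-1 * c n w) * D w).
    have e1 : bm (fun w => Z w * D w) by exact: bmM.
    have e2 : bm (fun w => `|C| * D w) by exact: bmZ.
    have e3 : bm (fun w => n.+1%:R^-1 * (c n w * D w)) by apply: bmZ; exact: bmM.
    transitivity (\int[P]_w (Z w * D w + `|C| * D w - n.+1%:R^-1 * (c n w * D w))).
      rewrite (RintB mT Pfin (bmD e1 e2) e3) (RintD mT Pfin e1 e2).
      rewrite !(RintZ mT Pfin) //; last exact: bmM.
      by rewrite D0 cD !mulr0 addr0 subr0.
    by congr (Rintegral _ _ _); apply/funext => w; ring.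
  rewrite -(RintZ mT Pfin) //; last exact: bm_norm.
  apply: (normr_Rint_le mT Pfin).
  - by apply: bmM => //; apply: bmB; [apply: bmD => //; exact: bm_cst|exact: bmZ].
  - by apply: bmZ; exact: bm_norm.
  - by apply: filterS (approx n) => w h _; rewrite normrM ler_wpM2r.
apply/eqP; rewrite -normr_le0.
have lim : (fun n => n.+1%:R^-1 * \int[P]_w `|D w|) @ \oo --> (0 : R).
  rewrite -(mul0r (\int[P]_w `|D w|)); apply: cvgM; last exact: cvg_cst.
  exact: cvg_harmonic.
rewrite -(cvg_lim _ lim) //; apply: limr_ge; first exact: cvgP lim.
by apply: nearW => n; exact: bound.
Qed.

Section Squares.
Variables (M : R -> Omega -> R) (hM : martingale P T F M) (c : R).
Hypothesis hc : forall t, 0 <= t <= T -> {ae P, forall w, `|M t w| <= c}.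
Variable p : nat -> R.
Hypotheses (p0 : 0 <= p 0) (pS : forall i, p i <= p i.+1) (pT : forall i, p i <= T).

Lemma p_ge0 i : 0 <= p i.
Proof. by elim: i => // i h; exact: le_trans h (pS i). Qed.

Lemma p_itv i : 0 <= p i <= T. Proof. by rewrite p_ge0 pT. Qed.

Lemma p_mono i j : (i <= j)%N -> p i <= p j.
Proof.
elim: j => [|j IH]; first by rewrite leqn0 => /eqP ->.
by rewrite leq_eqVlt => /predU1P[->//|]; rewrite ltnS => /IH h; exact: le_trans h (pS j).
Qed.

Let X i w := M (p i) w.
Let D i w := X i.+1 w - X i w.
Definition sqsum n w : R := \sum_(i < n) (M (p i.+1) w - M (p i) w) ^+ 2.

Lemma X_Fm i j : (i <= j)%N -> Fm F (p j) (X i).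
Proof.
move=> ij; apply: (Fm_mono hF (p_ge0 i) (p_mono ij) (pT j)).
by have [/(adaptedP hF) h _ _] := hM; apply: h; exact: p_itv.
Qed.

Lemma X_bm i : bm (X i).
Proof.
split; first exact: (Fm_meas hF (p_itv i) (X_Fm (leqnn i))).
by exists c; apply: filterS (hc (p_itv i)) => w h _.
Qed.

Lemma D_bm i : bm (D i). Proof. by apply: bmB; exact: X_bm. Qed.

Lemma sqsum_bm n : bm (sqsum n).
Proof. by apply: bm_sum => i; apply: bm_sqr; exact: D_bm. Qed.

Lemma sqsum_Fm n : Fm F (p n) (sqsum n).
Proof.
rewrite /Fm (_ : sqsum n = fun w => \sum_(i < n) (if (i < n)%N then D i w ^+ 2 else 0)); last first.
  by apply/funext => w; apply: eq_bigr => i _; rewrite ltn_ord.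
apply: measurable_sum => i; rewrite ltn_ord.
apply: measurable_funX; apply: measurable_funB.
  by apply: X_Fm; exact: ltn_ord.
by apply: X_Fm; exact/ltnW/ltn_ord.
Qed.

Lemma sqsum_ge0 n w : 0 <= sqsum n w.
Proof. by apply: sumr_ge0 => i _; exact: sqr_ge0. Qed.

(** The cross term in the square of the increment has mean zero by
    [martingale_weight]; what remains is, in mean, the weighted increment of the
    square. *)
Lemma weight_sqr i Z : Fm F (p i) Z -> bm Z ->
  \int[P]_w (Z w * D i w ^+ 2) =
  \int[P]_w (Z w * X i.+1 w ^+ 2) - \int[P]_w (Z w * X i w ^+ 2).
Proof.
move=> FZ bZ; have bX := X_bm i; have bX' := X_bm i.+1; have bD := D_bm i.
have e1 : bm (fun w => Z w * X i.+1 w ^+ 2) by apply: bmM => //; exact: bm_sqr.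
have e2 : bm (fun w => Z w * X i w ^+ 2) by apply: bmM => //; exact: bm_sqr.
have e3 : bm (fun w => (Z w * X i w) * D i w) by apply: bmM => //; exact: bmM.
transitivity (\int[P]_w (Z w * X i.+1 w ^+ 2 - Z w * X i w ^+ 2 - 2 * (Z w * X i w * D i w))).
  by congr (Rintegral _ _ _); apply/funext => w; rewrite /D; ring.
rewrite (RintB mT Pfin (bmB e1 e2)); last exact: bmZ.
rewrite (RintB mT Pfin e1 e2) (RintZ mT Pfin) //.
rewrite (martingale_weight hM (p_ge0 i) (pS i) (pT _) bX bX') ?mulr0 ?subr0 //.
  by apply: measurable_funM => //; exact: X_Fm.
by have [] := bmM bZ bX.
Qed.

Lemma sqsum_mean n :
  \int[P]_w sqsum n w = \int[P]_w (X n w ^+ 2) - \int[P]_w (X 0 w ^+ 2).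
Proof.
elim: n => [|n IH].
  rewrite subrr; under eq_Rintegral do rewrite /sqsum big_ord0.
  by rewrite Rintegral_cst // mul0r.
under eq_Rintegral do rewrite /sqsum big_ord_recr /=.
rewrite (RintD mT Pfin (sqsum_bm n)); last by apply: bm_sqr; exact: D_bm.
have := @weight_sqr n (fun=> 1) (measurable_cst _) (bm_cst _ _ _).
by rewrite !Rint_mul1 -/(sqsum n) IH => ->; lra.
Qed.

Lemma c_ge0 : 0 <= c.
Proof.
apply: contrapT => c0.
have : P.-negligible setT.
  have [A [mA PA sA]] := hc (p_itv 0); exists A; split => //.
  by move=> w _; apply: sA => /= h; apply: c0; exact: le_trans h.
move=> /(negligibleP P mT) h.
have : (1 = 0 :> \bar R)%E := etrans (esym (probability_setT P)) h.
by move=> /eqP; rewrite onee_eq0.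
Qed.

Lemma X_sqr_le i : {ae P, forall w, X i w ^+ 2 <= c ^+ 2}.
Proof.
apply: filterS (hc (p_itv i)) => w h.
by rewrite -[X i w ^+ 2]real_normK ?num_real // ler_pXn2r ?nnegrE ?c_ge0.
Qed.

Lemma D_sqr_le i : {ae P, forall w, D i w ^+ 2 <= 4 * c ^+ 2}.
Proof.
apply: filterS2 (hc (p_itv i)) (hc (p_itv i.+1)) => w; rewrite -/(X _ _) -/(X _ _).
rewrite !ler_norml => /andP[a1 a2] /andP[b1 b2]; rewrite /D.
have c0 := c_ge0; nra.
Qed.

Lemma sqsum_mean_le n : \int[P]_w sqsum n w <= c ^+ 2.
Proof.
rewrite sqsum_mean.
have h0 : 0 <= \int[P]_w (X 0 w ^+ 2) by apply: Rintegral_ge0 => w _; exact: sqr_ge0.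
have : \int[P]_w (X n w ^+ 2) <= \int[P]_w (c ^+ 2).
  apply: (Rint_ae_le mT Pfin); [apply: bm_sqr; exact: X_bm|exact: bm_cst|].
  by apply: filterS (X_sqr_le n) => w h _.
rewrite Rint_cst; lra.
Qed.

(** With [S_n] the sum of squared increments, the quantity
    [E S_n ^ 2 - 2 E (S_n X_n ^ 2) - 4 c ^ 2 E (X_n ^ 2 - X_0 ^ 2)] does not
    increase with [n]; boundedness then gives a fourth moment estimate that is
    uniform over partitions. *)
Lemma sqsum_sqr_mean_le n : \int[P]_w (sqsum n w ^+ 2) <= 6 * c ^+ 4.
Proof.
have pot : \int[P]_w (sqsum n w ^+ 2) <= 2 * \int[P]_w (sqsum n w * X n w ^+ 2) +
    4 * c ^+ 2 * (\int[P]_w (X n w ^+ 2) - \int[P]_w (X 0 w ^+ 2)).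
  elim: n => [|n IH].
    rewrite subrr mulr0 addr0.
    have e (f : Omega -> R) : (forall w, f w = 0) -> \int[P]_w f w = 0.
      by move=> h; under eq_Rintegral do rewrite h; rewrite Rintegral_cst // mul0r.
    by rewrite !e ?mulr0 // => w; rewrite /sqsum big_ord0 ?expr0n ?mul0r.
  have bS := sqsum_bm n; have bS' := sqsum_bm n.+1; have bD2 := bm_sqr (D_bm n).
  have bX := bm_sqr (X_bm n); have bX' := bm_sqr (X_bm n.+1).
  have SS w : sqsum n.+1 w = sqsum n w + D n w ^+ 2 by rewrite /sqsum big_ord_recr.
  have b1 : bm (fun w => 2 * (sqsum n w * D n w ^+ 2)) by apply: bmZ; exact: bmM.
  have b2 : bm (fun w => 4 * c ^+ 2 * D n w ^+ 2) by exact: bmZ.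
  have le1 : \int[P]_w (sqsum n.+1 w ^+ 2) <=
      \int[P]_w (sqsum n w ^+ 2 + 2 * (sqsum n w * D n w ^+ 2) + 4 * c ^+ 2 * D n w ^+ 2).
    apply: (Rint_ae_le mT Pfin); first exact: bm_sqr.
      by apply: bmD => //; apply: bmD => //; exact: bm_sqr.
    apply: filterS (D_sqr_le n) => w h _; rewrite SS.
    have := sqr_ge0 (D n w); set x := D n w ^+ 2 in h *; nra.
  rewrite (RintD mT Pfin (bmD (bm_sqr bS) b1) b2) in le1.
  rewrite (RintD mT Pfin (bm_sqr bS) b1) !(RintZ mT Pfin) // in le1; last exact: bmM.
  rewrite (weight_sqr (@sqsum_Fm n) bS) in le1.
  have D2 : \int[P]_w (D n w ^+ 2) = \int[P]_w (X n.+1 w ^+ 2) - \int[P]_w (X n w ^+ 2).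
    have := @weight_sqr n (fun=> 1) (measurable_cst _) (bm_cst _ _ _).
    by rewrite !Rint_mul1.
  rewrite D2 in le1.
  have le2 : \int[P]_w (sqsum n w * X n.+1 w ^+ 2) <= \int[P]_w (sqsum n.+1 w * X n.+1 w ^+ 2).
    apply: (Rint_ae_le mT Pfin); [exact: bmM|exact: bmM|apply: aeW => w _].
    by rewrite SS ler_wpM2r ?sqr_ge0 // lerDl sqr_ge0.
  lra.
have h1 : \int[P]_w (sqsum n w * X n w ^+ 2) <= c ^+ 2 * \int[P]_w sqsum n w.
  rewrite -(RintZ mT Pfin) //; last exact: sqsum_bm.
  apply: (Rint_ae_le mT Pfin).
  - by apply: bmM; [exact: sqsum_bm|apply: bm_sqr; exact: X_bm].
  - by apply: bmZ; exact: sqsum_bm.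
  - by apply: filterS (X_sqr_le n) => w h _; rewrite mulrC ler_wpM2r ?sqsum_ge0.
have h2 := sqsum_mean_le n; rewrite -sqsum_mean in pot.
have c2 : 0 <= c ^+ 2 by exact: sqr_ge0.
have c4 : c ^+ 4 = c ^+ 2 * c ^+ 2 by ring.
rewrite c4; nra.
Qed.

End Squares.

End BoundedMartingale.

(** * The exponential along partitions *)

Section ComplexMeasurable.
Context {d : measure_display} {Om : measurableType d} {R : realType}.
Variable D : set Om.
Implicit Types (f g : Om -> R[i]).

Definition cmeas f := measurable_fun D (fun w => cRe (f w)) /\
  measurable_fun D (fun w => cIm (f w)).

Lemma cmeas_cst z : cmeas (fun=> z). Proof. by split; exact: measurable_cst. Qed.

Lemma cmeasD f g : cmeas f -> cmeas g -> cmeas (fun w => f w + g w).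
Proof.
move=> [f1 f2] [g1 g2]; split.
  by under eq_fun do rewrite cReD; exact: measurable_funD.
by under eq_fun do rewrite cImD; exact: measurable_funD.
Qed.

Lemma cmeasM f g : cmeas f -> cmeas g -> cmeas (fun w => f w * g w).
Proof.
move=> [f1 f2] [g1 g2]; split.
  by under eq_fun do rewrite cReM; apply: measurable_funB; exact: measurable_funM.
by under eq_fun do rewrite cImM; apply: measurable_funD; exact: measurable_funM.
Qed.

Lemma cmeas_exp f : cmeas f -> cmeas (fun w => cexp (f w)).
Proof.
move=> [f1 f2].
have me : measurable_fun D (fun w => expR (cRe (f w))).
  by apply: measurableT_comp => //; exact: measurable_expR.
split => /=; apply: measurable_funM => //; apply: (measurableT_comp _ f2).
  exact: (continuous_measurable_fun (@continuous_cos R)).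
exact: (continuous_measurable_fun (@continuous_sin R)).
Qed.

End ComplexMeasurable.

Lemma cbmP {d : measure_display} {Om : measurableType d} {R : realType}
    (mu : {measure set Om -> \bar R}) (D : set Om) (f : Om -> R[i]) :
  cbm mu D f <-> cmeas D f /\
    exists C, {ae mu, forall w, D w -> normc (f w) <= C}.
Proof.
split=> [h|[[m1 m2] [C hC]]].
  by split; [case: h => -[? _] [? _]|exact: cbm_bound].
by split; split => //; exists C; apply: filterS hC => w h Dw;
  apply: le_trans (h Dw); [exact: normr_Re|exact: normr_Im].
Qed.

Lemma cbm_exp {d : measure_display} {Om : measurableType d} {R : realType}
    (mu : {measure set Om -> \bar R}) (D : set Om) (f : Om -> R[i]) :
  cbm mu D f -> cbm mu D (fun w => cexp (f w)).
Proof.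
move=> /cbmP[mf [C hC]]; apply/cbmP; split; first exact: cmeas_exp.
exists (expR C); apply: filterS hC => w h Dw; apply: le_trans (normc_cexp _) _.
by rewrite ler_expR; exact: h.
Qed.

(** A norm equivalent to the modulus whose continuity, measurability and
    adaptedness come directly from those of the absolute value. *)
Definition norm1 {R : realType} (z : R[i]) : R := `|cRe z| + `|cIm z|.

Lemma norm1_ge0 {R : realType} (z : R[i]) : 0 <= norm1 z.
Proof. by rewrite addr_ge0. Qed.

Lemma normc_le_norm1 {R : realType} (z : R[i]) : normc z <= norm1 z.
Proof. exact: normc_le_ReIm. Qed.

Lemma norm1_le {R : realType} (z : R[i]) : norm1 z <= 2 * normc z.
Proof. by rewrite mulr2n mulrDl mul1r lerD ?normr_Re ?normr_Im. Qed.

(** Here [y] is a bounded process, [Ja] and [Jb] are the compensators that make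
    [y] and its square martingales [M] and [N], and [K] is the candidate
    compensator of the exponential of [y]. The hypothesis [drift] says that over
    a short time interval the increment of [K] is the first order part of the
    increment of the exponential. *)
Section Ito.
Context {R : realType} {dO : measure_display} {Omega : measurableType dO}.
Variables (P : probability Omega R) (T : R) (F : R -> set (set Omega)).
Hypotheses (T0 : 0 < T) (hF : right_continuous_filtration T F).
Local Notation cbm := (cbm P setT).
Local Notation bm := (bm P setT).
Local Notation cint := (cint P setT).
Local Notation mT := (@measurableT _ Omega).
Local Notation Pfin := (PT_fin P).
Implicit Types (Z : Omega -> R[i]) (s t : R).

Definition cFm t (f : Omega -> R[i]) := cmeas [set: FT F t] f.

Definition cmartingale (M : R -> Omega -> R[i]) :=
  martingale P T F (fun t w => cRe (M t w)) /\
  martingale P T F (fun t w => cIm (M t w)).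

Lemma cmartingale_weight M s t Z : cmartingale M ->
  0 <= s -> s <= t -> t <= T -> cbm (M s) -> cbm (M t) -> cFm s Z -> cbm Z ->
  cint (fun w => Z w * (M t w - M s w)) = 0.
Proof.
move=> [M1 M2] s0 st tT [s1 s2] [t1 t2] [F1 F2] [Z1 Z2].
have w0 N W : martingale P T F N -> bm (N s) -> bm (N t) -> Fm F s W -> bm W ->
    \int[P]_w (W w * (N t w - N s w)) = 0 /\ bm (fun w => W w * (N t w - N s w)).
  move=> hN bs bt hW bW; split; last by apply: bmM => //; exact: bmB.
  by apply: (martingale_weight hF hN) => //; case: bW.
have [e11 b11] := w0 _ _ M1 s1 t1 F1 Z1; have [e12 b12] := w0 _ _ M2 s2 t2 F1 Z1.
have [e21 b21] := w0 _ _ M1 s1 t1 F2 Z2; have [e22 b22] := w0 _ _ M2 s2 t2 F2 Z2.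
apply: eq_ReIm => /=.
  transitivity (\int[P]_w (cRe (Z w) * (cRe (M t w) - cRe (M s w)) -
      cIm (Z w) * (cIm (M t w) - cIm (M s w)))).
    by congr (Rintegral _ _ _); apply/funext => w; rewrite cReM !cReD !cImD !cReN !cImN.
  by rewrite (RintB mT Pfin) // e11 e22 subrr.
transitivity (\int[P]_w (cRe (Z w) * (cIm (M t w) - cIm (M s w)) +
    cIm (Z w) * (cRe (M t w) - cRe (M s w)))).
  by congr (Rintegral _ _ _); apply/funext => w; rewrite cImM !cReD !cImD !cReN !cImN.
by rewrite (RintD mT Pfin) // e12 e21 addr0.
Qed.

Variables (y Ja Jb K M N : R -> Omega -> R[i]) (c L : R).
Hypothesis ME : forall r w, M r w = y r w - y 0 w - Ja r w.
Hypothesis NE : forall r w, N r w = y r w ^+ 2 - y 0 w ^+ 2 - Jb r w.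
Hypotheses (hM : cmartingale M) (hN : cmartingale N).
Hypothesis cM : forall r : R, 0 <= r <= T -> {ae P, forall w, normc (M r w) <= c}.
Hypothesis cy : {ae P, forall w, forall r : R, 0 <= r <= T -> normc (y r w) <= c}.
Hypothesis bmy : forall r : R, 0 <= r <= T -> cbm (y r).
Hypothesis bmJa : forall r : R, 0 <= r <= T -> cbm (Ja r).
Hypothesis bmJb : forall r : R, 0 <= r <= T -> cbm (Jb r).
Hypothesis bmK : forall r : R, 0 <= r <= T -> cbm (K r).
Hypothesis Fy : forall r : R, 0 <= r <= T -> cFm r (y r).
Hypothesis lipJa : {ae P, forall w, forall p q : R, 0 <= p -> p <= q -> q <= T ->
  normc (Ja q w - Ja p w) <= c * (q - p)}.
Hypothesis ucy : {ae P, forall w, forall e : R, 0 < e -> exists2 d : R, 0 < d &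
  forall p q : R, 0 <= p <= T -> 0 <= q <= T -> `|p - q| < d -> normc (y p w - y q w) < e}.
Hypothesis drift : {ae P, forall w, forall p q e : R, 0 <= p -> p <= q -> q <= T ->
  (forall r : R, p <= r <= q -> normc (y r w - y p w) <= e) ->
  normc (cexp (y p w) * ((1 - y p w) * (Ja q w - Ja p w) +
     2^-1 * (Jb q w - Jb p w)) - (K q w - K p w)) <= L * e * (q - p)}.

Hypotheses (c0 : 0 <= c) (L0 : 0 <= L).

Section Partition.
Variables (s t : R) (s0 : 0 <= s) (st : s <= t) (tT : t <= T).
Variables (G : set Omega) (sG : F s G).

Definition mesh n i : R := s + (t - s) * (minn i n.+1)%:R / n.+1%:R.

Lemma mesh0 n : mesh n 0 = s.
Proof. by rewrite /mesh min0n mulr0 mul0r addr0. Qed.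

Lemma meshN n : mesh n n.+1 = t.
Proof. by rewrite /mesh minnn mulfK ?pnatr_eq0 // addrC subrK. Qed.

Lemma mesh_le n i j : (i <= j)%N -> mesh n i <= mesh n j.
Proof.
move=> ij; rewrite /mesh lerD2l ler_wpM2r ?invr_ge0 // ler_wpM2l ?subr_ge0 //.
by rewrite ler_nat; lia.
Qed.

Lemma mesh_ge_s n i : s <= mesh n i.
Proof. by rewrite -{1}(mesh0 n) mesh_le. Qed.

Lemma mesh_le_t n i : mesh n i <= t.
Proof.
rewrite -(meshN n) /mesh lerD2l ler_wpM2r ?invr_ge0 // ler_wpM2l ?subr_ge0 //.
by rewrite ler_nat; lia.
Qed.

Lemma mesh_itv n i : 0 <= mesh n i <= T.
Proof. by rewrite (le_trans s0 (mesh_ge_s n i)) (le_trans (mesh_le_t n i)). Qed.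

Lemma meshS n (i : 'I_n.+1) : mesh n i.+1 - mesh n i = (t - s) / n.+1%:R.
Proof.
have i1 : (minn i.+1 n.+1 = i.+1)%N by have := ltn_ord i; lia.
have i2 : (minn i n.+1 = i)%N by have := ltn_ord i; lia.
by rewrite /mesh i1 i2 -natr1; field; rewrite ?pnatr_eq0 //.
Qed.

Let Y n (j : nat) w := y (mesh n j) w.
Let E n (j : nat) w := cexp (Y n j w).
Let H n (j : nat) w := Y n j.+1 w - Y n j w.
Let inc (J : R -> Omega -> R[i]) n (j : nat) w := J (mesh n j.+1) w - J (mesh n j) w.
(* [Dj] is the drift error and [Rj] the Taylor remainder on the cell [j]. *)
Let Dj n (j : nat) w :=
  E n j w * ((1 - Y n j w) * inc Ja n j w + 2^-1 * inc Jb n j w) - inc K n j w.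
Let Rj n (j : nat) w := E n j w * (cexp (H n j w) - \sum_(k < 3) H n j w ^+ k / (k`!)%:R).
Let Ds n w := \sum_(j < n.+1) Dj n j w.
Let Rs n w := \sum_(j < n.+1) Rj n j w.
Let X w := cexp (y t w) - cexp (y s w) - (K t w - K s w).

(** Second order expansion of the exponential over one cell of the partition.
    The square of an increment is the increment of the square minus twice the
    left value times the increment, so the quadratic term is expressed through
    [N] and [M] as well. *)
Lemma exp_step n j w : E n j.+1 w - E n j w - inc K n j w =
  E n j w * (1 - Y n j w) * inc M n j w + 2^-1 * E n j w * inc N n j w +
  (Dj n j w + Rj n j w).
Proof.
have -> : E n j.+1 w = E n j w * cexp (H n j w).
  by rewrite /E -cexpD /H addrC subrK.
rewrite /Dj /Rj /inc !ME !NE !big_ord_recr big_ord0 /= -/(Y n j w) -/(Y n j.+1 w).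
have -> : Y n j.+1 w = Y n j w + H n j w by rewrite /H addrC subrK.
rewrite !factS fact0 !muln1 expr0 expr1.
by field.
Qed.

Lemma Y_cbm n j : cbm (Y n j). Proof. by apply: bmy; exact: mesh_itv. Qed.
Lemma E_cbm n j : cbm (E n j). Proof. by apply: cbm_exp; exact: Y_cbm. Qed.
Lemma H_cbm n j : cbm (H n j). Proof. by apply: cbmB; exact: Y_cbm. Qed.

Lemma M_cbm r : 0 <= r <= T -> cbm (M r).
Proof.
move=> rT; have h0 : 0 <= (0 : R) <= T by rewrite lexx ltW.
have : cbm (fun w => y r w - y 0 w - Ja r w).
  by apply: cbmB; [apply: cbmB; apply: bmy|apply: bmJa].
by congr cbm; apply/funext => w; rewrite ME.
Qed.

Lemma N_cbm r : 0 <= r <= T -> cbm (N r).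
Proof.
move=> rT; have h0 : 0 <= (0 : R) <= T by rewrite lexx ltW.
have : cbm (fun w => y r w * y r w - y 0 w * y 0 w - Jb r w).
  by apply: cbmB; [apply: cbmB; apply: cbmM; apply: bmy|apply: bmJb].
by congr cbm; apply/funext => w; rewrite NE !expr2.
Qed.

Lemma inc_cbm J n j : (forall r : R, 0 <= r <= T -> cbm (J r)) -> cbm (inc J n j).
Proof. by move=> h; apply: cbmB; apply: h; exact: mesh_itv. Qed.

Lemma Dj_cbm n j : cbm (Dj n j).
Proof.
apply: cbmB; last exact: inc_cbm.
apply: cbmM; first exact: E_cbm.
apply: cbmD; last by apply: cbmZ; exact: inc_cbm.
apply: cbmM; last exact: inc_cbm.
by apply: cbmB; [exact: cbm_cst|exact: Y_cbm].
Qed.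

Lemma cbmX f k : cbm f -> cbm (fun w => f w ^+ k).
Proof.
move=> hf; elim: k => [|k IH]; first exact: cbm_cst.
by under eq_fun do rewrite exprS; exact: cbmM.
Qed.

Lemma Rj_cbm n j : cbm (Rj n j).
Proof.
apply: cbmM; first exact: E_cbm.
apply: cbmB; first by apply: cbm_exp; exact: H_cbm.
apply: cbm_sum => k; apply: cbmM; last exact: cbm_cst.
by apply: cbmX; exact: H_cbm.
Qed.

Let one w : R[i] := (\1_G w)%:C.

Lemma G_meas : measurable G.
Proof. by apply: (F_sub hF) sG; rewrite s0 (le_trans st). Qed.

Lemma one_cbm : cbm one.
Proof. by apply: cbm_real; apply: bm_indic; exact: G_meas. Qed.

(** The martingale increments have mean zero, because their weights are known at
    the left end points of the cells. *)
Lemma exp_sum_mean n :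
  cint (fun w => one w * X w) = cint (fun w => one w * (Ds n w + Rs n w)).
Proof.
have FZ j Z : cFm (mesh n j) Z -> cFm (mesh n j) (fun w => one w * Z w).
  move=> hZ; apply: cmeasM => //; split => /=; last exact: measurable_cst.
  apply: (Fm_indic hF); first exact: mesh_itv.
  apply: (F_mono hF s0 (mesh_ge_s n j) _ sG); exact: le_trans (mesh_le_t n j) tT.
have FY j : cFm (mesh n j) (Y n j) by apply: Fy; exact: mesh_itv.
pose Z1 j w := one w * (E n j w * (1 - Y n j w)).
pose Z2 j w := one w * (2^-1 * E n j w).
have FZ1 j : cFm (mesh n j) (Z1 j).
  apply: FZ; apply: cmeasM; first exact: (cmeas_exp (FY j)).
  apply: cmeasD; first exact: cmeas_cst.
  have : cmeas [set: FT F (mesh n j)] (fun w => -1 * Y n j w).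
    by apply: cmeasM; [exact: cmeas_cst|exact: (FY j)].
  by congr cmeas; apply/funext => w; rewrite mulN1r.
have FZ2 j : cFm (mesh n j) (Z2 j).
  by apply: FZ; apply: cmeasM; [exact: cmeas_cst|exact: (cmeas_exp (FY j))].
have bZ1 j : cbm (Z1 j).
  apply: cbmM; first exact: one_cbm.
  by apply: cbmM; [exact: E_cbm|apply: cbmB; [exact: cbm_cst|exact: Y_cbm]].
have bZ2 j : cbm (Z2 j).
  by apply: cbmM; [exact: one_cbm|apply: cbmZ; exact: E_cbm].
have b1 j : cbm (fun w => Z1 j w * inc M n j w).
  by apply: cbmM => //; apply: inc_cbm; exact: M_cbm.
have b2 j : cbm (fun w => Z2 j w * inc N n j w).
  by apply: cbmM => //; apply: inc_cbm; exact: N_cbm.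
have bDR : cbm (fun w => one w * (Ds n w + Rs n w)).
  apply: cbmM; first exact: one_cbm.
  apply: cbmD; apply: cbm_sum => j; [exact: Dj_cbm|exact: Rj_cbm].
transitivity (cint (fun w => \sum_(j < n.+1) Z1 j w * inc M n j w +
    \sum_(j < n.+1) Z2 j w * inc N n j w + one w * (Ds n w + Rs n w))).
  congr (cint _); apply/funext => w.
  have -> : X w = \sum_(j < n.+1) (E n j.+1 w - E n j w - inc K n j w).
    have tele (f : nat -> R[i]) k : \sum_(j < k) (f j.+1 - f j) = f k - f 0%N.
      elim: k => [|k IH]; first by rewrite big_ord0 subrr.
      by rewrite big_ord_recr /= IH addrC addrA subrK.
    rewrite sumrB (tele (fun j => E n j w)) (tele (fun j => K (mesh n j) w)).
    by rewrite /X /E /Y meshN mesh0.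
  under eq_bigr do rewrite exp_step.
  rewrite mulr_sumr /Ds /Rs -!big_split /= mulr_sumr -big_split /=.
  by apply: eq_bigr => j _; rewrite /Z1 /Z2; ring.
have bs1 : cbm (fun w => \sum_(j < n.+1) Z1 j w * inc M n j w) by exact: cbm_sum.
have bs2 : cbm (fun w => \sum_(j < n.+1) Z2 j w * inc N n j w) by exact: cbm_sum.
rewrite (cintD mT Pfin (cbmD bs1 bs2) bDR) (cintD mT Pfin bs1 bs2).
rewrite !(cint_sum mT Pfin) // !big1 ?add0r // => j _.
  apply: cmartingale_weight => //.
  - by case/andP: (mesh_itv n j).
  - exact: mesh_le.
  - by case/andP: (mesh_itv n j.+1).
  - by apply: N_cbm; exact: mesh_itv.
  - by apply: N_cbm; exact: mesh_itv.
apply: cmartingale_weight => //.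
- by case/andP: (mesh_itv n j).
- exact: mesh_le.
- by case/andP: (mesh_itv n j.+1).
- by apply: M_cbm; exact: mesh_itv.
- by apply: M_cbm; exact: mesh_itv.
Qed.

Lemma bm_norm1 f : cbm f -> bm (fun w => norm1 (f w)).
Proof. by move=> [f1 f2]; apply: bmD; exact: bm_norm. Qed.

Lemma length_le : t - s <= T.
Proof. by rewrite lerBlDr (le_trans tT) // lerDl. Qed.

Lemma mesh_sum n : \sum_(j < n.+1) (mesh n j.+1 - mesh n j) = t - s.
Proof.
have tele k : \sum_(j < k) (mesh n j.+1 - mesh n j) = mesh n k - mesh n 0.
  elim: k => [|k IH]; first by rewrite big_ord0 subrr.
  by rewrite big_ord_recr /= IH addrC addrA subrK.
by rewrite tele meshN mesh0.
Qed.

(** Each cell contributes the oscillation [e] times its length. *)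
Lemma Ds_bound w n e : 0 <= e ->
  (forall p q e : R, 0 <= p -> p <= q -> q <= T ->
    (forall r : R, p <= r <= q -> normc (y r w - y p w) <= e) ->
    normc (cexp (y p w) * ((1 - y p w) * (Ja q w - Ja p w) +
     2^-1 * (Jb q w - Jb p w)) - (K q w - K p w)) <= L * e * (q - p)) ->
  (forall (j : nat) (r : R), (j < n.+1)%N -> mesh n j <= r <= mesh n j.+1 ->
    normc (y r w - y (mesh n j) w) <= e) ->
  norm1 (Ds n w) <= 2 * L * T * e.
Proof.
move=> e0 hd he; apply: le_trans (norm1_le _) _.
apply: le_trans (_ : 2 * (\sum_(j < n.+1) L * e * (mesh n j.+1 - mesh n j)) <= _).
  rewrite ler_pM2l //; apply: le_trans (normc_sum _ _ _) _; apply: ler_sum => j _.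
  apply: hd.
  - by case/andP: (mesh_itv n j).
  - exact: mesh_le.
  - by case/andP: (mesh_itv n j.+1).
  - by move=> r hr; apply: he.
rewrite -mulr_sumr mesh_sum.
have h1 : 0 <= L * e by exact: mulr_ge0.
have h2 := length_le.
by have := ler_wpM2l h1 h2; nra.
Qed.

Lemma mesh_small (d : R) : 0 < d -> \forall n \near \oo,
  forall j, (j < n.+1)%N -> mesh n j.+1 - mesh n j < d.
Proof.
move=> d0.
have hl : (fun n => (t - s) / n.+1%:R) @ \oo --> (0 : R).
  rewrite -(mulr0 (t - s)); apply: cvgM; first exact: cvg_cst.
  exact: cvg_harmonic.
move/cvgrPdist_lt : hl => /(_ d d0); apply: filterS => n hn j jn.
rewrite (meshS (Ordinal jn)); apply: le_lt_trans hn.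
by rewrite sub0r normrN ler_norm.
Qed.

(** The oscillation of a continuous path over the cells tends to zero with the
    mesh, and it is bounded, so the limit can be taken under the integral. *)
Lemma Ds_mean : \int[P]_w norm1 (Ds n w) @[n --> \oo] --> (0 : R).
Proof.
have Dcbm n : cbm (Ds n) by apply: cbm_sum => j; exact: Dj_cbm.
have [] := @Rint_bdd_cvg _ _ R P setT mT Pfin (fun n w => norm1 (Ds n w)) (fun=> 0)
  (2 * L * T * (2 * c)).
- by move=> n; apply: bm_meas; exact: bm_norm1.
- exact: measurable_cst.
- apply: filterS2 drift cy => w hd hc _ n; rewrite ger0_norm ?norm1_ge0 //.
  apply: (Ds_bound _ hd); first by rewrite mulr_ge0.
  move=> j r jn /andP[r1 r2]; apply: le_trans (normcB _ _) _.
  rewrite mulr2n mulrDl mul1r; apply: lerD; apply: hc; last exact: mesh_itv.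
  have /andP[a1 a2] := mesh_itv n j; have /andP[b1 b2] := mesh_itv n j.+1; lra.
- apply: filterS2 drift ucy => w hd hu _; apply/cvgrPdist_le => e e0.
  have LT0 : 0 < 2 * L * T + 1 by rewrite ltr_wpDl // !mulr_ge0 // ltW.
  have [d d0 hd'] := hu (e / (2 * L * T + 1)) (divr_gt0 e0 LT0).
  apply: filterS (mesh_small d0) => n hn.
  rewrite sub0r normrN ger0_norm ?norm1_ge0 //.
  apply: le_trans (Ds_bound (e := e / (2 * L * T + 1)) _ hd _) _.
  + by rewrite ltW // divr_gt0.
  + move=> j r jn /andP[r1 r2]; rewrite ltW //; apply: hd'.
    * have /andP[a1 a2] := mesh_itv n j; have /andP[b1 b2] := mesh_itv n j.+1; lra.
    * exact: mesh_itv.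
    * rewrite ger0_norm ?subr_ge0 //; apply: le_lt_trans (hn j jn).
      by rewrite lerD2r.
  + by rewrite mulrA ler_pdivrMr // mulrC ler_wpM2l ?(ltW e0) // lerDl.
by move=> _; rewrite Rintegral_cst // mul0r.
Qed.

Let Q n w := sqsum (fun t w => cRe (M t w)) (mesh n) n.+1 w +
  sqsum (fun t w => cIm (M t w)) (mesh n) n.+1 w.
Let o n w := \big[Num.max/0]_(j < n.+1) norm1 (H n j w).

Lemma o_ge0 n w : 0 <= o n w.
Proof.
rewrite /o; apply: (big_ind (fun x : R => 0 <= x)) => // [a b a0 _|j _].
  by rewrite le_max a0.
exact: norm1_ge0.
Qed.

Lemma o_ge n (j : 'I_n.+1) w : norm1 (H n j w) <= o n w.
Proof. exact: (le_bigmax _ (fun j : 'I_n.+1 => norm1 (H n j w))). Qed.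

Lemma o_le n w e : 0 <= e -> (forall j : 'I_n.+1, norm1 (H n j w) <= e) -> o n w <= e.
Proof. by move=> e0 h; rewrite /o; apply/bigmax_leP; split=> // j _; exact: h. Qed.

Lemma o_bm n : bm (o n).
Proof.
rewrite /o; elim: (index_enum _) => [|j r IH].
  by under eq_fun do rewrite big_nil; exact: bm_cst.
under eq_fun do rewrite big_cons; apply: bm_max => //.
by apply: bm_norm1; exact: H_cbm.
Qed.

Lemma o_sqr_mean : \int[P]_w (o n w ^+ 2) @[n --> \oo] --> (0 : R).
Proof.
have [] := @Rint_bdd_cvg _ _ R P setT mT Pfin (fun n w => o n w ^+ 2) (fun=> 0)
  ((4 * c) ^+ 2).
- by move=> n; apply: bm_meas; apply: bm_sqr; exact: o_bm.
- exact: measurable_cst.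
- apply: filterS cy => w hc _ n; rewrite ger0_norm ?sqr_ge0 //.
  rewrite ler_pXn2r ?nnegrE ?o_ge0 ?mulr_ge0 //; apply: o_le; first by rewrite mulr_ge0.
  move=> j; apply: le_trans (norm1_le _) _.
  have := hc _ (mesh_itv n j); have := hc _ (mesh_itv n j.+1).
  have := normcB (Y n j.+1 w) (Y n j w); rewrite /H /Y; lra.
- apply: filterS ucy => w hu _; apply/cvgrPdist_le => e e0.
  pose e1 := Num.min 1 e; have e10 : 0 < e1 by rewrite lt_min ltr01.
  have [d d0 hd] := hu (e1 / 2) (divr_gt0 e10 (ltr0Sn _ _)).
  apply: filterS (mesh_small d0) => n hn.
  rewrite sub0r normrN ger0_norm ?sqr_ge0 //.
  have oe : o n w <= e1.
    apply: o_le; first exact: ltW.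
    move=> j; apply: le_trans (norm1_le _) _.
    have : normc (H n j w) < e1 / 2.
      apply: hd; [exact: mesh_itv|exact: mesh_itv|].
      by rewrite ger0_norm ?subr_ge0 ?mesh_le // hn.
    lra.
  have : e1 <= 1 /\ e1 <= e by rewrite !ge_min !lexx orbT.
  have := o_ge0 n w; move=> o0 [h1 h2]; rewrite expr2; nra.
by move=> _; rewrite Rintegral_cst // mul0r.
Qed.

Let C3 := expR c * expR (2 * c).
Let c' := 2 * c ^+ 2 * T ^+ 2.

(** The cubic remainder is at most the largest increment times the sum of
    squared increments, and the latter are squared increments of [M] up to a
    Lipschitz correction. *)
Lemma Rs_bound n : {ae P, forall w,
  normc (Rs n w) <= C3 * (o n w * (2 * Q n w + c'))}.
Proof.
apply: filterS2 cy lipJa => w hc hl.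
have hY j : normc (Y n j w) <= c by apply: hc; exact: mesh_itv.
have hH j : normc (H n j w) <= 2 * c.
  by apply: le_trans (normcB _ _) _; have := hY j; have := hY j.+1; lra.
pose del j := mesh n j.+1 - mesh n j.
have del0 j : 0 <= del j by rewrite subr_ge0 mesh_le.
have delT j : del j <= T.
  have /andP[a1 a2] := mesh_itv n j; have /andP[b1 b2] := mesh_itv n j.+1.
  rewrite /del; lra.
have sqH j : normc (H n j w) ^+ 2 <= 2 * normc (inc M n j w) ^+ 2 + 2 * (c ^+ 2 * T * del j).
  have HE : H n j w = inc M n j w + inc Ja n j w by rewrite /H /inc !ME /Y; ring.
  have h1 : normc (H n j w) <= normc (inc M n j w) + normc (inc Ja n j w).
    by rewrite HE normcD.
  have h2 : normc (inc Ja n j w) <= c * del j.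
    by apply: hl; [case/andP: (mesh_itv n j)|exact: mesh_le|case/andP: (mesh_itv n j.+1)].
  have h3 : (c * del j) ^+ 2 <= c ^+ 2 * T * del j.
    rewrite exprMn -mulrA ler_wpM2l ?sqr_ge0 // expr2 ler_wpM2r //.
  have p1 := normc_ge0 (H n j w); have p2 := normc_ge0 (inc M n j w).
  have p3 := normc_ge0 (inc Ja n j w); have p4 := mulr_ge0 c0 (del0 j).
  set a := normc (H n j w) in h1 p1 *; set b := normc (inc M n j w) in h1 p2 *.
  set x := normc (inc Ja n j w) in h1 h2 p3.
  have a2 : a ^+ 2 <= (b + c * del j) ^+ 2 by rewrite ler_pXn2r ?nnegrE ?addr_ge0 //; lra.
  have := sqr_ge0 (b - c * del j); nra.
apply: le_trans (normc_sum _ _ _) _.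
apply: le_trans (_ : \sum_(j < n.+1) C3 * (o n w * normc (H n j w) ^+ 2) <= _).
  apply: ler_sum => j _; rewrite /Rj normcM /C3 -mulrA; apply: ler_pM.
  - exact: normc_ge0.
  - exact: normc_ge0.
  - by apply: le_trans (normc_cexp _) _; rewrite ler_expR.
  apply: le_trans (cexp_remainder _ _) _.
  rewrite mulrC; apply: ler_pM; [exact: expR_ge0|by rewrite exprn_ge0 ?normc_ge0|by rewrite ler_expR|].
  rewrite exprS ler_wpM2r ?sqr_ge0 //.
  exact: (le_trans (normc_le_norm1 _) (o_ge j w)).
rewrite -mulr_sumr; apply: ler_wpM2l; last first.
- rewrite -mulr_sumr ler_wpM2l ?o_ge0 //.
  apply: le_trans (_ : \sum_(j < n.+1) (2 * normc (inc M n j w) ^+ 2 +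
      2 * (c ^+ 2 * T * del j)) <= _).
    by apply: ler_sum => j _; exact: sqH.
  rewrite big_split /= -!mulr_sumr mesh_sum.
  have -> : \sum_(j < n.+1) normc (inc M n j w) ^+ 2 = Q n w.
    rewrite /Q /sqsum -big_split; apply: eq_bigr => j _.
    by rewrite normc_sqr cReD cImD cReN cImN.
  rewrite lerD2l /c'; have h := length_le.
  have := ler_wpM2l (mulr_ge0 (sqr_ge0 c) (ltW T0)) h.
  rewrite expr2; lra.
- by rewrite mulr_ge0 ?expR_ge0.
Qed.

(* The real and the imaginary part contribute [12 * (6 * c ^+ 4)] each. *)
Let W := 144 * c ^+ 4 + 3 * c' ^+ 2.

Lemma sq_bm (f : R -> Omega -> R) n : (forall r : R, 0 <= r <= T -> bm (f r)) ->
  bm (sqsum f (mesh n) n.+1).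
Proof.
move=> h; apply: bm_sum => j; apply: bm_sqr; apply: bmB; apply: h; exact: mesh_itv.
Qed.

Lemma Q_bm n : bm (Q n).
Proof. by apply: bmD; apply: sq_bm => r /M_cbm[]. Qed.

(** Young's inequality with parameter [e] separates the largest increment, whose
    mean square vanishes, from the squared increments, whose second moments do
    not depend on the partition. *)
Lemma oQ_mean n e : 0 < e ->
  \int[P]_w (o n w * (2 * Q n w + c')) <= e * W + e^-1 * \int[P]_w (o n w ^+ 2).
Proof.
move=> e0.
set S1 := sqsum (fun t w => cRe (M t w)) (mesh n) n.+1.
set S2 := sqsum (fun t w => cIm (M t w)) (mesh n) n.+1.
have b1 : bm S1 by apply: sq_bm => r /M_cbm[].
have b2 : bm S2 by apply: sq_bm => r /M_cbm[].
have mT' j : mesh n j <= T by case/andP: (mesh_itv n j).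
have m0 : 0 <= mesh n 0 by case/andP: (mesh_itv n 0).
have mS j : mesh n j <= mesh n j.+1 by exact: mesh_le.
have q1 : \int[P]_w (S1 w ^+ 2) <= 6 * c ^+ 4.
  apply: (sqsum_sqr_mean_le hF hM.1 _ m0 mS mT') => r rT.
  by apply: filterS (cM rT) => w h; exact: le_trans (normr_Re _) h.
have q2 : \int[P]_w (S2 w ^+ 2) <= 6 * c ^+ 4.
  apply: (sqsum_sqr_mean_le hF hM.2 _ m0 mS mT') => r rT.
  by apply: filterS (cM rT) => w h; exact: le_trans (normr_Im _) h.
have bo := bm_sqr (o_bm n); have bq1 := bm_sqr b1; have bq2 := bm_sqr b2.
apply: le_trans (_ : \int[P]_w (12 * e * S1 w ^+ 2 + 12 * e * S2 w ^+ 2 +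
    e * (3 * c' ^+ 2) + e^-1 * o n w ^+ 2) <= _).
  apply: (Rint_ae_le mT Pfin).
  - apply: bmM; first exact: o_bm.
    by apply: bmD; [apply: bmZ; exact: Q_bm|exact: bm_cst].
  - by do !apply: bmD; do ?[exact: bmZ|exact: bm_cst].
  - apply: aeW => w _; rewrite /Q -/S1 -/S2.
    (* Young's inequality, from the square of a difference. *)
    have h1 : 0 <= e * (2 * (S1 w + S2 w) + c' - e^-1 * o n w) ^+ 2.
      by rewrite mulr_ge0 ?sqr_ge0 // ltW.
    have h1' : e * (2 * (S1 w + S2 w) + c' - e^-1 * o n w) ^+ 2 =
        e * (2 * (S1 w + S2 w) + c') ^+ 2 - 2 * (o n w * (2 * (S1 w + S2 w) + c'))
        + e^-1 * o n w ^+ 2.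
      by field; rewrite gt_eqF.
    have h2 : (2 * (S1 w + S2 w) + c') ^+ 2 <= 12 * S1 w ^+ 2 + 12 * S2 w ^+ 2 + 3 * c' ^+ 2.
      have := sqr_ge0 (2 * S1 w - 2 * S2 w); have := sqr_ge0 (2 * S1 w - c').
      have := sqr_ge0 (2 * S2 w - c'); nra.
    have := ler_wpM2l (ltW e0) h2.
    have h3 : 0 <= e * (2 * (S1 w + S2 w) + c') ^+ 2 by rewrite mulr_ge0 ?sqr_ge0 // ltW.
    have h4 : 0 <= e^-1 * o n w ^+ 2 by rewrite mulr_ge0 ?sqr_ge0 // invr_ge0 ltW.
    lra.
rewrite (RintD mT Pfin); last 2 first.
  by do !apply: bmD; do ?[exact: bmZ|exact: bm_cst].
  exact: bmZ.
rewrite (RintD mT Pfin); last 2 first.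
  by do !apply: bmD; exact: bmZ.
  exact: bm_cst.
rewrite Rint_cst (RintD mT Pfin (bmZ _ bq1) (bmZ _ bq2)) !(RintZ mT Pfin) //.
rewrite lerD2r /W.
have h1 := ler_wpM2l (mulr_ge0 (ler0n R 12) (ltW e0)) q1.
have h2 := ler_wpM2l (mulr_ge0 (ler0n R 12) (ltW e0)) q2.
lra.
Qed.

(** The left-hand side does not involve the partition. Refining the partition
    for a fixed parameter of Young's inequality, and then letting the parameter
    tend to zero, bounds it by zero. *)
Lemma ito_increment : cint (fun w => one w * X w) = 0.
Proof.
have bDR n : cbm (fun w => Ds n w + Rs n w).
  by apply: cbmD; apply: cbm_sum => j; [exact: Dj_cbm|exact: Rj_cbm].
have boQ n : bm (fun w => o n w * (2 * Q n w + c')).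
  apply: bmM; first exact: o_bm.
  by apply: bmD; [apply: bmZ; exact: Q_bm|exact: bm_cst].
have bD1 n : bm (fun w => norm1 (Ds n w)).
  by apply: bm_norm1; apply: cbm_sum => j; exact: Dj_cbm.
have C30 : 0 <= C3 by rewrite mulr_ge0 ?expR_ge0.
have bound n e : 0 < e -> normc (cint (fun w => one w * X w)) <=
    2 * (\int[P]_w norm1 (Ds n w) +
      C3 * (e * W + e^-1 * \int[P]_w (o n w ^+ 2))).
  move=> e0; rewrite (exp_sum_mean n).
  apply: le_trans (normc_cint mT Pfin (g := fun w => norm1 (Ds n w) +
    C3 * (o n w * (2 * Q n w + c'))) _ _ _) _.
  - by apply: cbmM; [exact: one_cbm|exact: bDR].
  - by apply: bmD => //; exact: bmZ.
  - apply: filterS (Rs_bound n) => w h _; rewrite normcM.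
    have -> : normc (one w) = \1_G w by rewrite normc_real ger0_norm // indicE.
    apply: le_trans (_ : normc (Ds n w + Rs n w) <= _).
      by rewrite ler_piMl ?normc_ge0 // indicE; case: (w \in G).
    by apply: le_trans (normcD _ _) _; rewrite lerD ?normc_le_norm1.
  rewrite ler_pM2l // (RintD mT Pfin (bD1 n) (bmZ _ (boQ n))) lerD2l.
  by rewrite (RintZ mT Pfin) // ler_wpM2l //; exact: oQ_mean.
have W0 : 0 <= W.
  by apply: addr_ge0; apply: mulr_ge0 => //; [exact: exprn_ge0|exact: sqr_ge0].
apply: ComplexField.Normc.eq0_normc; apply/eqP; rewrite eq_le normc_ge0 andbT.
apply/ler_addgt0Pr => e e0; rewrite add0r.
have h0 : 0 < 2 * C3 * W + 1 by rewrite ltr_wpDl // !mulr_ge0.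
(* The denominator is positive even when [C3 * W] vanishes. *)
pose e1 := e / (2 * C3 * W + 1).
have e10 : 0 < e1 by exact: divr_gt0.
have lim : (fun n => 2 * (\int[P]_w norm1 (Ds n w) +
      C3 * (e1 * W + e1^-1 * \int[P]_w (o n w ^+ 2)))) @ \oo -->
    2 * (0 + C3 * (e1 * W + e1^-1 * 0)).
  apply: cvgM; first exact: cvg_cst.
  apply: cvgD; first exact: Ds_mean.
  apply: cvgM; first exact: cvg_cst.
  apply: cvgD; first exact: cvg_cst.
  by apply: cvgM; [exact: cvg_cst|exact: o_sqr_mean].
have : normc (cint (fun w => one w * X w)) <= 2 * (0 + C3 * (e1 * W + e1^-1 * 0)).
  rewrite -(cvg_lim _ lim) //; apply: limr_ge; first exact: cvgP lim.
  by apply: nearW => n; exact: bound.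
move=> h; apply: le_trans h _; rewrite mulr0 addr0 add0r.
have -> : 2 * (C3 * (e1 * W)) = e * ((2 * C3 * W) / (2 * C3 * W + 1)).
  by rewrite /e1; field; rewrite gt_eqF.
by rewrite ler_piMr ?(ltW e0) // ler_pdivrMr // mul1r lerDl.
Qed.

End Partition.
End Ito.

(** * Complex cadlag paths *)

Section ComplexPaths.
Variables (R : realType) (T : R).
Implicit Types (f g : R -> R[i]) (p q t : R).
Local Notation lam := (@lebesgue_measure R).

Definition ccadlag f := cadlag_path T (fun t => cRe (f t)) /\
  cadlag_path T (fun t => cIm (f t)).

Lemma ccadlag_cst z : ccadlag (fun=> z). Proof. by split; exact: cadlag_cst. Qed.

Lemma ccadlagD f g : ccadlag f -> ccadlag g -> ccadlag (fun t => f t + g t).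
Proof.
move=> [f1 f2] [g1 g2]; split.
  by under eq_fun do rewrite cReD; exact: cadlagD.
by under eq_fun do rewrite cImD; exact: cadlagD.
Qed.

Lemma ccadlagM f g : ccadlag f -> ccadlag g -> ccadlag (fun t => f t * g t).
Proof.
move=> [f1 f2] [g1 g2]; split.
  by under eq_fun do rewrite cReM; apply: cadlagB; exact: cadlagM.
by under eq_fun do rewrite cImM; apply: cadlagD; exact: cadlagM.
Qed.

Lemma ccadlagB f g : ccadlag f -> ccadlag g -> ccadlag (fun t => f t - g t).
Proof.
move=> hf hg; have := ccadlagD hf (ccadlagM (ccadlag_cst (-1)) hg).
by congr ccadlag; apply/funext => t; rewrite mulN1r.
Qed.

Lemma ccadlag_sum (I : Type) (r : seq I) (f : I -> R -> R[i]) :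
  (forall i, ccadlag (f i)) -> ccadlag (fun t => \sum_(i <- r) f i t).
Proof.
move=> h; elim: r => [|i r IH].
  by under eq_fun do rewrite big_nil; exact: ccadlag_cst.
by under eq_fun do rewrite big_cons; exact: ccadlagD.
Qed.

Lemma ccadlag_exp f : ccadlag f -> ccadlag (fun t => cexp (f t)).
Proof.
move=> [f1 f2]; split => /=; apply: cadlagM.
- exact: (cadlag_comp (@continuous_expR R) f1).
- exact: (cadlag_comp (@continuous_cos R) f2).
- exact: (cadlag_comp (@continuous_expR R) f1).
- exact: (cadlag_comp (@continuous_sin R) f2).
Qed.


Lemma ctime_cadlag f : ccadlag f -> ccadlag (ctime_integral f).
Proof. by move=> [f1 f2]; split => /=; exact: integral_cadlag. Qed.

Lemma ctime0 f : ctime_integral f 0 = 0.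
Proof. by rewrite /ctime_integral set_itv1 !Rintegral_set1. Qed.

Lemma itv_oc_fin p q : (lam `]p, q] < +oo)%E.
Proof. by rewrite lebesgue_measure_itv /=; case: ifP => _; rewrite ?ltry // -EFinD ltry. Qed.

Lemma ccadlag_cbm f p q : ccadlag f -> 0 <= p -> q <= T -> cbm lam `]p, q] f.
Proof.
move=> [f1 f2] p0 qT.
have sub : `]p, q]%classic `<=` `[0, q]%classic.
  by apply: subset_itv; rewrite bnd_simp.
by split; [exact: (cadlag_bm_sub f1 qT sub)|exact: (cadlag_bm_sub f2 qT sub)].
Qed.

Lemma ctime_diff f p q : ccadlag f -> 0 <= p -> p <= q -> q <= T ->
  ctime_integral f q - ctime_integral f p = cint lam `]p, q] f.
Proof.
move=> [f1 f2] p0 pq qT; apply: eq_ReIm; rewrite ?cReD ?cImD ?cReN ?cImN /=.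
  by rewrite (Rint_itv_split f1 (lexx 0) p0 pq qT) addrC addKr.
by rewrite (Rint_itv_split f2 (lexx 0) p0 pq qT) addrC addKr.
Qed.

Lemma cint_le_length f C p q : ccadlag f -> 0 <= p -> p <= q -> q <= T ->
  (forall r, p <= r < q -> normc (f r) <= C) ->
  normc (cint lam `]p, q] f) <= 2 * C * (q - p).
Proof.
move=> [f1 f2] p0 pq qT hC; apply: le_trans (normc_le_ReIm _) _ => /=.
rewrite -mulrA mulr2n mulrDl mul1r; apply: lerD.
  apply: (Rint_le_length false f1 p0 pq qT) => r hr.
  exact: le_trans (normr_Re _) (hC r hr).
apply: (Rint_le_length false f2 p0 pq qT) => r hr.
exact: le_trans (normr_Im _) (hC r hr).
Qed.

Lemma ctime_lin (I : Type) (r : seq I) (a : I -> R[i]) (f : I -> R -> R[i]) t :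
  (forall i, ccadlag (f i)) -> 0 <= t <= T ->
  ctime_integral (fun s => \sum_(i <- r) a i * f i s) t =
  \sum_(i <- r) a i * ctime_integral (f i) t.
Proof.
move=> hf /andP[t0 tT].
have E g : ccadlag g -> ctime_integral g t = cint lam `]0, t] g.
  by move=> hg; rewrite -ctime_diff // ctime0 subr0.
have mI : measurable (`]0, t]%classic : set R) by exact: measurable_itv.
rewrite E; last first.
  by apply: ccadlag_sum => i; apply: ccadlagM => //; exact: ccadlag_cst.
rewrite (@cint_sum _ _ _ lam _ mI (itv_oc_fin 0 t)) => [|i].
  apply: eq_bigr => i _; rewrite E // (@cintZ _ _ _ lam _ mI (itv_oc_fin 0 t)) //.
  exact: ccadlag_cbm.
by apply: cbmZ; exact: ccadlag_cbm.
Qed.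

End ComplexPaths.

(** * One exponential up to a stopping time *)

Lemma cexp_lip {R : realType} (a b : R[i]) (c e : R) :
  normc a <= c -> normc b <= c -> normc (b - a) <= e ->
  normc (cexp b - cexp a) <= expR (3 * c) * e.
Proof.
move=> ha hb he.
have c0 : 0 <= c := le_trans (normc_ge0 a) ha.
have -> : cexp b - cexp a = cexp a * (cexp (b - a) - 1).
  by rewrite mulrBr mulr1 -cexpD [a + _]addrC subrK.
have h1 := cexp_remainder (b - a) 1.
have E : \sum_(j < 1) (b - a) ^+ j / (j`!)%:R = 1 by rewrite big_ord1 expr0 fact0 divr1.
rewrite E expr1 in h1.
have hba : normc (b - a) <= 2 * c by have := normcB b a; lra.
rewrite normcM.
have -> : expR (3 * c) * e = expR c * (e * expR (2 * c)).
  by rewrite mulrCA -expRD mulrC; congr (_ * expR _); ring.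
apply: ler_pM; [exact: normc_ge0|exact: normc_ge0| |].
  by apply: le_trans (normc_cexp _) _; rewrite ler_expR.
apply: le_trans h1 _; apply: ler_pM; [exact: normc_ge0|exact: expR_ge0|by []|].
by rewrite ler_expR.
Qed.

(** The two drift coefficients agree when [a = b]; freezing the argument of the
    exponential at [a] costs a multiple of the distance from [a] to [b]. *)
Lemma drift_lip {R : realType} (a b x y : R[i]) (c k e : R) :
  normc a <= c -> normc b <= c -> normc (b - a) <= e ->
  normc x <= k -> normc y <= k ->
  normc (cexp a * ((1 - a) * x + 2^-1 * y) - cexp b * (x + 2^-1 * y - b * x)) <=
    k * (expR (3 * c) * (2 + c) + expR c) * e.
Proof.
move=> ha hb he hx hy.
have c0 : 0 <= c := le_trans (normc_ge0 a) ha.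
have k0 : 0 <= k := le_trans (normc_ge0 x) hx.
have e0 : 0 <= e := le_trans (normc_ge0 _) he.
have hl := cexp_lip ha hb he.
have -> : cexp a * ((1 - a) * x + 2^-1 * y) - cexp b * (x + 2^-1 * y - b * x) =
    - ((cexp b - cexp a) * ((1 - a) * x + 2^-1 * y) - cexp b * (b - a) * x).
  by field.
rewrite normcN; apply: le_trans (normcB _ _) _; rewrite !normcM.
have h1 : normc ((1 - a) * x + 2^-1 * y) <= (2 + c) * k.
  apply: le_trans (normcD _ _) _; rewrite !normcM normcV normc_nat.
  have h2 : normc (1 - a) <= 1 + c.
    by apply: le_trans (normcB _ _) _; rewrite normc1 lerD2l.
  have h3 : normc (1 - a) * normc x <= (1 + c) * k.
    by apply: ler_pM => //; exact: normc_ge0.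
  have := normc_ge0 y; lra.
have h4 : normc (cexp b) <= expR c.
  by apply: le_trans (normc_cexp _) _; rewrite ler_expR.
have h5 : normc (cexp b - cexp a) * normc ((1 - a) * x + 2^-1 * y) <=
    expR (3 * c) * e * ((2 + c) * k).
  by apply: ler_pM => //; exact: normc_ge0.
have h6 : normc (cexp b) * normc (b - a) * normc x <= expR c * e * k.
  apply: ler_pM => //; rewrite ?mulr_ge0 ?normc_ge0 //.
  by apply: ler_pM => //; exact: normc_ge0.
lra.
Qed.

(** Before the stopping time [rho] the processes [y], [A] and [B] are bounded by
    [k], so all stopped processes are bounded and the hypotheses of the previous
    part can be verified for them. *)
Section OneExponential.
Context {R : realType} {dO : measure_display} {Omega : measurableType dO}.
Variables (P : probability Omega R) (T : R) (F : R -> set (set Omega)).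
Hypotheses (T0 : 0 < T) (hF : right_continuous_filtration T F).
Variables (y A B : R -> Omega -> R[i]).
Hypotheses (cy : forall w, ccadlag T (y^~ w)) (cA : forall w, ccadlag T (A^~ w))
  (cB : forall w, ccadlag T (B^~ w)).
Hypotheses (Fy : forall t : R, 0 <= t <= T -> cFm F t (y t))
  (FA : forall t : R, 0 <= t <= T -> cFm F t (A t))
  (FB : forall t : R, 0 <= t <= T -> cFm F t (B t)).
Hypothesis lM : complex_proc (local_martingale P T F)
  (fun t w => y t w - y 0 w - ctime_integral (A^~ w) t).
Hypothesis lN : complex_proc (local_martingale P T F)
  (fun t w => y t w ^+ 2 - y 0 w ^+ 2 - ctime_integral (B^~ w) t).
Hypothesis ycont : {ae P, forall w,
  {within `[0, T], continuous (fun t => cRe (y t w))} /\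
  {within `[0, T], continuous (fun t => cIm (y t w))}}.
Variables (x0 : R[i]) (k : R) (rho : Omega -> R).
Hypothesis y0 : {ae P, forall w, y 0 w = x0}.
Hypothesis hrho : stopping_time T F rho.
Hypothesis hk : forall w s, 0 <= s -> s < rho w ->
  [/\ normc (y s w) <= k, normc (A s w) <= k & normc (B s w) <= k].
Hypothesis k0 : 0 <= k.

Let g s w := cexp (y s w) * (A s w + 2^-1 * B s w - y s w * A s w).
Let cst_stop (Z : R -> Omega -> R[i]) : R -> Omega -> R[i] :=
  fun t w => Z (Num.min t (rho w)) w.
Let c0 := k + normc x0.
Let c := 2 * c0 + 2 * k * T + 2 * k.

Lemma c0_ge0 : 0 <= c0. Proof. by rewrite addr_ge0 ?normc_ge0. Qed.
Lemma k_c0 : k <= c0. Proof. by rewrite lerDl normc_ge0. Qed.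
Lemma c0_c : c0 <= c.
Proof.
have := c0_ge0; have : 0 <= k * T by rewrite mulr_ge0 // ltW.
rewrite /c; move: k0; lra.
Qed.
Lemma c_ge0' : 0 <= c. Proof. exact: le_trans c0_ge0 c0_c. Qed.

Lemma rho_itv w : 0 <= rho w <= T. Proof. by have [h _] := hrho. Qed.

Lemma min_itv (t : R) w : 0 <= t <= T -> 0 <= Num.min t (rho w) <= T.
Proof.
move=> /andP[t0 tT]; have /andP[r0 rT] := rho_itv w.
by rewrite le_min t0 r0 ge_min tT.
Qed.

Lemma min_le2 (p q : R) w : p <= q -> Num.min p (rho w) <= Num.min q (rho w).
Proof. by move=> pq; rewrite le_min !ge_min pq lexx orbT. Qed.

Lemma min_sub (p q : R) w : p <= q -> Num.min q (rho w) - Num.min p (rho w) <= q - p.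
Proof. by move=> pq; case: (leP p (rho w)); case: (leP q (rho w)) => *; lra. Qed.

Lemma cg w : ccadlag T (g^~ w).
Proof.
apply: ccadlagM; first by apply: ccadlag_exp; exact: cy.
apply: ccadlagB; last by apply: ccadlagM; [exact: cy|exact: cA].
apply: ccadlagD; first exact: cA.
by apply: ccadlagM; [exact: ccadlag_cst|exact: cB].
Qed.

Lemma ctime_stop_le (f : R -> Omega -> R[i]) C w (p q : R) :
  (forall w, ccadlag T (f^~ w)) ->
  (forall s, 0 <= s -> s < rho w -> normc (f s w) <= C) -> 0 <= C ->
  0 <= p -> p <= q -> q <= T ->
  normc (ctime_integral (f^~ w) (Num.min q (rho w)) -
    ctime_integral (f^~ w) (Num.min p (rho w))) <= 2 * C * (q - p).
Proof.
move=> cf hC C0 p0 pq qT.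
have pT : 0 <= p <= T by rewrite p0 (le_trans pq).
have qT' : 0 <= q <= T by rewrite qT (le_trans p0).
have /andP[p'0 p'T] := min_itv w pT; have /andP[q'0 q'T] := min_itv w qT'.
rewrite (ctime_diff (cf w) p'0 (min_le2 w pq) q'T).
apply: le_trans (cint_le_length (C := C) (cf w) p'0 (min_le2 w pq) q'T _) _.
  move=> r /andP[pr rq]; apply: hC; first exact: le_trans pr.
  by apply: lt_le_trans rq _; rewrite ge_min lexx orbT.
by apply: ler_wpM2l; [rewrite mulr_ge0|exact: min_sub].
Qed.

Lemma g_bound w s : 0 <= s -> s < rho w ->
  normc (g s w) <= expR k * (k + 2^-1 * k + k * k).
Proof.
move=> s0 sr; have [h1 h2 h3] := hk s0 sr; rewrite /g normcM.
apply: ler_pM; [exact: normc_ge0|exact: normc_ge0| |].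
  by apply: le_trans (normc_cexp _) _; rewrite ler_expR.
apply: le_trans (normcB _ _) _; apply: lerD; last first.
  by rewrite normcM ler_pM ?normc_ge0.
apply: le_trans (normcD _ _) _; apply: lerD => //.
by rewrite normcM normcV normc_nat ler_wpM2l ?invr_ge0.
Qed.

Lemma y_uniform : {ae P, forall w, forall e : R, 0 < e -> exists2 d : R, 0 < d &
  forall p q : R, 0 <= p <= T -> 0 <= q <= T -> `|p - q| < d -> normc (y p w - y q w) < e}.
Proof.
apply: filterS ycont => w [h1 h2] e e0.
have e2 : 0 < e / 2 by rewrite divr_gt0.
have [d1 d10 hd1] := continuous_uniform h1 e2.
have [d2 d20 hd2] := continuous_uniform h2 e2.
exists (Num.min d1 d2); first by rewrite lt_min d10.
move=> p q pT qT; rewrite lt_min => /andP[pq1 pq2].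
apply: le_lt_trans (normc_le_ReIm _) _; rewrite cReD cImD cReN cImN [e]splitr.
by apply: ltrD; [exact: hd1|exact: hd2].
Qed.

(** Up to and including the stopping time: at the stopping time itself the
    bound is inherited from the left by continuity, or from the initial value
    if the process stops at once. *)
Lemma y_stop_bound : {ae P, forall w, forall t : R, 0 <= t <= T ->
  normc (cst_stop y t w) <= c0}.
Proof.
apply: filterS2 y_uniform y0 => w hu hy0 t tT; rewrite /cst_stop.
have hb s : 0 <= s -> s < rho w -> normc (y s w) <= c0.
  by move=> s0 /(hk s0)[h _ _]; exact: le_trans h k_c0.
case: (ltP t (rho w)) => tr; first by rewrite hb //; case/andP: tT.
have /andP[r0 rT] := rho_itv w.
case: (eqVneq (rho w) 0) => [->|rn0]; first by rewrite hy0 lerDr.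
have rp : 0 < rho w by rewrite lt_neqAle eq_sym rn0.
apply/ler_addgt0Pr => e e0; have [d d0 hd] := hu e e0.
(* A time just before the stopping time, kept nonnegative. *)
pose s := Num.max 0 (rho w - d / 2).
have s0 : 0 <= s by rewrite le_max lexx.
have sr : s < rho w by rewrite gt_max rp /=; lra.
have sd : rho w - d / 2 <= s by rewrite le_max lexx orbT.
have := hd (rho w) s; rewrite r0 rT s0 (le_trans (ltW sr) rT).
have rs : 0 <= rho w - s by rewrite subr_ge0 ltW.
move=> /(_ isT isT); rewrite (ger0_norm rs) => h.
have h1 : normc (y (rho w) w) <= normc (y s w) + normc (y (rho w) w - y s w).
  by have := normcD (y s w) (y (rho w) w - y s w); rewrite addrC subrK addrC.
apply: le_trans h1 _; apply: lerD; first exact: hb.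
by rewrite ltW // h //; lra.
Qed.

Lemma stop_rcs (f : R -> Omega -> R) : (forall w, cadlag_path T (f^~ w)) ->
  forall w, rcs T (f^~ w).
Proof. by move=> h w; exact: right_cont_seq. Qed.

Lemma cstop_Fm (Z : R -> Omega -> R[i]) (t : R) : (forall w, ccadlag T (Z^~ w)) ->
  (forall s : R, 0 <= s <= T -> cFm F s (Z s)) -> 0 <= t <= T ->
  cFm F t (cst_stop Z t).
Proof.
move=> cZ FZ tT; split.
  apply: (stopped_Fm (M := fun t w => cRe (Z t w)) T0 hF hrho) => //.
    by move=> s /FZ[].
  by apply: stop_rcs => w; case: (cZ w).
apply: (stopped_Fm (M := fun t w => cIm (Z t w)) T0 hF hrho) => //.
  by move=> s /FZ[].
by apply: stop_rcs => w; case: (cZ w).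
Qed.

Lemma ctime_Fm (Z : R -> Omega -> R[i]) (t : R) : (forall w, ccadlag T (Z^~ w)) ->
  (forall s : R, 0 <= s <= T -> cFm F s (Z s)) -> 0 <= t <= T ->
  cFm F t (fun w => ctime_integral (Z^~ w) t).
Proof.
move=> cZ FZ tT; split => /=.
  apply: (integral_Fm (M := fun t w => cRe (Z t w)) hF) => //.
    by move=> s /FZ[].
  by move=> w; case: (cZ w).
apply: (integral_Fm (M := fun t w => cIm (Z t w)) hF) => //.
  by move=> s /FZ[].
by move=> w; case: (cZ w).
Qed.

Lemma cFm_meas (t : R) (f : Omega -> R[i]) : 0 <= t <= T -> cFm F t f -> cmeas setT f.
Proof. by move=> tT [f1 f2]; split; [exact: (Fm_meas hF tT f1)|exact: (Fm_meas hF tT f2)]. Qed.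

Lemma cFmB (t : R) (f h : Omega -> R[i]) : cFm F t f -> cFm F t h ->
  cFm F t (fun w => f w - h w).
Proof.
move=> hf hh; have := cmeasD hf (cmeasM (cmeas_cst _ (-1)) hh).
by congr cmeas; apply/funext => w; rewrite mulN1r.
Qed.

Lemma Fg (t : R) : 0 <= t <= T -> cFm F t (g t).
Proof.
move=> tT; apply: cmeasM; first exact: (cmeas_exp (Fy tT)).
apply: cFmB; last exact: (cmeasM (Fy tT) (FA tT)).
apply: cmeasD; first exact: (FA tT).
by apply: cmeasM; [exact: cmeas_cst|exact: (FB tT)].
Qed.

Lemma y_stop_cbm (t : R) : 0 <= t <= T -> cbm P setT (cst_stop y t).
Proof.
move=> tT; apply/cbmP; split; first exact: (cFm_meas tT (cstop_Fm cy Fy tT)).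
by exists c0; apply: filterS y_stop_bound => w h _; exact: h.
Qed.

Lemma ctime_stop_norm (f : R -> Omega -> R[i]) C w (t : R) : (forall w, ccadlag T (f^~ w)) ->
  0 <= C -> (forall s, 0 <= s -> s < rho w -> normc (f s w) <= C) -> 0 <= t <= T ->
  normc (cst_stop (fun t w => ctime_integral (f^~ w) t) t w) <= 2 * C * T.
Proof.
move=> cf C0 hC /andP[t0 tT].
have := ctime_stop_le cf hC C0 (lexx 0) t0 tT.
rewrite /cst_stop (@min_l _ _ 0 (rho w)) ?ctime0 ?subr0; last by case/andP: (rho_itv w).
move=> h; apply: le_trans h _; apply: ler_wpM2l => //; by rewrite mulr_ge0.
Qed.

Lemma ctime_stop_cbm (f : R -> Omega -> R[i]) C (t : R) : (forall w, ccadlag T (f^~ w)) ->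
  (forall s : R, 0 <= s <= T -> cFm F s (f s)) -> 0 <= C ->
  (forall w s, 0 <= s -> s < rho w -> normc (f s w) <= C) -> 0 <= t <= T ->
  cbm P setT (cst_stop (fun t w => ctime_integral (f^~ w) t) t).
Proof.
move=> cf Ff C0 hC tT; apply/cbmP; split.
  apply: (cFm_meas tT); apply: cstop_Fm => //.
    by move=> w; apply: ctime_cadlag; exact: cf.
  by move=> s sT; exact: ctime_Fm.
by exists (2 * C * T); apply: aeW => w _; exact: (ctime_stop_norm cf C0 (hC w) tT).
Qed.

Let Ja := cst_stop (fun t w => ctime_integral (A^~ w) t).
Let Jb := cst_stop (fun t w => ctime_integral (B^~ w) t).
Let K := cst_stop (fun t w => ctime_integral (g^~ w) t).
Let ys := cst_stop y.

Lemma ys0 w : ys 0 w = y 0 w.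
Proof. by rewrite /ys /cst_stop min_l //; case/andP: (rho_itv w). Qed.

Lemma stop_cmartingale (Z : R -> Omega -> R[i]) C : (forall w, ccadlag T (Z^~ w)) ->
  (forall s : R, 0 <= s <= T -> cFm F s (Z s)) ->
  complex_proc (local_martingale P T F) Z ->
  {ae P, forall w, forall t : R, 0 <= t <= T -> normc (cst_stop Z t w) <= C} ->
  cmartingale P T F (cst_stop Z).
Proof.
move=> cZ FZ [l1 l2] hC; split.
  apply: (optional_stopping (M := fun t w => cRe (Z t w)) (C := C) T0 hF l1) => //.
  - by apply/(adaptedP hF) => t /FZ[].
  - by apply: stop_rcs => w; case: (cZ w).
  - by apply: filterS hC => w h t tT; exact: le_trans (normr_Re _) (h t tT).
apply: (optional_stopping (M := fun t w => cIm (Z t w)) (C := C) T0 hF l2) => //.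
- by apply/(adaptedP hF) => t /FZ[].
- by apply: stop_rcs => w; case: (cZ w).
- by apply: filterS hC => w h t tT; exact: le_trans (normr_Im _) (h t tT).
Qed.

Lemma Fy0 (t : R) : 0 <= t <= T -> cFm F t (y 0).
Proof.
move=> /andP[t0 tT]; have h0 : 0 <= (0 : R) <= T by rewrite lexx ltW.
by have [f1 f2] := Fy h0; split;
  [exact: (Fm_mono hF (lexx 0) t0 tT f1)|exact: (Fm_mono hF (lexx 0) t0 tT f2)].
Qed.

Lemma y0_bound : {ae P, forall w, normc (y 0 w) <= c0}.
Proof. by apply: filterS y0 => w ->; rewrite lerDr. Qed.

Lemma M_stop_bound : {ae P, forall w, forall t : R, 0 <= t <= T ->
  normc (cst_stop (fun t w => y t w - y 0 w - ctime_integral (A^~ w) t) t w) <= c}.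
Proof.
apply: filterS2 y_stop_bound y0_bound => w h1 h2 t tT.
have hA s : 0 <= s -> s < rho w -> normc (A s w) <= k by move=> s0 /(hk s0)[].
have h3 := ctime_stop_norm cA k0 hA tT.
have h4 := h1 t tT; rewrite /cst_stop in h3 h4 *.
have := normcB (y (Num.min t (rho w)) w - y 0 w) (ctime_integral (A^~ w) (Num.min t (rho w))).
have := normcB (y (Num.min t (rho w)) w) (y 0 w).
rewrite /c; move: k0; lra.
Qed.

Lemma N_stop_bound : {ae P, forall w, forall t : R, 0 <= t <= T ->
  normc (cst_stop (fun t w => y t w ^+ 2 - y 0 w ^+ 2 - ctime_integral (B^~ w) t) t w) <=
    c0 ^+ 2 + c0 ^+ 2 + 2 * k * T}.
Proof.
apply: filterS2 y_stop_bound y0_bound => w h1 h2 t tT.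
have hB s : 0 <= s -> s < rho w -> normc (B s w) <= k by move=> s0 /(hk s0)[].
have h3 := ctime_stop_norm cB k0 hB tT.
have h4 := h1 t tT; rewrite /cst_stop in h3 h4 *.
apply: le_trans (normcB _ _) _; apply: lerD => //.
apply: le_trans (normcB _ _) _; rewrite !normcX.
by apply: lerD; rewrite ler_pXn2r ?nnegrE ?normc_ge0 ?c0_ge0.
Qed.

Let L := 2 * (k * (expR (3 * c0) * (2 + c0) + expR c0)).

(** Before [rho] the integrands are those compared in [drift_lip]; after [rho]
    the stopped integrals do not move. *)
Lemma drift_estimate : {ae P, forall w, forall p q e : R, 0 <= p -> p <= q -> q <= T ->
  (forall r : R, p <= r <= q -> normc (ys r w - ys p w) <= e) ->
  normc (cexp (ys p w) * ((1 - ys p w) * (Ja q w - Ja p w) +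
     2^-1 * (Jb q w - Jb p w)) - (K q w - K p w)) <= L * e * (q - p)}.
Proof.
apply: filterS y_stop_bound => w hb p q e p0 pq qT he.
have pT : 0 <= p <= T by rewrite p0 (le_trans pq).
have qT' : 0 <= q <= T by rewrite qT (le_trans p0).
have /andP[p'0 p'T] := min_itv w pT; have /andP[q'0 q'T] := min_itv w qT'.
have p'q' := min_le2 w pq.
rewrite /Ja /Jb /K /cst_stop (ctime_diff (cA w) p'0 p'q' q'T).
rewrite (ctime_diff (cB w) p'0 p'q' q'T) (ctime_diff (cg w) p'0 p'q' q'T).
set p' := Num.min p _ in p'0 p'T p'q' *; set q' := Num.min q _ in q'0 q'T p'q' *.
have mI : measurable (`]p', q']%classic : set R) by exact: measurable_itv.
have If := itv_oc_fin p' q'.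
have bA := ccadlag_cbm (cA w) p'0 q'T; have bB := ccadlag_cbm (cB w) p'0 q'T.
have bg := ccadlag_cbm (cg w) p'0 q'T.
set a := ys p w.
pose f (r : R) := cexp a * ((1 - a) * A r w + 2^-1 * B r w) - g r w.
have cf : ccadlag T f.
  apply: ccadlagB; last exact: cg.
  apply: ccadlagM; first exact: ccadlag_cst.
  by apply: ccadlagD; apply: ccadlagM; do ?[exact: ccadlag_cst|exact: cA|exact: cB].
have -> : cexp a * ((1 - a) * cint (@lebesgue_measure R) `]p', q'] (A^~ w) +
    2^-1 * cint (@lebesgue_measure R) `]p', q'] (B^~ w)) -
    cint (@lebesgue_measure R) `]p', q'] (g^~ w) = cint (@lebesgue_measure R) `]p', q'] f.
  rewrite (@cintB _ _ _ (@lebesgue_measure R) _ mI If) //; last first.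
    by apply: cbmZ; apply: cbmD; exact: cbmZ.
  rewrite (@cintZ _ _ _ (@lebesgue_measure R) _ mI If); last by apply: cbmD; exact: cbmZ.
  rewrite (@cintD _ _ _ (@lebesgue_measure R) _ mI If); do ?exact: cbmZ.
  by rewrite !(@cintZ _ _ _ (@lebesgue_measure R) _ mI If).
have e0 : 0 <= e.
  by apply: le_trans (he p _); [exact: normc_ge0|rewrite lexx].
have L1 : 0 <= k * (expR (3 * c0) * (2 + c0) + expR c0).
  by rewrite mulr_ge0 // addr_ge0 ?expR_ge0 // mulr_ge0 ?expR_ge0 // addr_ge0 // c0_ge0.
apply: le_trans (cint_le_length (C := k * (expR (3 * c0) * (2 + c0) + expR c0) * e)
   cf p'0 p'q' q'T _) _; last first.
  rewrite /L !mulrA; apply: ler_wpM2l; last exact: min_sub.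
  by rewrite -!mulrA mulr_ge0 // mulrA mulr_ge0.
move=> r /andP[pr rq].
have rr : r < rho w by apply: lt_le_trans rq _; rewrite ge_min lexx orbT.
have r0 : 0 <= r by exact: le_trans pr.
have pp' : p' = p.
  rewrite /p'; apply: min_l; rewrite leNgt; apply/negP => h.
  by move: pr; rewrite /p' min_r ?(ltW h) // => /(lt_le_trans rr); rewrite ltxx.
have rq' : r <= q by apply: le_trans (ltW rq) _; rewrite ge_min lexx.
have yr : ys r w = y r w by rewrite /ys /cst_stop min_l // ltW.
have [hy hA hB] := hk r0 rr.
rewrite /f /g; apply: drift_lip => //.
- exact: hb.
- exact: le_trans hy k_c0.
- by rewrite -yr; apply: he; rewrite -{1}pp' pr.
Qed.

Lemma exp_stopped_mean (s t : R) (G : set Omega) : 0 <= s -> s <= t -> t <= T -> F s G ->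
  cint P setT (fun w => (\1_G w)%:C *
    (cexp (ys t w) - cexp (ys s w) - (K t w - K s w))) = 0.
Proof.
move=> s0 st tT sG.
have cM w : ccadlag T (fun t => y t w - y 0 w - ctime_integral (A^~ w) t).
  apply: ccadlagB; last by apply: ctime_cadlag; exact: cA.
  by apply: ccadlagB; [exact: cy|exact: ccadlag_cst].
have cN w : ccadlag T (fun t => y t w ^+ 2 - y 0 w ^+ 2 - ctime_integral (B^~ w) t).
  apply: ccadlagB; last by apply: ctime_cadlag; exact: cB.
  apply: ccadlagB; last exact: ccadlag_cst.
  by under eq_fun do rewrite expr2; apply: ccadlagM; exact: cy.
have FM (r : R) : 0 <= r <= T ->
    cFm F r (fun w => y r w - y 0 w - ctime_integral (A^~ w) r).
  move=> rT; apply: cFmB; last exact: ctime_Fm.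
  by apply: cFmB; [exact: Fy|exact: Fy0].
have FN (r : R) : 0 <= r <= T ->
    cFm F r (fun w => y r w ^+ 2 - y 0 w ^+ 2 - ctime_integral (B^~ w) r).
  move=> rT; apply: cFmB; last exact: ctime_Fm.
  apply: cFmB; under eq_fun do rewrite expr2.
    exact: (cmeasM (Fy rT) (Fy rT)).
  exact: (cmeasM (Fy0 rT) (Fy0 rT)).
have mM := stop_cmartingale cM FM lM M_stop_bound.
have mN := stop_cmartingale cN FN lN N_stop_bound.
have hA w s' : 0 <= s' -> s' < rho w -> normc (A s' w) <= k by move=> h /(hk h)[].
have hB w s' : 0 <= s' -> s' < rho w -> normc (B s' w) <= k by move=> h /(hk h)[].
have C0 : 0 <= expR k * (k + 2^-1 * k + k * k).
  by rewrite mulr_ge0 ?expR_ge0 // !addr_ge0 ?mulr_ge0 ?invr_ge0.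
have L0 : 0 <= L.
  rewrite mulr_ge0 // mulr_ge0 // addr_ge0 ?expR_ge0 // mulr_ge0 ?expR_ge0 //.
  by rewrite addr_ge0 // c0_ge0.
apply: (ito_increment
  (N := cst_stop (fun t w => y t w ^+ 2 - y 0 w ^+ 2 - ctime_integral (B^~ w) t))
  (M := cst_stop (fun t w => y t w - y 0 w - ctime_integral (A^~ w) t))
  (Ja := Ja) (Jb := Jb) (c := c) (L := L) T0 hF) => //.
- by move=> r w; rewrite ys0.
- by move=> r w; rewrite ys0.
- by move=> r rT; apply: filterS M_stop_bound => w h; exact: h.
- by apply: filterS y_stop_bound => w h r rT; exact: le_trans (h r rT) c0_c.
- by move=> r rT; exact: y_stop_cbm.
- by move=> r rT; exact: (ctime_stop_cbm (C := k)).
- by move=> r rT; exact: (ctime_stop_cbm (C := k)).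
- by move=> r rT; exact: (ctime_stop_cbm cg Fg C0 g_bound).
- by move=> r rT; exact: cstop_Fm.
- apply: aeW => w p q p0 pq qT.
  apply: le_trans (ctime_stop_le cA (hA w) k0 p0 pq qT) _.
  apply: ler_wpM2r; first by rewrite subr_ge0.
  have := c0_ge0; have : 0 <= k * T by rewrite mulr_ge0 // ltW.
  rewrite /c; lra.
- apply: filterS y_uniform => w h e e0; have [d d0 hd] := h e e0; exists d => // p q pT qT pq.
  apply: hd; [exact: min_itv|exact: min_itv|].
  apply: le_lt_trans pq; wlog le_pq : p q pT qT / p <= q => [hw|].
    case: (leP p q) => h'; first exact: hw.
    by rewrite distrC [leRHS]distrC; apply: hw => //; exact: ltW.
  rewrite distrC [leRHS]distrC !ger0_norm ?subr_ge0 //; first exact: min_sub.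
  exact: min_le2.
- exact: drift_estimate.
- exact: c_ge0'.
Qed.

End OneExponential.

(** * Hitting times and localization *)

Lemma cReZ {R : realType} (x : R) (z : R[i]) : cRe (x%:C * z) = x * cRe z.
Proof. by case: z => u v /=; rewrite mul0r subr0. Qed.

Lemma cImZ {R : realType} (x : R) (z : R[i]) : cIm (x%:C * z) = x * cIm z.
Proof. by case: z => u v /=; rewrite mul0r addr0. Qed.

Section Hitting.
Context {R : realType} {dO : measure_display} {Omega : measurableType dO}.
Variables (T : R) (F : R -> set (set Omega)).
Hypotheses (T0 : 0 < T) (hF : right_continuous_filtration T F).
Variable H : R -> Omega -> R.
Hypothesis FH : forall t : R, 0 <= t <= T -> Fm F t (H t).
Hypothesis cH : forall w, cadlag_path T (H^~ w).
Implicit Types (k s t : R).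

(** The horizon belongs to the set, so that the infimum exists and is [T] when
    the level is never exceeded. *)
Definition hit_set k w : set R := [set s | 0 <= s <= T /\ k < H s w] `|` [set T].
Definition hit k w : R := inf (hit_set k w).

Lemma hit_set_lb k w : lbound (hit_set k w) 0.
Proof. by move=> s [[/andP[-> _] _]|->] //; exact: ltW. Qed.

Lemma hit_setT k w : hit_set k w T. Proof. by right. Qed.

Lemma hit_le k w s : hit_set k w s -> hit k w <= s.
Proof. by move=> hs; apply: ge_inf => //; exists 0; exact: hit_set_lb. Qed.

Lemma hit_itv k w : 0 <= hit k w <= T.
Proof.
apply/andP; split; last exact: hit_le (hit_setT k w).
by apply: lb_le_inf; [exists T; exact: hit_setT|exact: hit_set_lb].
Qed.

Lemma hit_lt k w s : 0 <= s -> s < hit k w -> H s w <= k.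
Proof.
move=> s0 sh; rewrite leNgt; apply/negP => h; move: (sh); rewrite ltNge => /negP; apply.
apply: hit_le; left; split => //; rewrite s0 /=.
by apply: le_trans (ltW sh) _; case/andP: (hit_itv k w).
Qed.

Lemma hit_mono k k' w : k <= k' -> hit k w <= hit k' w.
Proof.
move=> kk; apply: lb_le_inf; first by exists T; exact: hit_setT.
move=> s [[sT hs]|->]; apply: hit_le; last exact: hit_setT.
by left; split => //; exact: le_lt_trans hs.
Qed.

Lemma hit_eq_T k w : (forall s, 0 <= s <= T -> H s w <= k) -> hit k w = T.
Proof.
move=> h; apply/eqP; rewrite eq_le; have /andP[_ -> /=] := hit_itv k w.
apply: lb_le_inf; first by exists T; exact: hit_setT.
by move=> s [[sT hs]|->] //; have := h s sT; rewrite leNgt hs.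
Qed.

(** Exceeding the level before a time [s] is witnessed at a grid point, by
    right continuity, so it is known at time [s]; right continuity of the
    filtration passes to the closed event. *)
Lemma hit_stopping k : stopping_time T F (hit k).
Proof.
split=> [w|t tT]; first exact: hit_itv.
have [_ _ _ rcF] := hF.
case: (ltP t T) => tT'; last first.
  rewrite (_ : [set _ | _] = setT); first exact: (FmT hF tT).
  by apply/seteqP; split => // w _ /=; apply: le_trans tT'; case/andP: (hit_itv k w).
have /andP[t0 _] := tT.
apply: rcF; first by rewrite t0.
move=> s /andP[ts sT].
have s0 : 0 <= s by lra.
have sT' : 0 <= s <= T by rewrite s0.
(* Times decreasing to [t], all at most [s]: the event is tested strictly
   before each of them. *)
pose r (j : nat) : R := t + (s - t) / j.+1%:R.
have r_gt j : t < r j by rewrite /r ltrDl divr_gt0 // subr_gt0.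
have r_le j : r j <= s.
  rewrite /r -lerBrDl ler_pdivrMr ?ltr0n // ler_peMr ?subr_ge0 ?(ltW ts) //.
  by rewrite ler1n.
pose V (j N i : nat) : set Omega :=
  if gpt T N i < r j then [set w | k < H (gpt T N i) w] else set0.
have FV j N i : F s (V j N i).
  rewrite /V; case: ifP => hg; last exact/(F_measurable hF _ sT').
  have g0 : 0 <= gpt T N i by apply: gpt_ge0; exact: ltW.
  have gs : gpt T N i <= s by apply: le_trans (ltW hg) (r_le j).
  have gT : 0 <= gpt T N i <= T by rewrite g0 (le_trans gs).
  apply: (F_mono hF g0 gs sT).
  rewrite (_ : [set _ | _] = ~` [set w | H (gpt T N i) w <= k]).
    by apply: (FmC hF gT); apply: (Fm_le hF _ gT); exact: FH.
  by apply/seteqP; split => w /=; rewrite ltNge => /negP.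
rewrite (_ : [set _ | _] = \bigcap_j \bigcup_N \bigcup_i V j N i).
  apply/(F_measurable hF _ sT'); apply: bigcapT_measurable => j.
  apply: bigcupT_measurable => N; apply: bigcupT_measurable => i.
  by apply/(F_measurable hF _ sT').
apply/seteqP; split => w /=.
  move=> ht j _.
  have [q hq qr] : exists2 q, hit_set k w q & q < r j.
    apply: inf_lt; last exact: le_lt_trans ht (r_gt j).
    by exists T; exact: hit_setT.
  have qT : q < T by apply: lt_le_trans qr (le_trans (r_le j) sT).
  have [q0T kq] : 0 <= q <= T /\ k < H q w.
    by case: hq => // E; rewrite E ltxx in qT.
  have /andP[q0 _] := q0T.
  have gc := gup_cvg T0 q0.
  have hc : H (gup T N q) w @[N --> \oo] --> H q w.
    apply: (right_cont_seq (cH w) q0T _ gc) => N.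
    by rewrite gup_ge //= gup_le_t.
  have [N [h1 h2]] : exists N, k < H (gup T N q) w /\ gup T N q < r j.
    have n1 : \forall N \near \oo, k < H (gup T N q) w by apply: (cvgr_gt _ hc).
    have n2 : \forall N \near \oo, gup T N q < r j by apply: (cvgr_lt _ gc).
    have [N _ hN] := filterI n1 n2; exists N; exact: hN (leqnn N).
  exists N => //; exists (gidx T N q) => //.
  by rewrite /V -/(gup T N q) h2.
move=> h; rewrite leNgt; apply/negP => th.
have hl : r @ \oo --> t.
  rewrite -[t in X in _ --> X]addr0 -(mulr0 (s - t)); apply: cvgD; first exact: cvg_cst.
  apply: cvgM; first exact: cvg_cst.
  exact: cvg_harmonic.
have [j _ hj] : \forall j \near \oo, r j < hit k w by apply: (cvgr_lt _ hl).
have [N _ [i _]] := h j I; rewrite /V; case: ifP => // hg /= hk.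
have g0 : 0 <= gpt T N i by apply: gpt_ge0; exact: ltW.
have : gpt T N i < hit k w by apply: lt_trans hg _; exact: hj (leqnn j).
by move=> /(hit_lt g0); rewrite leNgt hk.
Qed.

End Hitting.

Section Family.
Context {R : realType} {dO : measure_display} {Omega : measurableType dO}.
Variables (P : probability Omega R) (T : R) (F : R -> set (set Omega)).
Hypotheses (T0 : 0 < T) (hF : right_continuous_filtration T F).
Variables (n : nat) (a : 'I_n -> R[i]) (y A B : 'I_n -> R -> Omega -> R[i]).
Hypotheses (cy : forall i w, ccadlag T ((y i)^~ w))
  (cA : forall i w, ccadlag T ((A i)^~ w)) (cB : forall i w, ccadlag T ((B i)^~ w)).
Hypotheses (Fy : forall i (t : R), 0 <= t <= T -> cFm F t (y i t))
  (FA : forall i (t : R), 0 <= t <= T -> cFm F t (A i t))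
  (FB : forall i (t : R), 0 <= t <= T -> cFm F t (B i t)).
Hypothesis lM : forall i, complex_proc (local_martingale P T F)
  (fun t w => y i t w - y i 0 w - ctime_integral ((A i)^~ w) t).
Hypothesis lN : forall i, complex_proc (local_martingale P T F)
  (fun t w => y i t w ^+ 2 - y i 0 w ^+ 2 - ctime_integral ((B i)^~ w) t).
Hypothesis ycont : forall i, {ae P, forall w,
  {within `[0, T], continuous (fun t => cRe (y i t w))} /\
  {within `[0, T], continuous (fun t => cIm (y i t w))}}.
Variable x0 : 'I_n -> R[i].
Hypothesis y0 : forall i, {ae P, forall w, y i 0 w = x0 i}.

Let g i s w := cexp (y i s w) * (A i s w + 2^-1 * B i s w - y i s w * A i s w).
Let H t w := \sum_(i < n) (norm1 (y i t w) + norm1 (A i t w) + norm1 (B i t w)).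
Let Z t w := \sum_(i < n) a i * cexp (y i t w) - \sum_(i < n) a i * cexp (y i 0 w) -
  ctime_integral (fun s => \sum_(i < n) a i * g i s w) t.

Lemma cadlag_norm1 (f : R -> R[i]) : ccadlag T f -> cadlag_path T (fun t => norm1 (f t)).
Proof.
move=> [f1 f2]; apply: cadlagD; apply: cadlag_comp => //; exact: norm_continuous.
Qed.

Lemma H_cadlag w : cadlag_path T (H^~ w).
Proof.
apply: cadlag_sum => i; apply: cadlagD; last by apply: cadlag_norm1; exact: cB.
by apply: cadlagD; apply: cadlag_norm1; [exact: cy|exact: cA].
Qed.

Lemma Fm_norm1 (t : R) f : cFm F t f -> Fm F t (fun w => norm1 (f w)).
Proof.
move=> [f1 f2]; apply: measurable_funD; apply: measurableT_comp => //;
  exact: normr_measurable.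
Qed.

Lemma H_Fm (t : R) : 0 <= t <= T -> Fm F t (H t).
Proof.
move=> tT; apply: measurable_sum => i; apply: measurable_funD.
  by apply: measurable_funD; apply: Fm_norm1; [exact: Fy|exact: FA].
by apply: Fm_norm1; exact: FB.
Qed.

Lemma H_bound i t w k : H t w <= k ->
  [/\ normc (y i t w) <= k, normc (A i t w) <= k & normc (B i t w) <= k].
Proof.
have h1 : norm1 (y i t w) + norm1 (A i t w) + norm1 (B i t w) <= H t w.
  rewrite /H (bigD1 i) //= lerDl; apply: sumr_ge0 => j _.
  by rewrite !addr_ge0.
have := normc_le_norm1 (y i t w); have := normc_le_norm1 (A i t w).
have := normc_le_norm1 (B i t w); have := norm1_ge0 (y i t w).
have := norm1_ge0 (A i t w); have := norm1_ge0 (B i t w).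
by move=> *; split; lra.
Qed.

Lemma g_cadlag i w : ccadlag T ((g i)^~ w).
Proof. exact: (cg (cy i) (cA i) (cB i)). Qed.

Lemma g_Fm i (t : R) : 0 <= t <= T -> cFm F t (g i t).
Proof. exact: (Fg (Fy i) (FA i) (FB i)). Qed.

Lemma sum_Fm (t : R) (f : 'I_n -> Omega -> R[i]) : (forall i, cFm F t (f i)) ->
  cFm F t (fun w => \sum_(i < n) a i * f i w).
Proof.
move=> hf; rewrite /cFm; elim: (index_enum _) => [|i r IH].
  by under eq_fun do rewrite big_nil; exact: cmeas_cst.
under eq_fun do rewrite big_cons; apply: cmeasD => //.
by apply: cmeasM; [exact: cmeas_cst|exact: hf].
Qed.

Lemma Z_cadlag w : ccadlag T (Z^~ w).
Proof.
apply: ccadlagB.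
  apply: ccadlagB; last exact: ccadlag_cst.
  apply: ccadlag_sum => i; apply: ccadlagM; first exact: ccadlag_cst.
  by apply: ccadlag_exp; exact: cy.
apply: ctime_cadlag; apply: ccadlag_sum => i.
by apply: ccadlagM; [exact: ccadlag_cst|exact: g_cadlag].
Qed.

Lemma Z_Fm (t : R) : 0 <= t <= T -> cFm F t (Z t).
Proof.
move=> tT; apply: cFmB; first apply: cFmB.
- by apply: sum_Fm => i; exact: (cmeas_exp (Fy i tT)).
- by apply: sum_Fm => i; exact: (cmeas_exp (Fy0 T0 hF (Fy i) tT)).
apply: (ctime_Fm (Z := fun s w => \sum_(i < n) a i * g i s w) hF) => //.
  move=> w; apply: ccadlag_sum => i.
  by apply: ccadlagM; [exact: ccadlag_cst|exact: g_cadlag].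
by move=> s sT; apply: sum_Fm => i; exact: g_Fm.
Qed.

(** One localizing sequence serves all members of the family, so that a linear
    combination is handled on the stopped, bounded processes. *)
Lemma exp_family_local_martingale : complex_proc (local_martingale P T F) Z.
Proof.
pose rho (m : nat) := hit T H m%:R.
have hrho m : stopping_time T F (rho m) := hit_stopping T0 hF H_Fm H_cadlag m%:R.
have rho_mono m w : rho m w <= rho m.+1 w by apply: hit_mono; rewrite // ler_nat.
have rhoT : {ae P, forall w, exists m, rho m w = T}.
  apply: aeW => w; have [C hC] := cadlag_bounded (H_cadlag w).
  exists (Num.bound `|C|); apply: hit_eq_T => // s sT.
  apply: le_trans (ler_norm _) _; apply: le_trans (hC s sT) _.
  apply: le_trans (ler_norm C) _; rewrite ltW //; exact: archi_boundP.
have hk m i w s : 0 <= s -> s < rho m w ->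
    [/\ normc (y i s w) <= m%:R, normc (A i s w) <= m%:R & normc (B i s w) <= m%:R].
  by move=> s0 sr; apply: H_bound; apply: (hit_lt T0 s0).
pose Ki m i t w := ctime_integral ((g i)^~ w) (Num.min t (rho m w)).
pose ys m i t w := y i (Num.min t (rho m w)) w.
pose Zs m t w := Z (Num.min t (rho m w)) w.
have minT m t w : 0 <= t <= T -> 0 <= Num.min t (rho m w) <= T.
  by move=> tT; apply: (min_itv (hrho m)).
have ZsE m t w : 0 <= t <= T -> Zs m t w = \sum_(i < n) a i *
    (cexp (ys m i t w) - cexp (y i 0 w) - Ki m i t w).
  move=> tT; rewrite /Zs /Z (ctime_lin _ _ _ (minT m t w tT)); last first.
    by move=> i; exact: g_cadlag.
  by rewrite -!sumrB; apply: eq_bigr => i _; rewrite -!mulrBr.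
have ecbm m i (t : R) : 0 <= t <= T -> cbm P setT (fun w => cexp (ys m i t w)).
  by move=> tT; apply: cbm_exp; exact: (y_stop_cbm T0 hF (cy i) (Fy i) (ycont i) (y0 i) (hrho m) (hk m i)).
have e0cbm i : cbm P setT (fun w => cexp (y i 0 w)).
  apply: cbm_exp; apply/cbmP; split.
    have h0 : 0 <= (0 : R) <= T by rewrite lexx ltW.
    exact: (cFm_meas hF h0 (Fy i h0)).
  by exists (normc (x0 i)); apply: filterS (y0 i) => w -> _.
have Kcbm m i (t : R) : 0 <= t <= T -> cbm P setT (Ki m i t).
  move=> tT; have m0 : (0 : R) <= m%:R by [].
  have C0 : 0 <= expR m%:R * (m%:R + 2^-1 * m%:R + m%:R * m%:R) :> R.
    by rewrite mulr_ge0 ?expR_ge0 // !addr_ge0 ?mulr_ge0 ?invr_ge0.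
  exact: (ctime_stop_cbm P T0 hF (hrho m) (g_cadlag i) (g_Fm i) C0 (g_bound (hk m i)) tT).
have Zcbm m (t : R) : 0 <= t <= T -> cbm P setT (Zs m t).
  move=> tT; have : cbm P setT (fun w => \sum_(i < n) a i *
      (cexp (ys m i t w) - cexp (y i 0 w) - Ki m i t w)).
    apply: cbm_sum => i; apply: cbmZ; apply: cbmB; last exact: Kcbm.
    by apply: cbmB => //; exact: ecbm.
  by congr cbm; apply/funext => w; rewrite ZsE.
have mT := @measurableT _ Omega; have Pf := PT_fin P.
have mean m (s t : R) G : 0 <= s -> s <= t -> t <= T -> F s G ->
    cint P setT (fun w => (\1_G w)%:C * (Zs m t w - Zs m s w)) = 0.
  move=> s0 st' tT sG; have sT : 0 <= s <= T by lra.
  have tT' : 0 <= t <= T by lra.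
  have bG : cbm P setT (fun w => (\1_G w)%:C).
    by apply: cbm_real; apply: bm_indic; exact: (F_sub hF sT sG).
  have bi i : cbm P setT (fun w => (\1_G w)%:C *
      (cexp (ys m i t w) - cexp (ys m i s w) - (Ki m i t w - Ki m i s w))).
    apply: cbmM => //; apply: cbmB; apply: cbmB;
      by [exact: ecbm|exact: Kcbm].
  transitivity (cint P setT (fun w => \sum_(i < n) a i * ((\1_G w)%:C *
      (cexp (ys m i t w) - cexp (ys m i s w) - (Ki m i t w - Ki m i s w))))).
    congr (cint _ _ _); apply/funext => w; rewrite !ZsE // -sumrB mulr_sumr.
    by apply: eq_bigr => i _; ring.
  rewrite (cint_sum mT Pf) => [|i]; last exact: cbmZ.
  rewrite big1 // => i _; rewrite (cintZ mT Pf) //.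
  rewrite (exp_stopped_mean T0 hF (cy i) (cA i) (cB i) (Fy i) (FA i) (FB i) (lM i)
    (lN i) (ycont i) (y0 i) (hrho m) (hk m i) _ s0 st' tT sG) ?mulr0 //.
have key (f : R[i] -> R) m : (forall z, f z = cRe z) \/ (forall z, f z = cIm z) ->
    martingale P T F (fun t w => f (Zs m t w)).
  move=> hf.
  have bf (t : R) : 0 <= t <= T -> bm P setT (fun w => f (Zs m t w)).
    by move=> /(Zcbm m)[b1 b2]; case: hf => hf; under eq_fun do rewrite hf.
  split.
  - apply/(adaptedP hF) => t tT; have [f1 f2] := cstop_Fm T0 hF (hrho m) Z_cadlag Z_Fm tT.
    by case: hf => hf; under eq_fun do rewrite hf.
  - by move=> t tT; apply: (bm_integrable mT Pf); exact: bf.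
  move=> s t s0 st' tT G sG; have sT : 0 <= s <= T by lra.
  have tT' : 0 <= t <= T by lra.
  have mG := F_sub hF sT sG.
  have ex u : 0 <= u <= T -> (\int[P]_(w in G) (f (Zs m u w))%:E =
      (\int[P]_w (\1_G w * f (Zs m u w)))%:E)%E.
    move=> uT; rewrite -Rint_restrict /Rintegral fineK //.
    apply/integrable_fin_num => //; apply: (integrableS mT) => //.
    by apply: (bm_integrable mT Pf); exact: bf.
  rewrite (ex t tT') (ex s sT); suff E : \int[P]_w (\1_G w * f (Zs m t w)) -
      \int[P]_w (\1_G w * f (Zs m s w)) = 0 by rewrite (subr0_eq E).
  have bGf u : 0 <= u <= T -> bm P setT (fun w => \1_G w * f (Zs m u w)).
    by move=> uT; apply: bmM; [exact: bm_indic|exact: bf].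
  rewrite -(RintB mT Pf (bGf t tT') (bGf s sT)).
  have := mean m s t G s0 st' tT sG; rewrite /cint => -[h1 h2].
  case: hf => hf.
    rewrite -[RHS]h1; congr (Rintegral _ _ _); apply/funext => w.
    by rewrite !hf (cReZ (\1_G w)) (cReD (Zs m t w)) (cReN (Zs m s w)) mulrBr.
  rewrite -[RHS]h2; congr (Rintegral _ _ _); apply/funext => w.
  by rewrite !hf (cImZ (\1_G w)) (cImD (Zs m t w)) (cImN (Zs m s w)) mulrBr.
have kRe m := key (@complex.Re R) m (or_introl (fun=> erefl)).
have kIm m := key (@complex.Im R) m (or_intror (fun=> erefl)).
by split; exists rho; split; [exact: hrho|exact: rho_mono|exact: rhoT|exact: kRe
  |exact: hrho|exact: rho_mono|exact: rhoT|exact: kIm].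
Qed.

End Family.

(** * From polynomial to affine processes *)

Section Modification.
Variables (R : realType) (T : R).
Hypothesis T0 : 0 < T.

(** Every time is a limit from the right of grid points, and [T] itself is a
    grid point. *)
Lemma cadlag_eq_continuous (f h : R -> R) : cadlag_path T f ->
  {within `[0, T], continuous h} ->
  (forall N i, (i <= N.+1)%N -> f (gpt T N i) = h (gpt T N i)) -> {within `[0, T], continuous f}.
Proof.
move=> cf ch fh; apply: (subspace_eq_continuous _ ch) => t; rewrite inE /= in_itv /= => tT.
have /andP[t0 _] := tT.
have gT N : t <= gup T N t <= T by rewrite gup_ge //= gup_le_t.
have l1 := right_cont_seq cf tT gT (gup_cvg T0 t0).
have l2 : h (gup T N t) @[N --> \oo] --> h t.
  apply/cvgrPdist_lt => e e0; have [d d0 hd] := continuous_uniform ch e0.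
  have /cvgrPdist_lt /(_ d d0) := gup_cvg T0 t0.
  apply: filterS => N hN; apply: hd => //.
  by have /andP[h1 ->] := gT N; rewrite (le_trans t0 h1).
have E : (fun N => f (gup T N t)) = fun N => h (gup T N t).
  by apply/funext => N; apply: fh; exact: gidx_max.
move: l1; rewrite E => l1.
exact: (cvg_unique _ l2 l1).
Qed.

End Modification.

Section PolynomialAffine.
Context {R : realType} {d : nat} {S : set 'rV[R]_d} {Pi : nat -> set (word d)}.
Hypothesis hPi : shuffle_partition R Pi.
Context {dO : measure_display} {Omega : measurableType dO}.
Variables (P : probability Omega R) (T : R) (F : R -> set (set Omega)).
Hypotheses (T0 : 0 < T) (hF : right_continuous_filtration T F).
Variables (U : set (ctensor R d)) (Lm : ctensor R d -> ctensor R d).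
Hypotheses (Ud : U `<=` dual S Pi) (Ld : forall u, U u -> dual S Pi (Lm u))
  (UU : forall u, U u -> U (cshuffle u u)).

(** With [y], [A] and [B] the pairings of [u], [Lm u] and [Lm (cshuffle u u)],
    the pairing is [A + (B - 2 y A) / 2]: half the density of the bracket of [y]
    is added to the drift. *)
Definition carre u : ctensor R d := fun K =>
  Lm u K + 2^-1 * Lm (cshuffle u u) K - cshuffle u (Lm u) K.

Lemma carreE u : carre u = fun K => -1 * cshuffle u (Lm u) K +
  (2^-1 * Lm (cshuffle u u) K + Lm u K).
Proof. by apply/funext => K; rewrite /carre; ring. Qed.

Lemma carre_dual u : U u -> dual S Pi (carre u).
Proof.
move=> Uu; rewrite carreE; apply: (dual_lin hPi).
  by apply: (dual_shuffle hPi); [exact: Ud|exact: Ld].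
by apply: (dual_lin hPi); apply: Ld => //; exact: UU.
Qed.

Lemma carre_pairing u (x : state S) : U u -> pairing (carre u) x =
  pairing (Lm u) x + 2^-1 * pairing (Lm (cshuffle u u)) x - pairing u x * pairing (Lm u) x.
Proof.
move=> Uu; have d1 := Ud Uu; have d2 := Ld Uu; have d3 := Ld (UU Uu).
rewrite carreE (dual_pairing_lin hPi (-1) x (dual_shuffle hPi d1 d2) (dual_lin hPi 2^-1 d3 d2)).
by rewrite (dual_pairing_lin hPi 2^-1 x d3 d2) (dual_pairing_shuffle hPi x d1 d2); ring.
Qed.

Variables (X Y : R -> Omega -> state S).
Hypothesis Xcont : continuous_process P T U X.
Hypothesis YX : version P T X Y.
Hypothesis X0 : exists x : state S, {ae P, forall w, sval (X 0 w) = sval x}.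

Lemma pairing_sval u (x z : state S) : sval x = sval z -> pairing u x = pairing u z.
Proof. by rewrite /pairing => ->. Qed.

(** A version agrees with the process almost surely at all grid points at once,
    since they are countably many; right continuity determines the rest of the
    path. *)
Lemma version_continuous u : U u ->
  (forall w, ccadlag T (fun t => pairing u (Y t w))) ->
  {ae P, forall w,
    {within `[0, T], continuous (fun t => cRe (pairing u (Y t w)))} /\
    {within `[0, T], continuous (fun t => cIm (pairing u (Y t w)))}}.
Proof.
move=> Uu cY; have [_ hYX] := YX.
have grid : {ae P, forall w N i, (i <= N.+1)%N ->
    sval (Y (gpt T N i) w) = sval (X (gpt T N i) w)}.
  apply: ae_foralln => N; apply: ae_foralln => i.
  case: (leqP i N.+1) => iN; last by apply: aeW => w.
  apply: filterS (hYX (gpt T N i) _) => [w h _ //|].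
  by rewrite (gpt_ge0 N i (ltW T0)) (gpt_le_t (ltW T0) iN).
apply: filterS2 grid (Xcont Uu) => w hg [h1 h2]; have [c1 c2] := cY w.
by split; [apply: (cadlag_eq_continuous T0 c1 h1)|apply: (cadlag_eq_continuous T0 c2 h2)]
  => N i iN; rewrite (pairing_sval u (hg N i iN)).
Qed.

Hypothesis YL : forall u, U u ->
  [/\ complex_proc (adapted T F) (fun t w => pairing u (Y t w)),
      complex_proc (cadlag T) (fun t w => pairing u (Y t w)),
      complex_proc (adapted T F) (fun t w => pairing (Lm u) (Y t w)),
      complex_proc (cadlag T) (fun t w => pairing (Lm u) (Y t w)) &
      complex_proc (local_martingale P T F) (fun t w =>
        pairing u (Y t w) - pairing u (Y 0 w) -
        ctime_integral (fun s => pairing (Lm u) (Y s w)) t)].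

Lemma proc_cFm (M : R -> Omega -> R[i]) : complex_proc (adapted T F) M ->
  forall t : R, 0 <= t <= T -> cFm F t (M t).
Proof.
by move=> [/(adaptedP hF) h1 /(adaptedP hF) h2] t tT; split; [exact: (h1 t tT)|exact: (h2 t tT)].
Qed.

Lemma cFm_proc (M : R -> Omega -> R[i]) :
  (forall t : R, 0 <= t <= T -> cFm F t (M t)) -> complex_proc (adapted T F) M.
Proof.
by move=> h; split; apply/(adaptedP hF) => t /h[].
Qed.

Lemma proc_ccadlag (M : R -> Omega -> R[i]) : complex_proc (cadlag T) M ->
  forall w, ccadlag T (M^~ w).
Proof. by move=> [h1 h2] w; split; [exact: h1|exact: h2]. Qed.

Lemma ccadlag_proc (M : R -> Omega -> R[i]) : (forall w, ccadlag T (M^~ w)) ->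
  complex_proc (cadlag T) M.
Proof. by move=> h; split=> w; case: (h w). Qed.

(** The pairing of [cshuffle u u] is the square of that of [u], so the
    polynomial martingale problem provides the compensators of both [y] and its
    square. *)
Lemma polynomial_solves_exp (n : nat) (c : 'I_n -> R[i]) (u : 'I_n -> ctensor R d)
    (f g : state S -> R[i]) : (forall i, U (u i)) ->
  f = (fun x => \sum_(i < n) c i * exp_pairing (u i) x) ->
  g = (fun x => \sum_(i < n) c i * (exp_pairing (u i) x * pairing (carre (u i)) x)) ->
  [/\ complex_proc (adapted T F) (fun t w => f (Y t w)),
      complex_proc (cadlag T) (fun t w => f (Y t w)),
      complex_proc (adapted T F) (fun t w => g (Y t w)),
      complex_proc (cadlag T) (fun t w => g (Y t w)) &
      complex_proc (local_martingale P T F) (fun t w =>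
        f (Y t w) - f (Y 0 w) - ctime_integral (fun s => g (Y s w)) t)].
Proof.
move=> Uu fE gE.
pose y i t w := pairing (u i) (Y t w).
pose A i t w := pairing (Lm (u i)) (Y t w).
pose B i t w := pairing (Lm (cshuffle (u i) (u i))) (Y t w).
have fE' t w : f (Y t w) = \sum_(i < n) c i * cexp (y i t w) by rewrite fE.
have gE' t w : g (Y t w) = \sum_(i < n) c i * (cexp (y i t w) *
    (A i t w + 2^-1 * B i t w - y i t w * A i t w)).
  by rewrite gE; apply: eq_bigr => i _; rewrite carre_pairing.
have cy i w : ccadlag T ((y i)^~ w).
  by have [_ h _ _ _] := YL (Uu i); exact: (proc_ccadlag h).
have cA i w : ccadlag T ((A i)^~ w).
  by have [_ _ _ h _] := YL (Uu i); exact: (proc_ccadlag h).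
have cB i w : ccadlag T ((B i)^~ w).
  by have [_ _ _ h _] := YL (UU (Uu i)); exact: (proc_ccadlag h).
have Fy i (t : R) : 0 <= t <= T -> cFm F t (y i t).
  by have [h _ _ _ _] := YL (Uu i); exact: (proc_cFm h).
have FA i (t : R) : 0 <= t <= T -> cFm F t (A i t).
  by have [_ _ h _ _] := YL (Uu i); exact: (proc_cFm h).
have FB i (t : R) : 0 <= t <= T -> cFm F t (B i t).
  by have [_ _ h _ _] := YL (UU (Uu i)); exact: (proc_cFm h).
have lM i : complex_proc (local_martingale P T F)
    (fun t w => y i t w - y i 0 w - ctime_integral ((A i)^~ w) t).
  by have [_ _ _ _ h] := YL (Uu i); exact: h.
have lN i : complex_proc (local_martingale P T F)
    (fun t w => y i t w ^+ 2 - y i 0 w ^+ 2 - ctime_integral ((B i)^~ w) t).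
  have [_ _ _ _] := YL (UU (Uu i)).
  congr complex_proc; apply/funext => t; apply/funext => w.
  have sq s : pairing (cshuffle (u i) (u i)) (Y s w) = y i s w ^+ 2.
    by rewrite (dual_pairing_shuffle hPi) -?expr2 //; exact: Ud.
  by rewrite (sq t) (sq 0).
have ycont i := version_continuous (Uu i) (cy i).
have [x hx] := X0.
have y0 i : {ae P, forall w, y i 0 w = pairing (u i) x}.
  have [_ hYX] := YX; have h0 : 0 <= (0 : R) <= T by rewrite lexx ltW.
  apply: filterS2 hx (hYX 0 h0) => w h1 h2.
  by apply: pairing_sval; rewrite h2.
have fc w : ccadlag T (fun t => \sum_(i < n) c i * cexp (y i t w)).
  apply: ccadlag_sum => i; apply: ccadlagM; first exact: ccadlag_cst.
  by apply: ccadlag_exp; exact: cy.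
have gc w : ccadlag T (fun t => \sum_(i < n) c i * (cexp (y i t w) *
    (A i t w + 2^-1 * B i t w - y i t w * A i t w))).
  apply: ccadlag_sum => i; apply: ccadlagM; first exact: ccadlag_cst.
  exact: (g_cadlag cy cA cB).
have Ef : (fun t w => f (Y t w)) = fun t w => \sum_(i < n) c i * cexp (y i t w).
  by apply/funext => t; apply/funext => w.
have Eg : (fun t w => g (Y t w)) = fun t w => \sum_(i < n) c i * (cexp (y i t w) *
    (A i t w + 2^-1 * B i t w - y i t w * A i t w)).
  by apply/funext => t; apply/funext => w.
split.
- rewrite Ef; apply: cFm_proc => t tT; apply: sum_Fm => i.
  exact: (cmeas_exp (Fy i t tT)).
- by rewrite Ef; exact: ccadlag_proc.
- rewrite Eg; apply: cFm_proc => t tT; apply: sum_Fm => i.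
  exact: (g_Fm Fy FA FB i tT).
- by rewrite Eg; exact: ccadlag_proc.
have := exp_family_local_martingale T0 hF c cy cA cB Fy FA FB lM lN ycont y0.
congr complex_proc; apply/funext => t; apply/funext => w.
rewrite !fE'; congr (_ - ctime_integral _ t); apply/funext => s.
by rewrite gE'.
Qed.

End PolynomialAffine.

Theorem proposition4p6 (R : realType) (d : nat) (S : set 'rV[R]_d)
    (Pi : nat -> set (word d)) (hPi : shuffle_partition R Pi)
    (dO : measure_display) (Omega : measurableType dO)
    (P : probability Omega R) (T : R) (hT : 0 < T)
    (F : R -> set (set Omega)) (hF : right_continuous_filtration T F)
    (X : R -> Omega -> state S) :
  (forall (U : set (ctensor R d)) (Rm : ctensor R d -> ctensor R d),
     affine_process P T F Pi U Rm X ->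
     continuous_process P T U X ->
     exists Lm : ctensor R d -> ctensor R d,
       [/\ polynomial_process P T F Pi (cspan (@shuffle_exp R d @` U)) Lm X,
           forall u, U u ->
             dual_eq S (Lm (shuffle_exp u)) (cshuffle (shuffle_exp u) (Rm u)) &
           forall u, U u ->
             (forall v, U v -> shuffle_exp v = shuffle_exp u -> Rm v = Rm u) ->
             Lm (shuffle_exp u) = cshuffle (shuffle_exp u) (Rm u)])
  /\
  (forall (U : set (ctensor R d)) (Lm : ctensor R d -> ctensor R d),
     polynomial_process P T F Pi U Lm X ->
     continuous_process P T U X ->
     (forall u, U u -> U (cshuffle u u)) ->
     let Rm : ctensor R d -> ctensor R d := fun u K =>
       Lm u K + 2^-1 * Lm (cshuffle u u) K - cshuffle u (Lm u) K in
     [/\ forall u, U u -> dual S Pi (Rm u),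
         solves_pairs P T F (affine_graph U Rm) X &
         (exists Lop : (state S -> R[i]) -> state S -> R[i],
            affine_type Pi U Rm Lop) ->
         affine_process P T F Pi U Rm X]).
Proof.
split=> [U Rm [Lop [Ud Llin Rd LR] hX] _|U Lm [Lop [Ud Ulin Llin Ld LE] hX] Xc UU Rm].
  have [h1 h2 h3] := affine_polynomial hPi Ud Rd Llin LR.
  exists (associated_map U Rm); split => //; exists Lop => //.
  by rewrite (polynomial_domain_exp hPi Ud).
have RmE : Rm = carre Lm by [].
have Rdual u : U u -> dual S Pi (Rm u) by rewrite RmE; exact: (carre_dual hPi Ud Ld UU).
have [hs hx [Y [YX hY]]] := hX.
have YL u : U u ->
  [/\ complex_proc (adapted T F) (fun t w => pairing u (Y t w)),
      complex_proc (cadlag T) (fun t w => pairing u (Y t w)),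
      complex_proc (adapted T F) (fun t w => pairing (Lm u) (Y t w)),
      complex_proc (cadlag T) (fun t w => pairing (Lm u) (Y t w)) &
      complex_proc (local_martingale P T F) (fun t w =>
        pairing u (Y t w) - pairing u (Y 0 w) -
        ctime_integral (fun s => pairing (Lm u) (Y s w)) t)].
  move=> Uu; apply: hY; split; first by exists u.
  by apply/funext => x; rewrite /= LE.
have sol : solves_pairs P T F (affine_graph U Rm) X.
  split => //; exists Y; split => // f g [n [c [u [Uu fE gE]]]].
  exact: (polynomial_solves_exp hPi hT hF Ud Ld UU Xc YX hx YL Uu fE gE).
split => //.
move=> [Lop' hLop']; exists Lop' => //.
have [_ Llin' _ LR'] := hLop'.
have [_ _ [Y' [YX' hY']]] := sol.
split => //; exists Y'; split => // f g [/= [n [c [h [hh fE]]]] gE].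
apply: hY'.
have hu i : exists u, U u /\ h i = exp_pairing u by have [u Uu ->] := hh i; exists u.
exists n, c, (fun i => projT1 (cid (hu i))).
have hP i := projT2 (cid (hu i)).
split => /=.
- by move=> i; case: (hP i).
- by rewrite fE; apply/funext => x; apply: eq_bigr => i _; case: (hP i) => _ <-.
- rewrite gE fE (linear_on_sum Llin' c hh); apply/funext => x; apply: eq_bigr => i _.
  by have [Ui hi] := hP i; rewrite {1}hi LR'.
Qed.
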